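(* Let $\varphi:[0,\pi]\to\mathbb{R}_+$ be twice continuously differentiable and increasing on $[0,\pi]$, with $\varphi'>0$ on $(0,\pi)$, and such that $0$ is an entrance boundary for the diffusion $$dX(t)=\sqrt{2}\,dB(t)+\frac{1}{\varphi'(X(t))}\,dt .$$ Start this diffusion at $X(0)=0$ and let $\tau$ be its hitting time of $\pi$. Assume that $\varphi(0)=0$ and $\min_{[0,\pi]}\varphi''>-1/3$. Then for any $r>0$, $$\mathbb{P}\left[\tau>\frac{\varphi(\pi)}{1+\min_{[0,\pi]}\varphi''}(1+r)\right]\le\frac{1}{r^2\varphi^2(\pi)\left(1+3\min_{[0,\pi]}\varphi''\right)}\int_0^\pi(\varphi'(u))^3\,du.$$
   Context: $(B(t))_{t\ge 0}$ is a standard real Brownian motion. The diffusion is defined up to the time $\tau$. ''Entrance boundary'' means that the diffusion can be started at $0$ and never returns to $0$ at positive times. *)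

(* Defs.v *)
From HB Require Import structures.
From mathcomp Require Import all_boot all_order all_algebra.
From mathcomp Require Import all_classical all_reals all_analysis.
Set Implicit Arguments.
Unset Strict Implicit.
Unset Printing Implicit Defensive.
Import Order.TTheory GRing.Theory Num.Theory.
Import numFieldNormedType.Exports.
Local Open Scope classical_set_scope.
Local Open Scope ring_scope.

Section calculus.
Context {R : realType}.
Implicit Types (D : set R) (f : R -> R).

(* Derivative relative to D: one-sided at the endpoints when D is an
   interval. *)
Definition is_derivative_on D f f' :=
  forall x, D x -> (fun y => (f y - f x) / (y - x)) @ within D x^' --> f' x.

(* f is C^2 on D, with first derivative f' and second derivative f''. *)
Definition is_C2_on D f f' f'' :=
  [/\ is_derivative_on D f f', is_derivative_on D f' f''
    & {within D, continuous f''}].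

Definition is_min_on D f m :=
  (exists2 x, D x & f x = m) /\ (forall x, D x -> m <= f x).

End calculus.

Section processes.
Context {R : realType} {d : measure_display} {T : measurableType d}.

(* Time is a real number; only the instants t >= 0 matter. *)
Definition filtration (F : R -> set (set T)) :=
  [/\ forall t, 0 <= t -> sigma_algebra setT (F t),
      forall t, 0 <= t -> F t `<=` measurable
    & forall s t, 0 <= s -> s <= t -> F s `<=` F t].

Definition adapted (F : R -> set (set T)) (X : R -> T -> R) :=
  forall t, 0 <= t -> forall U : set R, measurable U -> F t (X t @^-1` U).

Definition continuous_paths (X : R -> T -> R) :=
  forall w, {within `[0, +oo[, continuous (fun t => X t w)}.

(* Standard Brownian motion relative to the filtration F; the second parameter
   of normal_prob is the standard deviation. *)
Definition brownian_motion (P : probability T R) (F : R -> set (set T))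
    (B : R -> T -> R) :=
  [/\ adapted F B, continuous_paths B, {ae P, forall w, B 0 w = 0},
      forall s t, 0 <= s -> s < t -> forall U : set R, measurable U ->
        P [set w | U (B t w - B s w)] = normal_prob 0 (Num.sqrt (t - s)) U
    & forall s t, 0 <= s -> s < t -> forall A, F s A ->
        forall U : set R, measurable U ->
        P (A `&` [set w | U (B t w - B s w)])
          = (P A * P [set w | U (B t w - B s w)%R])%E].

Definition hitting_time (X : R -> T -> R) (a : R) (w : T) : \bar R :=
  ereal_inf [set t%:E | t in [set t : R | 0 <= t /\ X t w = a]].

(* X solves dX = sqrt 2 dB + b(X) dt from X(0) = x in the state space [0, a],
   up to its hitting time of a; the values of X after that time are irrelevant.
   The noise is additive, so the equation is a pathwise integral equation.
   The drift b is meant to be nonnegative on [0, a]: its integral is then an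
   extended real and the equation forces it to be finite.
   For b = 1 / f', MathComp's convention 0^-1 = 0 matters only when X is at a
   zero of f'; in the application these are endpoints of [0, a], where a
   solution spends a Lebesgue-null set of times almost surely. *)
Definition diffusion_from (b : R -> R) (a x : R) (P : probability T R)
    (F : R -> set (set T)) (B X : R -> T -> R) :=
  [/\ filtration F, brownian_motion P F B, adapted F X /\ continuous_paths X,
      {ae P, forall w, X 0 w = x}
    & {ae P, forall w, forall t, 0 <= t -> (t%:E <= hitting_time X a w)%E ->
        0 <= X t w <= a /\
        (X t w)%:E = ((X 0 w + Num.sqrt 2 * B t w)%:E
          + \int[lebesgue_measure]_(s in `[0%R, t]) (b (X s w))%:E)%E}].

Definition never_returns_to_0 (P : probability T R) (X : R -> T -> R) (a : R) :=
  {ae P, forall w, forall t, 0 < t -> (t%:E <= hitting_time X a w)%E ->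
    X t w != 0}.

End processes.

(* The diffusion can be started at 0 (in the weak sense, on some filtered
   probability space), and started there it never returns to 0. *)
Definition entrance_boundary_0 (R : realType) (b : R -> R) (a : R) :=
  (exists (d : measure_display) (T : measurableType d) (P : probability T R)
     (F : R -> set (set T)) (B X : R -> T -> R),
     diffusion_from b a 0 P F B X) /\
  (forall (d : measure_display) (T : measurableType d) (P : probability T R)
     (F : R -> set (set T)) (B X : R -> T -> R),
     diffusion_from b a 0 P F B X -> never_returns_to_0 P X a).

(* Main.v *)
(** Chebyshev's inequality for [tau] alone loses a factor 2; what saves it is the
    log-concavity of the tail.  Fix [0 < b < a0 < pi], reflect the generator
    [L = w'' + w' / phi'] at [b] and absorb it at [a0].  For a rate [q] close to
    a large constant [th] and a positive [A] with [L A = q A] and [A'(b) = 0],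
    the resolvent [w] of [g], [q w - L w = q g], is explicit, and iterating it
    on [1] gives [surv n x], the probability of surviving [n] rings of a clock of
    rate [q] from [x].  Total positivity makes [n |-> surv n b] log-concave and
    [surv n] nonincreasing.  A log-concave tail [G] with mean [mu] satisfies
    [G n (n - mu)^2 <= variance / 2], up to lower order terms, and the
    hypothesis on [phi''] bounds, by comparison of ordinary differential
    equations, the mean exit time by [phi(pi) / (1 + m)] and half its variance by
    the integral of [phi'^3] divided by [(1 + m)^2 (1 + 3m)].

    The survival functions are transferred to the diffusion without stochastic
    integrals.  While [X] stays in a compact part of [(0, pi)], a mixture of the
    [surv k] whose weights follow the negative binomial recursion is a
    supermartingale along Euler steps up to a cubic Taylor error: each step only
    freezes the past and integrates a Gaussian increment.  Letting the mesh tend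
    to 0, then [th] to infinity, bounds the probability that [X] remains in the
    compact from time [e] on.  As [X] never returns to 0, survival beyond [t] is,
    up to a null set, the increasing union of these events. *)

Require Import Defs.
From HB Require Import structures.
From mathcomp Require Import all_boot all_order all_algebra.
From mathcomp Require Import all_classical all_reals all_analysis measurable_realfun.
From mathcomp Require Import zify ring lra.
Set Implicit Arguments.
Unset Strict Implicit.
Unset Printing Implicit Defensive.
Import Order.TTheory GRing.Theory Num.Theory.
Import numFieldNormedType.Exports.
Local Open Scope classical_set_scope.
Local Open Scope ring_scope.

(** * Calculus on the line *)

Section calculus_lemmas.
Context {R : realType}.
Implicit Types (f g F G : R -> R) (a b x y z : R).

(** Exponential clocks replace a deterministic time because each survival function is then a
    resolvent of the preceding one, hence given by two quadratures: no semigroup and no parabolic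
    equation is needed. The rate [q] is not constant, since [A] is a partial sum of the series of
    the exact eigenfunction; it lies within 1 of [th], an error that disappears as [th] grows.
    Reflection at [b] copes with the unknown position of [X] at time [e]: it makes [b] the starting
    point with the best survival, and a path confined above [b] never meets the reflection. Among
    log-concave tails with given mean and given value at [n], the smallest variance belongs, up to
    discretisation, to a tail that is 1 and then exponential, censored at [n]; an explicit
    inequality for that tail gains the factor 2. All coefficients are extended to positive
    continuous functions on the line, so that the differential equations carry no domain conditions;
    only bounds and comparisons are restricted to intervals. *)

Lemma is_derive_continuous F x (d : R) : is_derive x 1 F d -> {for x, continuous F}.
Proof. by move=> [dF _]; exact/differentiable_continuous/derivable1_diffP. Qed.

Lemma derive_within_continuous F f a b :
  (forall z, a <= z <= b -> is_derive z 1 F (f z)) -> {within `[a, b], continuous F}.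
Proof.
move=> dF; apply: derivable_within_continuous => z zab.
by have [] : is_derive z 1 F (f z) by apply: dF; move: zab; rewrite in_itv.
Qed.

Lemma ge0_derive_le F f a b : a <= b ->
  (forall z, a <= z <= b -> is_derive z 1 F (f z)) ->
  (forall z, a < z < b -> 0 <= f z) -> F a <= F b.
Proof.
rewrite le_eqVlt => /predU1P[->//|ab] dF f0.
have dF' z : z \in `]a, b[ -> is_derive z 1 F (f z).
  by rewrite in_itv/= => /andP[? ?]; apply: dF; rewrite !ltW.
have [c cab E] := MVT ab dF' (derive_within_continuous dF).
rewrite -subr_ge0 E; apply: mulr_ge0; last by rewrite subr_ge0 ltW.
by apply: f0; move: cab; rewrite in_itv.
Qed.

Lemma le_derive_sub F f G g a b : a <= b ->
  (forall z, a <= z <= b -> is_derive z 1 F (f z)) ->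
  (forall z, a <= z <= b -> is_derive z 1 G (g z)) ->
  (forall z, a < z < b -> f z <= g z) -> F b - F a <= G b - G a.
Proof.
move=> ab dF dG fg.
suff : G a - F a <= G b - F b by lra.
apply: (@ge0_derive_le (G \- F) (g \- f)) => // z zab.
  by apply: is_deriveB; [exact: dG|exact: dF].
by rewrite subr_ge0 fg.
Qed.

Lemma eq_derive_sub F G f a b : a <= b ->
  (forall z, a <= z <= b -> is_derive z 1 F (f z)) ->
  (forall z, a <= z <= b -> is_derive z 1 G (f z)) -> F b - F a = G b - G a.
Proof.
move=> ab dF dG; apply/eqP; rewrite eq_le.
by rewrite !(le_derive_sub ab dF dG)// (le_derive_sub ab dG dF).
Qed.

Lemma primitive_right f a : continuous f ->
  exists F, forall x, a < x -> is_derive x 1 F (f x).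
Proof.
move=> cf; exists (fun x => \int[lebesgue_measure]_(t in `[a, x]) f t)%R => x ax.
have xu : x < x + 1 by rewrite ltrDl.
have intf : lebesgue_measure.-integrable `[a, x + 1] (EFin \o f).
  apply: continuous_compact_integrable; first exact: segment_compact.
  exact: continuous_subspaceT.
have [dF E] := continuous_FTC1_closed xu intf ax (cf x).
by rewrite -E derive1E; exact/derivableP.
Qed.

(** The integral from a base point is a primitive only to the right of it. Primitives valid to the
    right of [- n] and normalised at [b] agree wherever two of them are valid, so they can be
    glued. *)
Lemma primitive_exists f b : continuous f ->
  exists F, (forall x, is_derive x 1 F (f x)) /\ F b = 0.
Proof.
move=> cf.
have /choice [H dH] : forall n : nat, exists F, forall x, - n%:R < x -> is_derive x 1 F (f x).
  by move=> n; exact: primitive_right.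
pose K n x := H n x - H n b.
have dK n x : - n%:R < x -> is_derive x 1 (K n) (f x).
  move=> nx; rewrite -[f x]subr0; apply: is_deriveB; exact: dH.
have KE n m x : - n%:R < b -> - m%:R < b -> - n%:R < x -> - m%:R < x -> K n x = K m x.
  move=> nb mb nx mx.
  have [xb|/ltW bx] := leP x b.
    have := @eq_derive_sub (K n) (K m) f x b xb _ _.
    rewrite /K !subrr => E; apply: oppr_inj; rewrite -[LHS]add0r -[RHS]add0r; apply: E => z /andP[xz _].
      by apply: dK; exact: lt_le_trans xz.
    by apply: dK; exact: lt_le_trans xz.
  have := @eq_derive_sub (K n) (K m) f b x bx _ _.
  rewrite /K !subrr !subr0; apply => z /andP[xz _]; apply: dK; exact: lt_le_trans xz.
(* [- N x] lies below [b] and below a unit neighbourhood of [x], so that near [x] the glued function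
   is the single primitive [K (N x)]. *)
pose N x := (Num.truncn (`|x| + `|b| + 1)).+1.
have NP x y : `|y - x| < 1 -> - (N x)%:R < y.
  move=> yx; have : `|x| + `|b| + 1 < (N x)%:R by exact: Num.Theory.truncnS_gt.
  move: yx; rewrite ltr_norml => /andP[yx1 yx2].
  have := ler_norm (- x); rewrite normrN; have := normr_ge0 b; lra.
have Nb x : - (N x)%:R < b.
  have : `|x| + `|b| + 1 < (N x)%:R by exact: Num.Theory.truncnS_gt.
  have := ler_norm (- b); rewrite normrN; have := normr_ge0 x; lra.
exists (fun x => K (N x) x); split; last by rewrite /K subrr.
move=> x; have xN : - (N x)%:R < x by apply: NP; rewrite subrr normr0.
apply: (@near_eq_is_derive _ _ _ (K (N x))) => //; last exact: dK.
near=> y; have yx : `|y - x| < 1.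
  by rewrite distrC; near: y; exact: cvgr_dist_lt.
apply: KE => //; [exact: NP|apply: NP; by rewrite subrr normr0].
Unshelve. all: by end_near. Qed.

End calculus_lemmas.

(** * Primitives on the whole line *)

Section primitive.
Context {R : realType}.
Implicit Types (f g F G : R -> R) (a b x y z : R).

Lemma is_derive_continuousT F f : (forall x, is_derive x 1 F (f x)) -> continuous F.
Proof. by move=> dF x; exact: is_derive_continuous (dF x). Qed.

Lemma continuousMT f g : continuous f -> continuous g -> continuous (fun x => f x * g x).
Proof. by move=> cf cg x; apply: cvgM; [exact: cf|exact: cg]. Qed.

Lemma continuousCT (c : R) : continuous (fun _ : R => c).
Proof. by move=> x; exact: cst_continuous. Qed.

Lemma continuousDT f g : continuous f -> continuous g -> continuous (fun x => f x + g x).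
Proof. by move=> cf cg x; apply: cvgD; [exact: cf|exact: cg]. Qed.

Lemma continuousNT f : continuous f -> continuous (fun x => - f x).
Proof. by move=> cf x; apply: cvgN; exact: cf. Qed.

Lemma continuousVT f : (forall x, f x != 0) -> continuous f -> continuous (fun x => (f x)^-1).
Proof. by move=> f0 cf x; apply: cvgV; [exact: f0|exact: cf]. Qed.

Lemma continuousXT f n : continuous f -> continuous (fun x => f x ^+ n).
Proof.
move=> cf; elim: n => [|n IH]; first exact: continuousCT.
by under eq_fun do rewrite exprS; exact: continuousMT.
Qed.

Lemma is_deriveMT F G (df dg x : R) : is_derive x 1 F df -> is_derive x 1 G dg ->
  is_derive x 1 (fun y => F y * G y) (df * G x + F x * dg).
Proof.
move=> dF dG; have := is_deriveM dF dG.
by move/is_derive_eq; apply; rewrite /GRing.scale/=; ring.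
Qed.

Lemma is_deriveDT F G (df dg x : R) : is_derive x 1 F df -> is_derive x 1 G dg ->
  is_derive x 1 (fun y => F y + G y) (df + dg).
Proof. by move=> dF dG; exact: is_deriveD. Qed.

Lemma is_deriveNT F (df x : R) : is_derive x 1 F df ->
  is_derive x 1 (fun y => - F y) (- df).
Proof. by move=> dF; exact: is_deriveN. Qed.

Lemma is_deriveCT (c x : R) : is_derive x 1 (fun=> c) 0.
Proof. exact: is_derive_cst. Qed.

Lemma is_derive_idT (x : R) : is_derive x 1 (fun y => y) 1.
Proof. exact: is_derive_id. Qed.

Lemma is_deriveVT F (df x : R) : F x != 0 -> is_derive x 1 F df ->
  is_derive x 1 (fun y => (F y)^-1) (- df / F x ^+ 2).
Proof.
move=> F0 dF; have := is_deriveV F0 dF.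
move/is_derive_eq; apply; rewrite /GRing.scale/=.
by rewrite mulNr mulrC mulNr.
Qed.

Lemma is_deriveXT n F (df x : R) : is_derive x 1 F df ->
  is_derive x 1 (fun y => F y ^+ n.+1) (n.+1%:R * F x ^+ n * df).
Proof.
move=> dF; elim: n => [|n IH].
  by move/is_derive_eq: dF; apply; rewrite expr0 mul1r mul1r.
rewrite (_ : (fun y => F y ^+ n.+2) = (fun y => F y * F y ^+ n.+1)); last first.
  by apply/funext => y; rewrite exprS.
have := is_deriveMT dF IH.
by move/is_derive_eq; apply; rewrite (exprS _ n) -[in RHS]natr1; ring.
Qed.

(** Selected by its characterisation rather than written as an integral, so that the derivative is
    available on both sides of [b]. *)
Definition prim b f : R -> R :=
  xget (fun=> 0) [set F | (forall x, is_derive x 1 F (f x)) /\ F b = 0].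

Lemma primP b f : continuous f -> (forall x, is_derive x 1 (prim b f) (f x)) /\ prim b f b = 0.
Proof.
move=> cf; have [F HF] := primitive_exists b cf.
by have := @xgetPex _ (fun=> 0) [set F | (forall x, is_derive x 1 F (f x)) /\ F b = 0];
   apply; exists F.
Qed.

Lemma is_derive_prim b f x : continuous f -> is_derive x 1 (prim b f) (f x).
Proof. by move=> /(primP b)[]. Qed.

Lemma prim_base b f : continuous f -> prim b f b = 0.
Proof. by move=> /(primP b)[]. Qed.

Lemma prim_unique b f F : (forall x, is_derive x 1 F (f x)) -> F b = 0 ->
  continuous f -> F = prim b f.
Proof.
move=> dF F0 cf; apply/funext => x.
have [xb|/ltW bx] := leP x b.
  have := @eq_derive_sub _ F (prim b f) f x b xb _ _.
  rewrite F0 prim_base// => E; apply: oppr_inj; rewrite -[LHS]add0r -[RHS]add0r.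
  by apply: E => z _ //; exact: is_derive_prim.
have := @eq_derive_sub _ F (prim b f) f b x bx _ _.
by rewrite F0 prim_base// !subr0; apply => z _ //; exact: is_derive_prim.
Qed.

Lemma le_prim b f g x : continuous f -> continuous g -> b <= x ->
  (forall y, b <= y <= x -> f y <= g y) -> prim b f x <= prim b g x.
Proof.
move=> cf cg bx fg.
have := @le_derive_sub _ (prim b f) f (prim b g) g b x bx.
rewrite !prim_base// !subr0; apply.
- by move=> z _; exact: is_derive_prim.
- by move=> z _; exact: is_derive_prim.
- by move=> z /andP[bz zx]; apply: fg; rewrite !ltW.
Qed.

Lemma prim_ge0 b f x : continuous f -> b <= x ->
  (forall y, b <= y <= x -> 0 <= f y) -> 0 <= prim b f x.
Proof.
move=> cf bx f0; have [dP P0] := primP b cf.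
rewrite -P0; apply: (@ge0_derive_le _ _ f) => // z /andP[bz zx].
by apply: f0; rewrite !ltW.
Qed.

Lemma prim_le0_left b f x : continuous f -> x <= b ->
  (forall y, 0 <= f y) -> prim b f x <= 0.
Proof.
move=> cf xb f0; have [dP P0] := primP b cf.
by rewrite -[leRHS]P0; apply: (@ge0_derive_le _ _ f).
Qed.

Lemma prim_lin b c f g : continuous f -> continuous g ->
  prim b (fun x => c * f x + g x) = (fun x => c * prim b f x + prim b g x).
Proof.
move=> cf cg; apply/esym/prim_unique.
- move=> x; apply: is_deriveDT; last exact: is_derive_prim.
  have := is_deriveMT (is_deriveCT c x) (is_derive_prim b x cf).
  by rewrite mul0r add0r.
- by rewrite !prim_base// mulr0 addr0.
- by apply: continuousDT => //; apply: continuousMT => // x; exact: cst_continuous.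
Qed.

End primitive.

(** * The generator, its integrating factor and its iterated potentials *)

Section generator.
Context {R : realType} (f : R -> R) (b a : R).
Hypothesis cf : continuous f.
Hypothesis f_gt0 : forall x, 0 < f x.
Hypothesis ba : b <= a.
Implicit Types (g w l F : R -> R) (x y : R).

(** The integrating factor of the generator: [w'' + w' / f = (speed * w')' / speed]. *)
Definition speed (x : R) : R := expR (prim b (fun y => (f y)^-1) x).

Lemma continuous_invf : continuous (fun y => (f y)^-1).
Proof. by apply: continuousVT => // x; rewrite gt_eqF. Qed.

Lemma is_derive_speed x : is_derive x 1 speed (speed x / f x).
Proof.
have := is_derive1_comp (is_derive_expR _) (is_derive_prim b x continuous_invf).
by move/is_derive_eq; apply.
Qed.

Lemma speed_gt0 x : 0 < speed x. Proof. exact: expR_gt0. Qed.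

Lemma speed_neq0 x : speed x != 0. Proof. by rewrite gt_eqF ?speed_gt0. Qed.

Lemma continuous_speed : continuous speed.
Proof. exact: is_derive_continuousT is_derive_speed. Qed.

(* [l] is the image of [w] under the generator [w'' + w' / f]. *)
Definition hasL w w1 l :=
  (forall x, is_derive x 1 w (w1 x)) /\
  (forall x, is_derive x 1 w1 (l x - w1 x / f x)).

(** [pot l] solves [w'' + w' / f = l] with [w b = 0] and [w' b = 0]; [dpot l] is its derivative and
    [flux l] is [speed] times that derivative. *)
Definition flux l (x : R) : R := prim b (fun y => speed y * l y) x.
Definition dpot l (x : R) : R := flux l x / speed x.
Definition pot l (x : R) : R := prim b (dpot l) x.

Section pot.
Context (l : R -> R).
Hypothesis cl : continuous l.

Lemma continuous_speedM : continuous (fun y => speed y * l y).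
Proof. exact: (continuousMT continuous_speed). Qed.

Lemma is_derive_flux x : is_derive x 1 (flux l) (speed x * l x).
Proof. exact: (is_derive_prim b x continuous_speedM). Qed.

Lemma is_derive_dpot x : is_derive x 1 (dpot l) (l x - dpot l x / f x).
Proof.
have := is_deriveMT (is_derive_flux x) (is_deriveVT (speed_neq0 x) (is_derive_speed x)).
move/is_derive_eq; apply; rewrite /dpot.
by field; rewrite speed_neq0 gt_eqF.
Qed.

Lemma continuous_dpot : continuous (dpot l).
Proof. by apply: is_derive_continuousT; exact: is_derive_dpot. Qed.

Lemma pot_hasL : hasL (pot l) (dpot l) l.
Proof. by split=> x; [exact: (is_derive_prim b x continuous_dpot)|exact: is_derive_dpot]. Qed.

Lemma pot_base : pot l b = 0.
Proof. exact: (prim_base b continuous_dpot). Qed.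

Lemma dpot_base : dpot l b = 0.
Proof. by rewrite /dpot /flux prim_base ?mul0r//; exact: continuous_speedM. Qed.

Lemma dpot_ge0 x : b <= x -> (forall y, b <= y <= x -> 0 <= l y) -> 0 <= dpot l x.
Proof.
move=> bx l0; rewrite divr_ge0 ?(ltW (speed_gt0 _))//.
by apply: prim_ge0 => //; [exact: continuous_speedM|move=> y yx; rewrite mulr_ge0 ?(ltW (speed_gt0 _))// l0].
Qed.

Lemma pot_ge0 x : (forall y, 0 <= l y) -> 0 <= pot l x.
Proof.
move=> l0; have [bx|/ltW xb] := leP b x.
  apply: prim_ge0 => //; first exact: continuous_dpot.
  by move=> y /andP[bY _]; exact: dpot_ge0.
rewrite -pot_base -lerN2.
apply: (@ge0_derive_le _ (fun y => - pot l y) (fun y => - dpot l y) x b) => // z => [_|/andP[_ zb]].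
  by apply: is_deriveNT; exact: pot_hasL.1.
rewrite oppr_ge0 pmulr_lle0 ?invr_gt0 ?speed_gt0//; apply: prim_le0_left => //; last 2 first.
- exact: ltW.
- by move=> y; rewrite mulr_ge0 ?(ltW (speed_gt0 _)).
- exact: continuous_speedM.
Qed.

End pot.

(** Multiplied by [speed], the differential inequality compares the derivatives of [flux l] and of
    [F * speed]. The bounds on the iterated potentials and on both moments of the exit time rest on
    this comparison. *)
Lemma le_dpot l F F1 x : continuous l -> b <= x -> 0 <= F b ->
  (forall y, b <= y <= x -> is_derive y 1 F (F1 y)) ->
  (forall y, b < y < x -> l y <= F1 y + F y / f y) -> dpot l x <= F x.
Proof.
move=> cl bx Fb dF lF; rewrite ler_pdivrMr ?speed_gt0//.
have := @le_derive_sub _ (flux l) (fun x => speed x * l x) (fun x => F x * speed x)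
  (fun x => F1 x * speed x + F x * (speed x / f x)) b x bx _ _ _.
have -> : flux l b = 0 by rewrite /flux prim_base//; exact: continuous_speedM.
rewrite subr0 => H; apply: (le_trans (H _ _ _)) => {H}.
- by move=> z _; exact: is_derive_flux.
- by move=> z zx; apply: is_deriveMT; [exact: dF|exact: is_derive_speed].
- move=> z zx.
  have -> : F1 z * speed z + F z * (speed z / f z) = speed z * (F1 z + F z / f z) by ring.
  by apply: ler_wpM2l; [exact/ltW/speed_gt0|exact: lF].
- by rewrite gerBl mulr_ge0 ?(ltW (speed_gt0 _)).
Qed.

Section near_eigenfunction.
Context (th : R).
Hypothesis th_gt0 : 0 < th.

Fixpoint iterpot k : R -> R := if k is k'.+1 then pot (iterpot k') else fun=> 1.

Lemma continuous_iterpot k : continuous (iterpot k).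
Proof.
elim: k => [|k IH] /=; first by move=> x; exact: cst_continuous.
by apply: is_derive_continuousT; exact: (pot_hasL IH).1.
Qed.

Lemma iterpot_ge0 k x : 0 <= iterpot k x.
Proof.
elim: k x => [|k IH] x /=; first exact: ler01.
by apply: pot_ge0 => //; exact: continuous_iterpot.
Qed.

(** As [1 / f] is positive, [dpot l] at [z] is at most [z - b] times a bound of [l] on [[b, z]].
    Replacing this [z - b] by [a - b] and integrating [(z - b) ^ k] produces the factorial. *)
Lemma iterpot_le k x : b <= x <= a ->
  iterpot k x <= (a - b) ^+ k * (x - b) ^+ k / k`!%:R.
Proof.
elim: k x => [|k IH] x /andP[bx xa] /=; first by rewrite !expr0 fact0 divr1 mulr1.
have ck := @continuous_iterpot k.
have := @le_derive_sub _ (pot (iterpot k)) (dpot (iterpot k))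
  (fun x => (a - b) ^+ k.+1 * (x - b) ^+ k.+1 / (k.+1)`!%:R)
  (fun x => (a - b) * ((a - b) ^+ k * (x - b) ^+ k / k`!%:R)) b x bx _ _ _.
rewrite pot_base// subrr expr0n/= mulr0 mul0r !subr0; apply.
- by move=> z _; exact: (pot_hasL ck).1.
- move=> z _.
  have dX : is_derive z 1 (fun y => (y - b) ^+ k.+1) ((z - b) ^+ k *+ k.+1).
    have := is_deriveXT k (is_deriveDT (is_derive_idT z) (is_deriveCT (- b) z)).
    by move/is_derive_eq; apply; rewrite addr0 mulr1 mulr_natl.
  have := is_deriveMT (is_deriveMT (is_deriveCT ((a - b) ^+ k.+1) z) dX)
    (is_deriveCT ((k.+1)`!%:R^-1) z).
  move/is_derive_eq; apply; rewrite mul0r add0r mulr0 addr0 factS natrM exprS.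
  by rewrite -mulr_natl; field; rewrite !pnatr_eq0 -lt0n fact_gt0/= .
- move=> z /andP[bz zx].
  have zb0 : 0 <= z - b by rewrite subr_ge0 ltW.
  have ab0 : 0 <= a - b by rewrite subr_ge0.
  have ck0 : 0 <= (a - b) ^+ k / k`!%:R :> R by rewrite divr_ge0 ?exprn_ge0.
  apply: (@le_trans _ _ ((z - b) * ((a - b) ^+ k * (z - b) ^+ k / k`!%:R))); last first.
    rewrite ler_wpM2r//; last lra.
    by rewrite mulrAC mulr_ge0// exprn_ge0.
  apply: (@le_dpot (iterpot k) (fun y => (y - b) * ((a - b) ^+ k * (z - b) ^+ k / k`!%:R))
     (fun=> (a - b) ^+ k * (z - b) ^+ k / k`!%:R)) => //.
  + exact: ltW.
  + by rewrite subrr mul0r.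
  + move=> y _; have := is_deriveMT (is_deriveDT (is_derive_idT y) (is_deriveCT (- b) y))
      (is_deriveCT ((a - b) ^+ k * (z - b) ^+ k / k`!%:R) y).
    by move/is_derive_eq; apply; rewrite addr0 mul1r mulr0 addr0.
  + move=> y /andP[bY yz].
    apply: (@le_trans _ _ ((a - b) ^+ k * (z - b) ^+ k / k`!%:R)).
      apply: (le_trans (IH _ _)); first by apply/andP; split; lra.
      rewrite mulrAC [leRHS]mulrAC ler_wpM2l// lerXn2r ?nnegrE; lra.
    rewrite lerDl divr_ge0 ?(ltW (f_gt0 _))// mulr_ge0//; first by rewrite subr_ge0 ltW.
    by rewrite mulrAC mulr_ge0// exprn_ge0.
Qed.

(** Partial sums of the eigenfunction of the generator for [th] with value 1 and slope 0 at [b].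
    Truncation keeps all derivatives finite sums, at the price that the generator maps [ser k.+1] to
    [th * ser k] instead of [th * ser k.+1]. *)
Definition ser k (x : R) : R := \sum_(j < k.+1) th ^+ j * iterpot j x.
Definition dser k (x : R) : R := \sum_(j < k) th ^+ j.+1 * dpot (iterpot j) x.

Lemma ser0 x : ser 0 x = 1.
Proof. by rewrite /ser big_ord_recl big_ord0 addr0 expr0 mul1r. Qed.

Lemma serS k x : ser k.+1 x = ser k x + th ^+ k.+1 * iterpot k.+1 x.
Proof. by rewrite /ser big_ord_recr. Qed.

Lemma dserS k x : dser k.+1 x = dser k x + th ^+ k.+1 * dpot (iterpot k) x.
Proof. by rewrite /dser big_ord_recr. Qed.

Lemma ser_hasL k : hasL (ser k.+1) (dser k.+1) (fun x => th * ser k x).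
Proof.
elim: k => [|k [IH1 IH2]].
  have [h1 h2] := pot_hasL (@continuous_iterpot 0).
  have dE x : dser 1 x = th * dpot (iterpot 0) x.
    by rewrite /dser big_ord_recl big_ord0 addr0 expr1.
  split => x.
    rewrite (_ : ser 1 = fun x => 1 + th * iterpot 1 x); last first.
      by apply/funext => y; rewrite serS ser0 expr1.
    have := is_deriveDT (is_deriveCT 1 x) (is_deriveMT (is_deriveCT th x) (h1 x)).
    by move/is_derive_eq; apply; rewrite dE mul0r !add0r.
  rewrite (_ : dser 1 = fun x => th * dpot (iterpot 0) x); last exact/funext.
  have := is_deriveMT (is_deriveCT th x) (h2 x).
  by move/is_derive_eq; apply; rewrite ser0/=; ring.
have [h1 h2] := pot_hasL (@continuous_iterpot k.+1).
split => x.
  rewrite (_ : ser k.+2 = fun x => ser k.+1 x + th ^+ k.+2 * iterpot k.+2 x); last first.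
    by apply/funext => y; rewrite serS.
  have := is_deriveDT (IH1 x) (is_deriveMT (is_deriveCT (th ^+ k.+2) x) (h1 x)).
  by move/is_derive_eq; apply; rewrite [in RHS]dserS mul0r !add0r.
rewrite (_ : dser k.+2 = fun x => dser k.+1 x + th ^+ k.+2 * dpot (iterpot k.+1) x); last first.
  by apply/funext => y; rewrite dserS.
have := is_deriveDT (IH2 x) (is_deriveMT (is_deriveCT (th ^+ k.+2) x) (h2 x)).
by move/is_derive_eq; apply; rewrite [in RHS]serS (exprS _ k.+1)/=; ring.
Qed.

Lemma ser_ge1 k x : 1 <= ser k x.
Proof.
elim: k => [|k IH]; first by rewrite ser0.
by rewrite serS (le_trans IH)// lerDl mulr_ge0 ?iterpot_ge0// exprn_ge0// ltW.
Qed.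

Lemma le_ser k x : ser k x <= ser k.+1 x.
Proof. by rewrite serS lerDl mulr_ge0 ?iterpot_ge0// exprn_ge0// ltW. Qed.

(** By [iterpot_le] the last term is at most a term of the exponential series at [th * (a - b) ^ 2],
    hence eventually below [eta], whereas [ser] is at least 1. *)
Lemma ser_gap (eta : R) : 0 < eta ->
  exists k, forall x, b <= x <= a -> (1 - eta) * ser k.+1 x <= ser k x.
Proof.
move=> eta0; pose C := th * (a - b) ^+ 2.
have : exp_coeff C k @[k --> \oo] --> (0 : R).
  by apply: cvg_series_cvg_0; exact: is_cvg_series_exp_coeff.
move=> /cvgrPdist_lt/(_ _ eta0)[N _ HN].
exists N => x xab.
have ab0 : 0 <= a - b by rewrite subr_ge0.
have := HN N.+1 (leqnSn N); rewrite /= sub0r normrN => H.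
have {}H : th ^+ N.+1 * iterpot N.+1 x <= eta.
  apply: le_trans (ltW H); apply: le_trans (ler_norm _).
  rewrite /exp_coeff/= /C exprMn -mulrA ler_wpM2l ?exprn_ge0 ?(ltW th_gt0)//.
  apply: (le_trans (iterpot_le N.+1 xab)).
  rewrite ler_wpM2r ?invr_ge0// [leRHS]exprAC expr2 ler_wpM2l ?exprn_ge0//.
  case/andP: xab => bx xa.
  rewrite lerXn2r ?nnegrE//; lra.
have : eta <= eta * ser N.+1 x by rewrite ler_peMr// ?ser_ge1// ltW.
by have := serS N x; rewrite mulrBl mul1r; move: H; lra.
Qed.

Lemma dser_ge0 k x : b <= x -> 0 <= dser k x.
Proof.
move=> bx; apply: sumr_ge0 => j _; rewrite mulr_ge0 ?exprn_ge0 ?(ltW th_gt0)//.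
by apply: dpot_ge0 => //; [exact: continuous_iterpot|move=> y _; exact: iterpot_ge0].
Qed.

Lemma dser_base k : dser k b = 0.
Proof.
by rewrite /dser big1// => j _; rewrite dpot_base ?mulr0//; exact: continuous_iterpot.
Qed.

End near_eigenfunction.

End generator.

(** * The killed resolvent and its survival functions *)

Section resolvent.
Context {R : realType} (f : R -> R) (b a : R) (A A1 q : R -> R).
Hypothesis cf : continuous f.
Hypothesis f_gt0 : forall x, 0 < f x.
Hypothesis ba : b <= a.
Hypothesis AL : hasL f A A1 (fun x => q x * A x).
Hypothesis A1b : A1 b = 0.
Hypothesis A_gt0 : forall x, 0 < A x.
Hypothesis A1_ge0 : forall x, b <= x -> 0 <= A1 x.
Hypothesis q_gt0 : forall x, 0 < q x.
Hypothesis cq : continuous q.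
Implicit Types (g h w l : R -> R) (x y z : R).

Local Notation rho := (speed f b).

Let cA : continuous A. Proof. exact: is_derive_continuousT AL.1. Qed.
Let A_neq0 x : A x != 0. Proof. by rewrite gt_eqF. Qed.
Let q_neq0 x : q x != 0. Proof. by rewrite gt_eqF. Qed.
Let rho0 x : 0 < rho x. Proof. exact: speed_gt0. Qed.
Let rho_n0 x : rho x != 0. Proof. by rewrite gt_eqF. Qed.
Let crho : continuous rho. Proof. exact: continuous_speed. Qed.
Let f_n0 x : f x != 0. Proof. by rewrite gt_eqF. Qed.

(** For [w = A * v], the equation [q w - L w = q g] becomes [(A^2 rho v')' = - A rho q g].
    Reflection at [b] gives [v' b = 0] and absorption gives [v a = 0], so two integrations solve
    it. *)
Definition inflow g := prim b (fun x => A x * rho x * q x * g x).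
Definition outflow g := prim b (fun x => (A x ^+ 2 * rho x)^-1 * inflow g x).

(* The resolvent of the generator killed at rate [q], with reflection at [b] and
   absorption at [a]: the solution of [q w - L w = q g]. *)
Definition resolv g (x : R) : R := A x * (outflow g a - outflow g x).
Definition dresolv g (x : R) : R :=
  A1 x * (outflow g a - outflow g x) - inflow g x / (A x * rho x).

Let cArq g : continuous g -> continuous (fun x => A x * rho x * q x * g x).
Proof. by move=> cg; do 3 (apply: continuousMT => //). Qed.

Let is_derive_inflow g x : continuous g ->
  is_derive x 1 (inflow g) (A x * rho x * q x * g x).
Proof. by move=> cg; exact: (is_derive_prim b x (cArq cg)). Qed.

Let inflow_base g : continuous g -> inflow g b = 0.
Proof. by move=> cg; exact: (prim_base b (cArq cg)). Qed.

Let A2r_gt0 x : 0 < (A x ^+ 2 * rho x)^-1.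
Proof. by rewrite invr_gt0 mulr_gt0 ?exprn_gt0. Qed.

Let cA2r : continuous (fun x => (A x ^+ 2 * rho x)^-1).
Proof.
apply: continuousVT; first by move=> x; rewrite mulf_neq0 ?expf_neq0.
by apply: continuousMT => //; exact: continuousXT.
Qed.

Let cout g : continuous g ->
  continuous (fun x => (A x ^+ 2 * rho x)^-1 * inflow g x).
Proof.
move=> cg; apply: continuousMT => //.
by apply: is_derive_continuousT => x; exact: is_derive_inflow.
Qed.

Let is_derive_outflow g x : continuous g ->
  is_derive x 1 (outflow g) ((A x ^+ 2 * rho x)^-1 * inflow g x).
Proof. by move=> cg; exact: (is_derive_prim b x (cout cg)). Qed.

Lemma resolv_hasL g : continuous g ->
  hasL f (resolv g) (dresolv g) (fun x => q x * (resolv g x - g x)).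
Proof.
move=> cg; split => x.
  have dD := is_deriveDT (is_deriveCT (outflow g a) x) (is_deriveNT (is_derive_outflow x cg)).
  have := is_deriveMT (AL.1 x) dD; move/is_derive_eq; apply.
  by rewrite /dresolv; field; rewrite A_neq0 rho_n0.
have dD := is_deriveDT (is_deriveCT (outflow g a) x) (is_deriveNT (is_derive_outflow x cg)).
have d1 := is_deriveMT (AL.2 x) dD.
have d2 := is_deriveMT (AL.1 x) (is_derive_speed b cf f_gt0 x).
have Ar0 : A x * rho x != 0 by rewrite mulf_neq0.
have d3 := is_deriveMT (is_derive_inflow x cg) (@is_deriveVT R (fun y => A y * rho y) _ x Ar0 d2).
have := is_deriveDT d1 (is_deriveNT d3); move/is_derive_eq; apply.
rewrite /dresolv /resolv.
by field; rewrite A_neq0 rho_n0 f_n0.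
Qed.

Lemma continuous_resolv g : continuous g -> continuous (resolv g).
Proof. by move=> cg; exact: is_derive_continuousT (resolv_hasL cg).1. Qed.

Lemma resolv_lin (c : R) g h : continuous g -> continuous h ->
  resolv (fun x => c * g x + h x) = (fun x => c * resolv g x + resolv h x).
Proof.
move=> cg ch.
have inE : inflow (fun x => c * g x + h x) = fun x => c * inflow g x + inflow h x.
  rewrite /inflow -(prim_lin b c (cArq cg) (cArq ch)); congr prim.
  by apply/funext => x; ring.
have outE : outflow (fun x => c * g x + h x) = fun x => c * outflow g x + outflow h x.
  rewrite /outflow -(prim_lin b c (cout cg) (cout ch)) inE; congr prim.
  by apply/funext => x; ring.
by apply/funext => x; rewrite /resolv outE; ring.
Qed.

Lemma resolv0 : resolv (fun=> 0) = fun=> 0.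
Proof.
have c0 := @continuousCT R 0.
have /(congr1 (fun F : R -> R => fun x => F x - resolv (fun=> 0) x)) := resolv_lin 1 c0 c0.
rewrite (_ : (fun x => 1 * 0 + 0) = fun=> 0) => [E|]; last by apply/funext => x; rewrite mulr0 addr0.
apply/funext => x; have := congr1 (@^~ x) E; rewrite /= subrr mul1r addrK => <-//.
Qed.

Lemma resolvZ (c : R) g : continuous g ->
  resolv (fun x => c * g x) = (fun x => c * resolv g x).
Proof.
move=> cg; have c0 := @continuousCT R 0.
have := resolv_lin c cg c0; rewrite resolv0.
under eq_fun do rewrite addr0; by under [RHS]eq_fun do rewrite addr0.
Qed.

Lemma le_resolv g h x : continuous g -> continuous h -> b <= x <= a ->
  (forall y, b <= y <= a -> g y <= h y) -> resolv g x <= resolv h x.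
Proof.
move=> cg ch /andP[bx xa] gh; rewrite /resolv ler_wpM2l ?(ltW (A_gt0 _))//.
apply: (@le_derive_sub _ _ (fun x => (A x ^+ 2 * rho x)^-1 * inflow g x)
  _ (fun x => (A x ^+ 2 * rho x)^-1 * inflow h x)) => // z.
- by move=> _; exact: is_derive_outflow.
- by move=> _; exact: is_derive_outflow.
- move=> /andP[xz za]; apply: ler_wpM2l; first exact: ltW.
  apply: le_prim; [exact: cArq|exact: cArq|by lra|].
  move=> y /andP[bY yz]; apply: ler_wpM2l; first by rewrite !mulr_ge0 ?(ltW (q_gt0 _)) ?(ltW (A_gt0 _)) ?(ltW (rho0 _)).
  apply: gh; lra.
Qed.

Lemma resolv_ge0 g x : continuous g -> b <= x <= a ->
  (forall y, b <= y <= a -> 0 <= g y) -> 0 <= resolv g x.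
Proof.
move=> cg xab g0; rewrite -[leLHS]/((fun=> 0) x) -resolv0; apply: le_resolv => //.
exact: continuousCT.
Qed.

(** The weighted Wronskian [rho * (A1 * w - w1 * A)] vanishes at [b] and its derivative is the
    integrand of [inflow]. Divided by [A ^ 2 * rho] it is the derivative of [- w / A], which
    identifies [outflow]. *)
Lemma resolv_unique w w1 l : hasL f w w1 l -> continuous l -> w a = 0 -> w1 b = 0 ->
  w = resolv (fun x => w x - l x / q x).
Proof.
move=> [wL1 wL2] cl wa w1b.
have cw : continuous w by exact: is_derive_continuousT wL1.
have cg : continuous (fun x => w x - l x / q x).
  apply: continuousDT => //; apply: continuousNT; apply: continuousMT => //.
  exact: continuousVT.
have inE : (fun x => rho x * (A1 x * w x - w1 x * A x)) = inflow (fun x => w x - l x / q x).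
  apply: prim_unique; last exact: cArq.
    move=> x.
    have d1 := is_deriveMT (AL.2 x) (wL1 x).
    have d2 := is_deriveMT (wL2 x) (AL.1 x).
    have := is_deriveMT (is_derive_speed b cf f_gt0 x) (is_deriveDT d1 (is_deriveNT d2)).
    move/is_derive_eq; apply.
    by field; rewrite q_neq0 f_n0.
  by rewrite A1b w1b !mul0r subr0 mulr0.
have outE : (fun x => w b / A b - w x / A x) = outflow (fun x => w x - l x / q x).
  apply: prim_unique; last exact: cout.
    move=> x; rewrite -inE.
    have d1 := is_deriveMT (wL1 x) (is_deriveVT (A_neq0 x) (AL.1 x)).
    have := is_deriveDT (is_deriveCT (w b / A b) x) (is_deriveNT d1).
    move/is_derive_eq; apply.
    by field; rewrite A_neq0 rho_n0.
  by rewrite subrr.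
apply/funext => x; rewrite /resolv -outE wa mul0r.
by field; rewrite !A_neq0.
Qed.

(* [g / h] is nonincreasing, written without division. *)
Definition ratio_nincr g h :=
  forall x y, b <= x -> x <= y -> y <= a -> g y * h x <= g x * h y.

(* Total positivity of the Green kernel. *)
Lemma ratio_nincr_resolv g h : continuous g -> continuous h ->
  ratio_nincr g h -> ratio_nincr (resolv g) (resolv h).
Proof.
move=> cg ch gh.
(* Four inequalities, each the integral in one variable of the one before, started where both sides
   agree: a point against the inflow, inflow against inflow, inflow against outflow, outflow against
   outflow. *)
have in_pt x y : b <= x -> x <= y -> y <= a -> g y * inflow h x <= inflow g x * h y.
  move=> bx xy ya; rewrite -subr_ge0.
  have -> : 0 = inflow g b * h y - g y * inflow h b by rewrite !inflow_base// mul0r mulr0 subrr.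
  apply: (@ge0_derive_le _ (fun x => inflow g x * h y - g y * inflow h x)
    (fun x => A x * rho x * q x * (g x * h y - g y * h x))) => // z.
    move=> _; have d1 := is_deriveMT (is_derive_inflow z cg) (is_deriveCT (h y) z).
    have d2 := is_deriveMT (is_deriveCT (g y) z) (is_derive_inflow z ch).
    have := is_deriveDT d1 (is_deriveNT d2); move/is_derive_eq; apply; ring.
  move=> /andP[bz zx]; rewrite mulr_ge0// ?subr_ge0.
    by rewrite !mulr_ge0 ?(ltW (q_gt0 _)) ?(ltW (A_gt0 _)) ?(ltW (rho0 _)).
  by apply: gh; lra.
have in_in x y : b <= x -> x <= y -> y <= a ->
    inflow g y * inflow h x <= inflow g x * inflow h y.
  move=> bx xy ya; rewrite -subr_ge0.
  have -> : 0 = inflow g x * inflow h x - inflow g x * inflow h x by rewrite subrr.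
  apply: (@ge0_derive_le _ (fun y => inflow g x * inflow h y - inflow g y * inflow h x)
    (fun y => A y * rho y * q y * (inflow g x * h y - g y * inflow h x))) => // z.
    move=> _; have d1 := is_deriveMT (is_deriveCT (inflow g x) z) (is_derive_inflow z ch).
    have d2 := is_deriveMT (is_derive_inflow z cg) (is_deriveCT (inflow h x) z).
    have := is_deriveDT d1 (is_deriveNT d2); move/is_derive_eq; apply; ring.
  move=> /andP[xz zy]; rewrite mulr_ge0// ?subr_ge0.
    by rewrite !mulr_ge0 ?(ltW (q_gt0 _)) ?(ltW (A_gt0 _)) ?(ltW (rho0 _)).
  by apply: in_pt => //; lra.
pose E g x := outflow g a - outflow g x.
have dE k x : continuous k -> is_derive x 1 (E k) (- ((A x ^+ 2 * rho x)^-1 * inflow k x)).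
  move=> ck; have := is_deriveDT (is_deriveCT (outflow k a) x) (is_deriveNT (is_derive_outflow x ck)).
  by move/is_derive_eq; apply; rewrite add0r.
have in_out x y : b <= x -> x <= y -> y <= a -> E g y * inflow h x <= inflow g x * E h y.
  move=> bx xy ya; rewrite -subr_ge0 -oppr_le0.
  have -> : 0 = - (inflow g x * E h a - E g a * inflow h x) by rewrite /E !subrr mulr0 mul0r subrr oppr0.
  apply: (@ge0_derive_le _ (fun y => - (inflow g x * E h y - E g y * inflow h x))
    (fun y => (A y ^+ 2 * rho y)^-1 * (inflow g x * inflow h y - inflow g y * inflow h x))) => // z.
    move=> _; have d1 := is_deriveMT (is_deriveCT (inflow g x) z) (dE h z ch).
    have d2 := is_deriveMT (dE g z cg) (is_deriveCT (inflow h x) z).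
    have := is_deriveNT (is_deriveDT d1 (is_deriveNT d2)); move/is_derive_eq; apply; ring.
  move=> /andP[yz za]; rewrite mulr_ge0// ?subr_ge0; first exact: ltW.
  by apply: in_in => //; lra.
move=> x y bx xy ya; rewrite /resolv -/(E g y) -/(E h x) -/(E g x) -/(E h y).
have -> : A y * E g y * (A x * E h x) = (A x * A y) * (E g y * E h x) by ring.
have -> : A x * E g x * (A y * E h y) = (A x * A y) * (E g x * E h y) by ring.
apply: ler_wpM2l; first by rewrite mulr_ge0// ltW.
rewrite -subr_ge0 -oppr_le0.
have -> : 0 = - (E g y * E h y - E g y * E h y) by rewrite subrr oppr0.
apply: (@ge0_derive_le _ (fun x => - (E g x * E h y - E g y * E h x))
  (fun x => (A x ^+ 2 * rho x)^-1 * (inflow g x * E h y - E g y * inflow h x))) => // z.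
  move=> _; have d1 := is_deriveMT (dE g z cg) (is_deriveCT (E h y) z).
  have d2 := is_deriveMT (is_deriveCT (E g y) z) (dE h z ch).
  have := is_deriveNT (is_deriveDT d1 (is_deriveNT d2)); move/is_derive_eq; apply; ring.
move=> /andP[xz zy]; rewrite mulr_ge0// ?subr_ge0; first exact: ltW.
by apply: in_out => //; lra.
Qed.

Definition surv (n : nat) : R -> R := iter n resolv (fun=> 1).

Lemma survS n : surv n.+1 = resolv (surv n). Proof. by []. Qed.

Lemma continuous_surv n : continuous (surv n).
Proof.
elim: n => [|n IH]; first exact: continuousCT.
exact: continuous_resolv.
Qed.

(** [A x / A a] is the probability of reaching [a] before the first ring; its complement has the
    boundary values that [resolv_unique] asks for. *)
Lemma surv1E : surv 1 = fun x => 1 - A x / A a.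
Proof.
have cl : continuous (fun x => - (q x * A x / A a)).
  by apply: continuousNT; apply: continuousMT; [exact: continuousMT|exact: continuousCT].
have H : hasL f (fun x => 1 - A x / A a) (fun x => - (A1 x / A a)) (fun x => - (q x * A x / A a)).
  split=> x.
    have := is_deriveDT (is_deriveCT 1 x) (is_deriveNT (is_deriveMT (AL.1 x) (is_deriveCT (A a)^-1 x))).
    by move/is_derive_eq; apply; rewrite mulr0 addr0 add0r.
  have := is_deriveNT (is_deriveMT (AL.2 x) (is_deriveCT (A a)^-1 x)).
  by move/is_derive_eq; apply; field; rewrite A_neq0 f_n0.
have := resolv_unique H cl; rewrite divff// subrr A1b mul0r oppr0 => /(_ erefl erefl) E.
rewrite survS E; congr resolv; apply/funext => x /=.
by field; rewrite A_neq0 q_neq0.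
Qed.

Lemma surv_itv n x : b <= x <= a -> 0 <= surv n.+1 x <= surv n x.
Proof.
elim: n x => [|n IH] x xab.
  rewrite surv1E/= subr_ge0 ler_pdivrMr// mul1r gerBl divr_ge0 ?(ltW (A_gt0 _))// andbT.
  case/andP: xab => bx xa.
  apply: (@ge0_derive_le _ A A1) => // z; first by move=> _; exact: AL.1.
  by move=> /andP[xz za]; apply: A1_ge0; lra.
apply/andP; split.
  rewrite survS; apply: resolv_ge0 => //; first exact: continuous_surv.
  by move=> y /IH/andP[].
apply: (@le_resolv (surv n.+1) (surv n)) => //; [exact: continuous_surv..|].
by move=> y /IH/andP[].
Qed.

Lemma surv_le1 n x : b <= x <= a -> 0 <= surv n x <= 1.
Proof.
move=> xab; elim: n => [|n /andP[_ IH]]; first by rewrite /= ler01 lexx.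
by have /andP[-> h] := surv_itv n xab; exact: le_trans h IH.
Qed.

Lemma surv_ratio n : ratio_nincr (surv n.+1) (surv n).
Proof.
elim: n => [|n IH].
  move=> x y bx xy ya; rewrite surv1E /surv/= !mulr1 lerD2l lerN2.
  rewrite ler_wpM2r ?invr_ge0 ?(ltW (A_gt0 _))//.
  apply: (@ge0_derive_le _ A A1) => // z; first by move=> _; exact: AL.1.
  by move=> /andP[xz za]; apply: A1_ge0; lra.
rewrite survS [X in ratio_nincr _ X]survS.
by apply: ratio_nincr_resolv => //; exact: continuous_surv.
Qed.

(** [surv n.+1] is [surv n] times a ratio that is nonincreasing by [surv_ratio]. Since the ratio is
    available in product form only, the case where [surv n x] vanishes is treated apart. *)
Lemma surv_nincr n x y : b <= x -> x <= y -> y <= a -> surv n y <= surv n x.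
Proof.
move=> bx xy ya; elim: n => [//|n IH].
have xab : b <= x <= a by rewrite bx (le_trans xy).
have yab : b <= y <= a by rewrite ya (le_trans bx).
have /andP[sx0 sx] := surv_itv n xab; have /andP[sy0 sy] := surv_itv n yab.
have [s0|s_gt0] := leP (surv n x) 0.
  by apply: (le_trans sy); apply: (le_trans IH); apply: (le_trans s0).
rewrite -(ler_pM2r s_gt0); apply: (le_trans (surv_ratio n bx xy ya)).
by rewrite ler_wpM2l.
Qed.

(** The ratio [surv n.+1 / surv n] is largest at [b]. The resolvent preserves this pointwise
    inequality and raises by one the index of each function, but not of the constants [surv n b] and
    [surv n.+1 b]. *)
Lemma surv_logconcave n : surv n b * surv n.+2 b <= surv n.+1 b ^+ 2.
Proof.
have bab : b <= b <= a by rewrite lexx.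
have cs := continuous_surv.
have : resolv (fun x => surv n b * surv n.+1 x) b <= resolv (fun x => surv n.+1 b * surv n x) b.
  apply: le_resolv => //.
  - by apply: continuousMT => //; exact: continuousCT.
  - by apply: continuousMT => //; exact: continuousCT.
  - move=> y /andP[bY ya]; rewrite mulrC.
    by have := surv_ratio n (lexx b) bY ya.
by rewrite !resolvZ// -!survS expr2.
Qed.

End resolvent.

(** * Moments of the exit time *)

Section exit_time_moments.
Context {R : realType} (f f1 : R -> R) (b a m : R).
Hypothesis cf : continuous f.
Hypothesis f_gt0 : forall x, 0 < f x.
Hypothesis ba : b <= a.
Implicit Types (x y : R).

Local Notation u1 := (dpot f b (fun=> 1)).
Local Notation u := (pot f b (fun=> 1)).

Definition mean_exit x := u a - u x.
(** Half the variance of the exit time: if [e] is the mean, then [L (e ^ 2) = 2 e L e + 2 (e')^2],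
    so the variance [v] satisfies [L v = - 2 (e')^2], and [e' = - u1]. *)
Definition var_exit x := pot f b (fun y => u1 y ^+ 2) a - pot f b (fun y => u1 y ^+ 2) x.
(* Half the second moment of the exit time. *)
Definition mom2_exit x := mean_exit x ^+ 2 / 2 + var_exit x.

Let c1 : continuous (fun _ : R => 1 : R). Proof. exact: continuousCT. Qed.
Let cu1 : continuous u1. Proof. exact: continuous_dpot. Qed.
Let cu12 : continuous (fun y => u1 y ^+ 2). Proof. exact: continuousXT. Qed.

Lemma mean_exit_hasL : hasL f mean_exit (fun x => - u1 x) (fun=> -1).
Proof.
have [h1 h2] := pot_hasL b cf f_gt0 c1.
split=> x.
  have := is_deriveDT (is_deriveCT (u a) x) (is_deriveNT (h1 x)).
  by move/is_derive_eq; apply; rewrite add0r.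
have := is_deriveNT (h2 x).
by move/is_derive_eq; apply; rewrite mulNr opprB opprK addrC.
Qed.

Lemma mom2_exit_hasL : hasL f mom2_exit
  (fun x => - (mean_exit x * u1 x + dpot f b (fun y => u1 y ^+ 2) x))
  (fun x => - mean_exit x).
Proof.
have [h1 h2] := pot_hasL b cf f_gt0 c1.
have [k1 k2] := pot_hasL b cf f_gt0 cu12.
have [e1 e2] := mean_exit_hasL.
split=> x.
  have := is_deriveDT (is_deriveMT (is_deriveXT 1 (e1 x)) (is_deriveCT (2^-1) x))
    (is_deriveDT (is_deriveCT (pot f b (fun y => u1 y ^+ 2) a) x) (is_deriveNT (k1 x))).
  by move/is_derive_eq; apply; rewrite expr1; field.
have := is_deriveNT (is_deriveDT (is_deriveMT (e1 x) (h2 x)) (k2 x)).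
by move/is_derive_eq; apply; field; rewrite gt_eqF.
Qed.

Lemma mean_exit_ge0 x : b <= x <= a -> 0 <= mean_exit x <= mean_exit b.
Proof.
move=> /andP[bx xa]; have [h1 h2] := pot_hasL b cf f_gt0 c1.
have u1_ge0 z : b <= z -> 0 <= u1 z by move=> bz; apply: dpot_ge0.
rewrite subr_ge0 lerD2l lerN2; apply/andP; split.
  by apply: (@ge0_derive_le _ u u1) => // z /andP[xz za]; apply: u1_ge0; lra.
by apply: (@ge0_derive_le _ u u1) => // z /andP[xz za]; apply: u1_ge0; lra.
Qed.

Lemma mean_exit_end : mean_exit a = 0. Proof. exact: subrr. Qed.

Lemma mom2_exit_end : mom2_exit a = 0.
Proof. by rewrite /mom2_exit mean_exit_end expr0n/= mul0r add0r /var_exit subrr. Qed.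

Lemma var_exit_ge0 x : b <= x <= a -> 0 <= var_exit x.
Proof.
move=> /andP[bx xa]; have [k1 k2] := pot_hasL b cf f_gt0 cu12.
rewrite subr_ge0.
apply: (@ge0_derive_le _ _ (dpot f b (fun y => u1 y ^+ 2))) => // z /andP[xz za].
by apply: dpot_ge0 => //; [lra|move=> y _; exact: sqr_ge0].
Qed.

Lemma mom2_exit_ge0 x : b <= x <= a -> 0 <= mom2_exit x.
Proof. by move=> xab; rewrite addr_ge0 ?divr_ge0 ?sqr_ge0// var_exit_ge0. Qed.

Hypothesis m_gt : - (1 / 3) < m.
Hypothesis df : forall x, b <= x <= a -> is_derive x 1 f (f1 x).
Hypothesis f1_ge : forall x, b <= x <= a -> m <= f1 x.

Let m1_gt0 : 0 < 1 + m. Proof. by move: m_gt; lra. Qed.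
Let m3_gt0 : 0 < 1 + 3 * m. Proof. by move: m_gt; lra. Qed.

(** Comparison with [F = f / (1 + m)], for which [F' + F / f = (f' + 1) / (1 + m)] is at least 1. *)
Lemma dpot1_le x : b <= x <= a -> u1 x <= f x / (1 + m).
Proof.
move=> /andP[bx xa].
apply: (@le_dpot _ f b cf f_gt0 _ (fun x => f x / (1 + m)) (fun x => f1 x / (1 + m))) => //.
- by rewrite divr_ge0// ltW.
- move=> y /andP[bY yx].
  have yba : b <= y <= a by lra.
  have := is_deriveMT (df yba) (is_deriveCT (1 + m)^-1 y).
  by move/is_derive_eq; apply; rewrite mulr0 addr0.
- move=> y /andP[bY yx].
  have -> : f1 y / (1 + m) + f y / (1 + m) / f y = (f1 y + 1) / (1 + m).
    by field; rewrite !gt_eqF.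
  rewrite ler_pdivlMr// mul1r addrC lerD2r.
  by apply: f1_ge; lra.
Qed.

Lemma mean_exit_le (phi : R -> R) : (forall x, b <= x <= a -> is_derive x 1 phi (f x)) ->
  mean_exit b <= (phi a - phi b) / (1 + m).
Proof.
move=> dphi; rewrite ler_pdivlMr//.
have [h1 h2] := pot_hasL b cf f_gt0 c1.
have := @le_derive_sub _ (fun x => u x * (1 + m)) (fun x => u1 x * (1 + m)) phi f b a ba.
rewrite -mulrBl; apply => // z.
  move=> _; have := is_deriveMT (h1 z) (is_deriveCT (1 + m) z).
  by move/is_derive_eq; apply; rewrite mulr0 addr0.
move=> /andP[bz za]; rewrite -ler_pdivlMr//; apply: dpot1_le; lra.
Qed.

(** Comparison with [F = c * f ^ 3], for which [F' + F / f = c * f ^ 2 * (1 + 3 * f')]. The constant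
    [c] makes this at least [(f / (1 + m)) ^ 2], which dominates [u1 ^ 2] by [dpot1_le]. The
    threshold [- 1 / 3] for [m] is the positivity of [1 + 3 * m]. *)
Lemma var_exit_le (psi : R -> R) : (forall x, b <= x <= a -> is_derive x 1 psi (f x ^+ 3)) ->
  var_exit b <= (psi a - psi b) / ((1 + m) ^+ 2 * (1 + 3 * m)).
Proof.
move=> dpsi.
pose c := ((1 + m) ^+ 2 * (1 + 3 * m))^-1.
have c_gt0 : 0 < c by rewrite invr_gt0 mulr_gt0 ?exprn_gt0.
have [k1 k2] := pot_hasL b cf f_gt0 cu12.
have dle x : b <= x <= a -> dpot f b (fun y => u1 y ^+ 2) x <= f x ^+ 3 * c.
  move=> /andP[bx xa].
  apply: (@le_dpot _ f b cf f_gt0 _ (fun x => f x ^+ 3 * c) (fun x => 3 * f x ^+ 2 * f1 x * c)) => //.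
  - by rewrite mulr_ge0 ?exprn_ge0 ?(ltW (f_gt0 _)) ?(ltW c_gt0).
  - move=> y /andP[bY yx].
    have yba : b <= y <= a by lra.
    have := is_deriveMT (is_deriveXT 2 (df yba)) (is_deriveCT c y).
    by move/is_derive_eq; apply; rewrite mulr0 addr0.
  - move=> y /andP[bY yx].
    have yba : b <= y <= a by lra.
    have -> : 3 * f y ^+ 2 * f1 y * c + f y ^+ 3 * c / f y = f y ^+ 2 * ((1 + 3 * f1 y) * c).
      by field; rewrite gt_eqF.
    apply: (@le_trans _ _ (f y ^+ 2 * ((1 + 3 * m) * c))); last first.
      by rewrite ler_wpM2l ?sqr_ge0// ler_wpM2r ?(ltW c_gt0)//; have := f1_ge yba; lra.
    have -> : f y ^+ 2 * ((1 + 3 * m) * c) = (f y / (1 + m)) ^+ 2.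
      by rewrite /c; field; rewrite !gt_eqF.
    have u0 : 0 <= u1 y by apply: dpot_ge0 => //; lra.
    by rewrite lerXn2r ?nnegrE ?dpot1_le// divr_ge0// ltW.
have := @le_derive_sub _ (pot f b (fun y => u1 y ^+ 2)) (dpot f b (fun y => u1 y ^+ 2))
   (fun x => psi x * c) (fun x => f x ^+ 3 * c) b a ba.
rewrite -mulrBl; apply => // z.
  move=> zba; have := is_deriveMT (dpsi z zba) (is_deriveCT c z).
  by move/is_derive_eq; apply; rewrite mulr0 addr0.
by move=> /andP[bz za]; apply: dle; lra.
Qed.

End exit_time_moments.

(** * Sums of survival probabilities by telescoping *)

Section survival_sums.
Context {R : realType} (f : R -> R) (b a th th' : R) (A A1 q : R -> R).
Hypothesis cf : continuous f.
Hypothesis f_gt0 : forall x, 0 < f x.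
Hypothesis ba : b <= a.
Hypothesis AL : hasL f A A1 (fun x => q x * A x).
Hypothesis A1b : A1 b = 0.
Hypothesis A_gt0 : forall x, 0 < A x.
Hypothesis A1_ge0 : forall x, b <= x -> 0 <= A1 x.
Hypothesis q_gt0 : forall x, 0 < q x.
Hypothesis cq : continuous q.
Hypothesis th'_gt0 : 0 < th'.
Hypothesis q_le : forall x, b <= x <= a -> q x <= th.
Hypothesis q_ge : forall x, b <= x <= a -> th' <= q x.
Implicit Types (x y : R) (g h : R -> R).

Local Notation Rv := (resolv f b a A q).
Local Notation sv := (surv f b a A q).
Local Notation e := (mean_exit f b a).
Local Notation e2 := (mom2_exit f b a).

Let th_gt0 : 0 < th.
Proof. by apply: (lt_le_trans (q_gt0 b)); apply: q_le; rewrite lexx. Qed.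

Let cR g : continuous g -> continuous (Rv g).
Proof. exact: (continuous_resolv cf f_gt0 AL A_gt0 cq). Qed.

Let cRn n g : continuous g -> continuous (iter n Rv g).
Proof. by move=> cg; elim: n => //= n IH; exact: cR. Qed.

Let le_Rn n g h x : continuous g -> continuous h -> b <= x <= a ->
  (forall y, b <= y <= a -> g y <= h y) -> iter n Rv g x <= iter n Rv h x.
Proof.
move=> cg ch + gh; elim: n x => [|n IH] x xab; first exact: gh.
apply: (le_resolv cf f_gt0 AL A_gt0 q_gt0 cq) => //; exact: cRn.
Qed.

Let Rn_lin n (c : R) g h : continuous g -> continuous h ->
  iter n Rv (fun x => c * g x + h x) = fun x => c * iter n Rv g x + iter n Rv h x.
Proof.
move=> cg ch; elim: n => //= n ->.
by rewrite (resolv_lin b a cf f_gt0 AL A_gt0 cq)//; exact: cRn.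
Qed.

Let Rn0 k : iter k Rv (fun=> 0) = fun=> 0.
Proof. by elim: k => //= k ->; exact: (resolv0 b a cf f_gt0 AL A_gt0 cq). Qed.

Let ce : continuous e.
Proof. exact: is_derive_continuousT (mean_exit_hasL b a cf f_gt0).1. Qed.
Let ce2 : continuous e2.
Proof. exact: is_derive_continuousT (mom2_exit_hasL b a cf f_gt0).1. Qed.
Let cqV : continuous (fun x => (q x)^-1).
Proof. by apply: continuousVT => // x; rewrite gt_eqF. Qed.
Let c1 : continuous (fun _ : R => 1 : R). Proof. exact: continuousCT. Qed.

(** Since [L e = -1], [resolv_unique] reads [e = Rv (e + 1 / q)]. As [1 / q] is nearly the constant
    [1 / th], this makes [Rv 1] nearly a difference [th * (e - Rv e)], and the sums over rings
    telescope. [R_eq] plays the same part for the second moment. *)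
Let R_invq : Rv (fun x => (q x)^-1) = fun x => e x - Rv e x.
Proof.
have H := resolv_unique cf f_gt0 AL A1b A_gt0 q_gt0 cq (mean_exit_hasL b a cf f_gt0).
have {H} := H a (@continuousCT R (-1)) (mean_exit_end f b a).
rewrite dpot_base// oppr0 => /(_ erefl) E.
have := Rn_lin 1 1 ce cqV.
rewrite /= (_ : (fun x => 1 * e x + (q x)^-1) = (fun x => e x - -1 / q x)); last first.
  by apply/funext => x; rewrite mul1r mulN1r opprK.
rewrite -E => {}E; apply/funext => x.
by rewrite [in e x]E mul1r addrAC subrr add0r.
Qed.

Let R_eq : Rv (fun x => e x / q x) = fun x => e2 x - Rv e2 x.
Proof.
have cl : continuous (fun x => - e x) by exact: continuousNT.
have H := resolv_unique cf f_gt0 AL A1b A_gt0 q_gt0 cq (mom2_exit_hasL b a cf f_gt0).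
have {H} := H a cl (mom2_exit_end f b a).
rewrite !dpot_base//; last first.
  by apply: continuousXT; exact: continuous_dpot.
rewrite mulr0 addr0 oppr0 => /(_ erefl) E.
have ceq : continuous (fun x => e x / q x) by exact: continuousMT.
have := Rn_lin 1 1 ce2 ceq.
rewrite /= (_ : (fun x => 1 * e2 x + e x / q x) = (fun x => e2 x - - e x / q x)); last first.
  by apply/funext => x; rewrite mul1r mulNr opprK.
rewrite -E => {}E; apply/funext => x.
by rewrite [in e2 x]E mul1r addrAC subrr add0r.
Qed.

Let bab : b <= b <= a. Proof. by rewrite lexx. Qed.

Let E k := iter k Rv e b.
Let E2 k := iter k Rv e2 b.

Let RnS n g h (c : R) : continuous g -> continuous h ->
  (forall x, b <= x <= a -> Rv g x <= c * (h x - Rv h x)) ->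
  iter n.+1 Rv g b <= c * (iter n Rv h b - iter n.+1 Rv h b).
Proof.
move=> cg ch H; rewrite !iterSr.
have -> : c * (iter n Rv h b - iter n Rv (Rv h) b) =
          iter n Rv (fun x => c * h x + (- c * Rv h x + 0)) b.
  rewrite Rn_lin//; last first.
    by apply: continuousDT => //; [apply: continuousMT; [exact: continuousCT|exact: cR]|exact: continuousCT].
  rewrite (Rn_lin n (- c) (cR ch) (@continuousCT R 0)).
  rewrite Rn0.
  by rewrite addr0 mulNr mulrBr.
apply: le_Rn => //; first exact: cR.
- apply: continuousDT; first by apply: continuousMT => //; exact: continuousCT.
  by apply: continuousDT; [apply: continuousMT; [exact: continuousCT|exact: cR]|exact: continuousCT].
- by move=> y yab; rewrite addr0 mulNr -mulrBr; exact: H.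
Qed.

Let surv_up k : sv k.+1 b <= th * (E k - E k.+1).
Proof.
apply: RnS => // x xab.
have := congr1 (@^~ x) R_invq; rewrite /= => <-.
rewrite -[leRHS](congr1 (@^~ x) (resolvZ b a cf f_gt0 AL A_gt0 cq th cqV)).
apply: (le_resolv cf f_gt0 AL A_gt0 q_gt0 cq) => //.
  by apply: continuousMT => //; exact: continuousCT.
by move=> y yab; rewrite ler_pdivlMr// mul1r q_le.
Qed.

Let surv_low k : th' * (E k - E k.+1) <= sv k.+1 b.
Proof.
rewrite -lerN2.
suff : - sv k.+1 b <= - th' * (E k - E k.+1) by rewrite mulNr.
have -> : - sv k.+1 b = iter k.+1 Rv (fun=> -1) b.
  have := Rn_lin k.+1 (-1) c1 (@continuousCT R 0).
  rewrite Rn0.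
  rewrite (_ : (fun x : R => -1 * 1 + 0) = (fun=> -1 : R)); last first.
    by apply/funext => x; rewrite mulr1 addr0.
  by move=> ->; rewrite addr0 mulN1r.
apply: RnS => //; first exact: continuousCT.
move=> x xab.
have := congr1 (@^~ x) R_invq; rewrite /= => <-.
rewrite -[leRHS](congr1 (@^~ x) (resolvZ b a cf f_gt0 AL A_gt0 cq (- th') cqV)).
apply: (le_resolv cf f_gt0 AL A_gt0 q_gt0 cq) => //.
  exact: continuousCT.
  by apply: continuousMT => //; exact: continuousCT.
by move=> y yab; rewrite mulNr lerN2 ler_pdivrMr// mul1r q_ge.
Qed.

Let E_up k : E k.+1 <= th * (E2 k - E2 k.+1).
Proof.
apply: RnS => // x xab.
have := congr1 (@^~ x) R_eq; rewrite /= => <-.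
rewrite -[leRHS](congr1 (@^~ x) (resolvZ b a cf f_gt0 AL A_gt0 cq th (continuousMT ce cqV))).
apply: (le_resolv cf f_gt0 AL A_gt0 q_gt0 cq) => //.
  by apply: continuousMT; [exact: continuousCT|exact: continuousMT].
move=> y yab; have /andP[ey _] := mean_exit_ge0 cf f_gt0 yab.
by rewrite mulrCA ler_peMr// ler_pdivlMr// mul1r q_le.
Qed.

Let E_ge0 k : 0 <= E k.
Proof.
rewrite -[leLHS]/((fun=> 0) b).
rewrite -(congr1 (@^~ b) (Rn0 k)).
apply: le_Rn => //; first exact: continuousCT.
by move=> y yab; have /andP[] := mean_exit_ge0 cf f_gt0 yab.
Qed.

Let E2_ge0 k : 0 <= E2 k.
Proof.
rewrite -[leLHS]/((fun=> 0) b).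
rewrite -(congr1 (@^~ b) (Rn0 k)).
apply: le_Rn => //; first exact: continuousCT.
by move=> y yab; exact: mom2_exit_ge0.
Qed.

Let E_surv k : E k <= e b * sv k b.
Proof.
have := congr1 (@^~ b) (Rn_lin k (e b) c1 (@continuousCT R 0)).
rewrite Rn0 => H; rewrite -[leRHS]addr0 -[leRHS]H.
apply: le_Rn => //.
  by apply: continuousDT; [apply: continuousMT|]; exact: continuousCT.
by move=> y yab; rewrite mulr1 addr0; have /andP[] := mean_exit_ge0 cf f_gt0 yab.
Qed.

Lemma sum_surv_le N : \sum_(k < N) sv k.+1 b <= th * e b.
Proof.
apply: (@le_trans _ _ (th * (E 0 - E N))); last first.
  by rewrite ler_pM2l// gerBl.
elim: N => [|N IH]; first by rewrite big_ord0 subrr mulr0.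
by have := surv_up N; move: IH; rewrite big_ord_recr !mulrBr /=; lra.
Qed.

Lemma sum_surv_ge N : th' * (e b - e b * sv N b) <= \sum_(k < N) sv k.+1 b.
Proof.
apply: (@le_trans _ _ (th' * (E 0 - E N))).
  by rewrite ler_pM2l// lerD2l lerN2.
elim: N => [|N IH]; first by rewrite big_ord0 subrr mulr0.
by have := surv_low N; move: IH; rewrite big_ord_recr !mulrBr /=; lra.
Qed.

Lemma sum_nat_surv_le N :
  \sum_(k < N) k.+1%:R * sv k.+1 b <= th * (e b + th * e2 b).
Proof.
(* Summation by parts replaces the weights by a sum of the [E k], which telescopes in its turn
   through [E_up]. The term [E 0 = e b] is outside the range of [E_up] and is kept. *)
have H1 : \sum_(k < N) k.+1%:R * sv k.+1 b <= th * (\sum_(k < N) E k - N%:R * E N).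
  elim: N => [|N IH]; first by rewrite !big_ord0 mul0r subrr mulr0.
  rewrite !big_ord_recr/=.
  have : N.+1%:R * sv N.+1 b <= N.+1%:R * (th * (E N - E N.+1)).
    by apply: ler_wpM2l; rewrite ?ler0n.
  move: IH; rewrite -natr1 => IH H; apply: (le_trans (lerD IH H)).
  by rewrite le_eqVlt; apply/orP; left; apply/eqP; ring.
apply: (le_trans H1); rewrite ler_pM2l//.
apply: (@le_trans _ _ (\sum_(k < N) E k)); first by rewrite gerBl mulr_ge0 ?ler0n.
case: N {H1} => [|N].
  rewrite big_ord0 addr_ge0 ?mulr_ge0 ?(ltW th_gt0)//; first exact: (E_ge0 0).
  exact: (E2_ge0 0).
rewrite big_ord_recl lerD2l.
apply: (@le_trans _ _ (th * (E2 0 - E2 N))); last by rewrite ler_pM2l// gerBl.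
elim: N => [|N IH]; first by rewrite big_ord0 subrr mulr0.
by have := E_up N; move: IH; rewrite big_ord_recr !mulrBr /=; lra.
Qed.

End survival_sums.

(** * Tails of log-concave sequences *)

Section logconcave_tail.
Context {R : realType}.
Implicit Types (c g x y z : R).

Lemma is_derive_expRT (F : R -> R) (df x : R) : is_derive x 1 F df ->
  is_derive x 1 (fun y => expR (F y)) (df * expR (F x)).
Proof.
move=> dF; have := is_derive1_comp (is_derive_expR (F x)) dF.
by move/is_derive_eq; apply; rewrite mulrC.
Qed.

Lemma expRN1_ge : 3^-1 <= expR (- 1) :> R.
Proof.
(* [(7 / 8) ^ 8] is about 0.344, just above 1/3; the coarser [(3 / 4) ^ 4] would fall below. *)
have -> : expR (- 1) = expR (- 8^-1) ^+ 8 :> R.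
  by rewrite -expRM_natl; congr expR; field.
apply: (@le_trans _ _ ((7 / 8) ^+ 8 : R)); first lra.
rewrite lerXn2r ?nnegrE ?expR_ge0//.
by have := @expR_ge1Dx R (- 8^-1); lra.
Qed.

(** The tangent at [c = 1] is [(2 - c) * expR (- 1)], and [expR (- 1)] is at least 1/3. This gives
    the sign of the last factor of [dh] in [censored_exp_ineq]. *)
Lemma expRN_ge_affine c : (2 - c) / 3 <= expR (- c).
Proof.
have [c2|/ltW c2] := leP 2 c.
  by apply: (@le_trans _ _ 0); [lra|exact: expR_ge0].
have H : 2 - c <= expR (- (c - 1)) by have := expR_ge1Dx (- (c - 1)); lra.
have -> : expR (- c) = expR (- (c - 1)) * expR (- 1).
  by rewrite -expRD; congr expR; lra.
by rewrite ler_pM ?invr_ge0 ?expRN1_ge//; lra.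
Qed.

(* The variance of an exponential variable censored at a time [c] against the
   square of the distance from its mean to [c]; the derivative in [c] factors
   as [6 g (g - (1 - c)) (g - (2 - c) / 3)], where [g = exp (- c)]. *)
Lemma censored_exp_ineq c : 0 <= c ->
  2 * expR (- c) * (c - 1 + expR (- c)) ^+ 2
    <= 1 - expR (- c) ^+ 2 - 2 * c * expR (- c).
Proof.
move=> c0; rewrite -subr_ge0.
pose h c := 1 - expR (- c) * (2 * (c * c) - 2 * c + 2) - expR (- c) * expR (- c) * (4 * c - 3)
  - 2 * (expR (- c) * expR (- c) * expR (- c)).
pose dh c := 6 * expR (- c) * (expR (- c) - (1 - c)) * (expR (- c) - (2 - c) / 3).
have dE x : is_derive x 1 (fun c => expR (- c)) (- expR (- x)).
  have := is_derive1_comp (is_derive_expR (- x)) (is_deriveNT (is_derive_idT x)).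
  by move/is_derive_eq; apply; rewrite mulrN1.
have dhP x : is_derive x 1 h (dh x).
  have dp1 := is_deriveDT (is_deriveDT (is_deriveMT (is_deriveCT 2 x)
     (is_deriveMT (is_derive_idT x) (is_derive_idT x)))
     (is_deriveNT (is_deriveMT (is_deriveCT 2 x) (is_derive_idT x)))) (is_deriveCT 2 x).
  have dp2 := is_deriveDT (is_deriveMT (is_deriveCT 4 x) (is_derive_idT x)) (is_deriveCT (- 3) x).
  have d1 := is_deriveMT (dE x) dp1.
  have d2 := is_deriveMT (is_deriveMT (dE x) (dE x)) dp2.
  have d3 := is_deriveMT (is_deriveCT 2 x) (is_deriveMT (is_deriveMT (dE x) (dE x)) (dE x)).
  have := is_deriveDT (is_deriveDT (is_deriveDT (is_deriveCT 1 x) (is_deriveNT d1)) (is_deriveNT d2)) (is_deriveNT d3).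
  by move/is_derive_eq; apply; rewrite /dh; field.
have -> : 1 - expR (- c) ^+ 2 - 2 * c * expR (- c) - 2 * expR (- c) * (c - 1 + expR (- c)) ^+ 2 = h c.
  by rewrite /h; ring.
have <- : h 0 = 0 by rewrite /h oppr0 expR0; ring.
apply: (@ge0_derive_le _ h dh) => // x /andP[x0 _].
have := expR_ge1Dx (- x); have := expRN_ge_affine x => h1 h2.
have := expR_ge0 (- x) => h3.
by rewrite /dh mulr_ge0 ?mulr_ge0//; lra.
Qed.

(** Increments before [j] are at least [D j.+1 - D j] and later ones at most that; each family is
    summed and weighted by the length of the other. The case [j = k] is apart because [j.+1] may
    then exceed [n]. *)
Lemma concave3 (D : nat -> R) (n i j k : nat) :
  (forall l, (l.+2 <= n)%N -> D l + D l.+2 <= 2 * D l.+1) ->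
  (i <= j)%N -> (j <= k)%N -> (k <= n)%N ->
  (k - j)%:R * D i + (j - i)%:R * D k <= (k - i)%:R * D j.
Proof.
move=> cD ij jk kn.
have dD p l : (p + l < n)%N -> D (p + l).+1 - D (p + l)%N <= D p.+1 - D p.
  elim: l => [|l IH]; first by rewrite addn0.
  rewrite addnS => pl; have := cD (p + l)%N pl; have := IH (ltnW pl); lra.
have [->|jk'] := eqVneq j k; first by rewrite subnn mul0r add0r.
have {}jk : (j < k)%N by rewrite ltn_neqAle jk'.
have up t : (j + t <= n)%N -> D (j + t)%N - D j <= t%:R * (D j.+1 - D j).
  elim: t => [|t IH]; first by rewrite addn0 mul0r subrr.
  rewrite addnS => tn; have := dD j t tn; have := IH (ltnW tn).
  by rewrite -natr1 mulrDl mul1r; lra.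
have dn t : (t <= j)%N -> t%:R * (D j.+1 - D j) <= D j - D (j - t)%N.
  elim: t => [|t IH]; first by rewrite subn0 mul0r subrr.
  move=> tj; have := IH (ltnW tj); have := dD (j - t.+1)%N t.+1.
  rewrite subnK// => /(_ (leq_trans jk kn)).
  have -> : (j - t.+1).+1 = (j - t)%N by lia.
  by rewrite -natr1 mulrDl mul1r; lra.
have := up (k - j)%N; rewrite subnKC ?(ltnW jk)// => /(_ kn) Hup.
have := dn (j - i)%N (leq_subr _ _); rewrite subKn// => Hdn.
have -> : (k - i)%N = ((k - j) + (j - i))%N by lia.
rewrite natrD; move: Hup Hdn.
have : (0 : R) <= (k - j)%:R by []; have : (0 : R) <= (j - i)%:R by [].
move: (k - j)%:R (j - i)%:R => u v v0 u0 h1 h2.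
have h3 : v * (D k - D j) <= v * (u * (D j.+1 - D j)) by exact: ler_wpM2l.
have h4 : u * (v * (D j.+1 - D j)) <= u * (D j - D i) by exact: ler_wpM2l.
by move: h3 h4; rewrite !mulrBr mulrCA; nra.
Qed.

Section crossing.
Context (G : nat -> R) (n N : nat).
Hypothesis nN : (n <= N)%N.
Hypothesis G0 : G 0 = 1.
Hypothesis G_le1 : forall k, 0 <= G k <= 1.
Hypothesis G_lc : forall k, G k * G k.+2 <= G k.+1 ^+ 2.
Hypothesis G_decr : forall k, G k.+1 <= G k.
Hypothesis Gn_gt0 : 0 < G n.

Local Notation S := (\sum_(j < N.+1) G j).
Hypothesis S_lt : S < n%:R.

Let c := - ln (G n).

Let G_anti k l : (k <= l)%N -> G l <= G k.
Proof.
elim: l => [|l IH]; first by rewrite leqn0 => /eqP ->.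
by rewrite leq_eqVlt => /predU1P[->//|kl]; apply: (le_trans (G_decr l)); exact: IH.
Qed.

Let G_gt0 k : (k <= n)%N -> 0 < G k.
Proof. by move=> kn; apply: (lt_le_trans Gn_gt0); exact: G_anti. Qed.

Let gE : expR (- c) = G n.
Proof. by rewrite /c opprK lnK. Qed.

Let n_gt0 : (0 < n)%N.
Proof.
rewrite lt0n; apply/eqP => n0; move: S_lt; rewrite n0 ltNge.
by rewrite sumr_ge0// => j _; have /andP[] := G_le1 j.
Qed.

Let sum_prefix k l : (k <= l)%N -> \sum_(j < k) G j <= \sum_(j < l) G j.
Proof.
elim: l => [|l IH]; first by rewrite leqn0 => /eqP ->.
rewrite leq_eqVlt => /predU1P[->//|kl]; apply: (le_trans (IH kl)).
by rewrite big_ord_recr/= lerDl; have /andP[] := G_le1 l.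
Qed.

Let Gn_lt1 : G n < 1.
Proof.
rewrite ltNge; apply/negP => Gn1; move: S_lt; rewrite ltNge => /negP; apply.
apply: (@le_trans _ _ (\sum_(j < n.+1) G j)); last by apply: sum_prefix.
apply: (@le_trans _ _ (\sum_(j < n.+1) 1)).
  by rewrite sumr_const card_ord ler_nat.
by apply: ler_sum => j _; apply: (le_trans Gn1); apply: G_anti; rewrite -ltnS.
Qed.

Let c_gt0 : 0 < c.
Proof. by rewrite oppr_gt0 ln_lt0// Gn_gt0 Gn_lt1. Qed.

Let D0 k := ln (G k).

Let D0_concave l : (l.+2 <= n)%N -> D0 l + D0 l.+2 <= 2 * D0 l.+1.
Proof.
move=> ln; have g0 := G_gt0 (ltnW (ltnW ln)); have g1 := G_gt0 (ltnW ln); have g2 := G_gt0 ln.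
rewrite /D0 -lnM ?posrE// mulr_natl -lnXn// ler_ln ?posrE ?mulr_gt0 ?exprn_gt0//.
Qed.

Let G_ge_chord k : (k <= n)%N -> expR (- c * k%:R / n%:R) <= G k.
Proof.
move=> kn; rewrite -[leRHS]lnK ?posrE ?G_gt0// ler_expR.
have := concave3 D0_concave (leq0n k) kn (leqnn n).
rewrite /D0 G0 ln1 mulr0 add0r !subn0 => H.
rewrite ler_pdivrMr ?ltr0n// /c opprK mulrC; apply: (le_trans H).
by rewrite mulrC.
Qed.

(** The mean of [expR (- c * t)] over [[0, 1]], so that [kap * n] is the integral over [[0, n]] of
    the exponential chord below [G]. *)
Let kap := (1 - G n) / c.

Let kap_lt1 : kap < 1.
Proof.
rewrite ltr_pdivrMr// mul1r -gE.
have := @expR_gt1Dx R (- c); rewrite oppr_eq0 gt_eqF// => /(_ isT); lra.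
Qed.

Let S_ge : kap * n%:R <= S.
Proof.
apply: (@le_trans _ _ (\sum_(j < n) G j)); last by apply: sum_prefix; exact: leqW.
have n0 : (0 : R) < n%:R by rewrite ltr0n.
pose F k := n%:R / c * (1 - expR (- c * k%:R / n%:R)) : R.
have -> : kap * n%:R = F n.
  have E : - c * n%:R / n%:R = - c by field; rewrite gt_eqF.
  by rewrite /F E gE /kap; field; rewrite gt_eqF.
suff H : forall k, (k <= n)%N -> F k <= \sum_(j < k) G j by exact: H.
elim => [_|k IH kn]; first by rewrite big_ord0 /F mulr0 mul0r expR0 subrr mulr0.
rewrite big_ord_recr/=; have := IH (ltnW kn); have := G_ge_chord (ltnW kn).
suff : F k.+1 - F k <= expR (- c * k%:R / n%:R) by lra.
have -> : F k.+1 - F k = expR (- c * k%:R / n%:R) * (n%:R / c * (1 - expR (- (c / n%:R)))).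
  rewrite /F.
  have -> : - c * k.+1%:R / n%:R = - c * k%:R / n%:R + - (c / n%:R).
    by rewrite -natr1; field; rewrite gt_eqF.
  by rewrite expRD; ring.
rewrite -[leRHS]mulr1; apply: ler_wpM2l; first exact: expR_ge0.
apply: (@le_trans _ _ (n%:R / c * (c / n%:R))); last by rewrite le_eqVlt; apply/orP; left; apply/eqP; field; rewrite !gt_eqF.
rewrite ler_wpM2l ?divr_ge0 ?(ltW c_gt0)//.
by have := @expR_ge1Dx R (- (c / n%:R)); lra.
Qed.

(* [y0] is chosen so that the censored exponential tail
   [min 1 (exp (- bet (t - y0)))] on [[0, n]] has integral [S]. *)
Let y0 := (S - kap * n%:R) / (1 - kap).
(** The rate for which [Gs] takes the value [G n] at [n]. *)
Let bet := c / (n%:R - y0).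
Let Gs (t : R) := Num.min 1 (expR (- bet * (t - y0))).

Let y0_ge0 : 0 <= y0.
Proof. by rewrite divr_ge0// subr_ge0 ?S_ge// ltW. Qed.

Let y0_lt : y0 < n%:R.
Proof.
rewrite ltr_pdivrMr ?subr_gt0//; move: S_lt; rewrite mulrBr mulr1; lra.
Qed.

Let bet_gt0 : 0 < bet.
Proof. by rewrite divr_gt0// subr_gt0 y0_lt. Qed.

Let y0E : y0 + (1 - G n) / bet = S.
Proof.
have H : 1 - kap != 0 by rewrite gt_eqF// subr_gt0.
have -> : (1 - G n) / bet = kap * (n%:R - y0).
  by rewrite /bet /kap; field; rewrite !gt_eqF// subr_gt0 y0_lt.
by rewrite /y0; field.
Qed.

Let Gs_left t : t <= y0 -> Gs t = 1.
Proof.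
move=> ty; apply/min_idPl; rewrite -expR0 ler_expR mulNr -mulrN.
by rewrite mulr_ge0 ?(ltW bet_gt0)// opprB subr_ge0.
Qed.

Let Gs_right t : y0 <= t -> Gs t = expR (- bet * (t - y0)).
Proof.
move=> ty; apply/min_idPr; rewrite -expR0 ler_expR mulNr oppr_le0.
by rewrite mulr_ge0 ?(ltW bet_gt0)// subr_ge0.
Qed.

Let Gs_le1 t : 0 <= Gs t <= 1.
Proof. by rewrite le_min ler01 expR_ge0 ge_min lexx. Qed.

Let Gs_anti s t : s <= t -> Gs t <= Gs s.
Proof.
move=> st; rewrite le_min; apply/andP; split; first by have /andP[] := Gs_le1 t.
rewrite ge_min ler_expR; apply/orP; right.
by rewrite !mulNr lerN2 ler_wpM2l ?(ltW bet_gt0)// lerD2r.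
Qed.

Let Gs_n : Gs n%:R = G n.
Proof.
rewrite Gs_right ?(ltW y0_lt)// -gE; congr expR.
by rewrite /bet; field; rewrite gt_eqF// subr_gt0 y0_lt.
Qed.

Let dexp (x : R) : is_derive x 1 (fun t => expR (- bet * (t - y0))) (- bet * expR (- bet * (x - y0))).
Proof.
have d0 := is_deriveMT (is_deriveCT (- bet) x) (is_deriveDT (is_derive_idT x) (is_deriveCT (- y0) x)).
by move/is_derive_eq: (is_derive_expRT d0); apply; rewrite mul0r add0r addr0 mulr1.
Qed.

Let cGs : continuous Gs.
Proof.
move=> x; apply: (@continuous_min _ R (fun=> 1) (fun t => expR (- bet * (t - y0)))); first exact: continuousCT.
exact: is_derive_continuous (dexp x).
Qed.

Let P := prim 0 Gs.
Let Q := prim 0 (fun t => t * Gs t).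

Let ctGs : continuous (fun t : R => t * Gs t).
Proof. by apply: continuousMT => // x; exact: cvg_id. Qed.

Let Pn : P n%:R = S.
Proof.
have H1 : P y0 - P 0 = y0 - 0.
  apply: (@eq_derive_sub _ P (fun t => t) Gs) => // z zy; first exact: is_derive_prim.
  by rewrite Gs_left; [exact: is_derive_idT|case/andP: zy].
have H2 : P n%:R - P y0 = - (expR (- bet * (n%:R - y0))) / bet - - (expR (- bet * (y0 - y0))) / bet.
  apply: (@eq_derive_sub _ P (fun t => - expR (- bet * (t - y0)) / bet) Gs); first exact: ltW.
    by move=> z _; exact: is_derive_prim.
  move=> z /andP[yz _]; rewrite Gs_right//.
  have := is_deriveMT (is_deriveNT (dexp z)) (is_deriveCT bet^-1 z).
  by move/is_derive_eq; apply; field; rewrite gt_eqF.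
have P0 : P 0 = 0 by exact: prim_base.
rewrite -y0E -Gs_n Gs_right ?(ltW y0_lt)//.
move: H1 H2; rewrite P0 subrr mulr0 expR0 !subr0 => -> H2.
have -> : P n%:R = P n%:R - y0 + y0 by ring.
by rewrite H2; ring.
Qed.

(** The left side is the variance of the variable with tail [Gs] censored at [n]. The shift [y0]
    drops out, which leaves an exponential variable of rate [bet] censored at [c / bet]. *)
Let Qn : 2 * Q n%:R - S ^+ 2 = (1 - G n ^+ 2 - 2 * c * G n) / bet ^+ 2.
Proof.
have H1 : Q y0 - Q 0 = y0 * y0 / 2 - 0 * 0 / 2.
  apply: (@eq_derive_sub _ Q (fun t => t * t / 2) (fun t => t * Gs t)) => // z zy; first exact: is_derive_prim.
  have := is_deriveMT (is_deriveMT (is_derive_idT z) (is_derive_idT z)) (is_deriveCT 2^-1 z).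
  by move/is_derive_eq; apply; rewrite Gs_left; [field|case/andP: zy].
pose F (t : R) := - (t / bet + 1 / bet ^+ 2) * expR (- bet * (t - y0)).
have H2 : Q n%:R - Q y0 = F n%:R - F y0.
  apply: (@eq_derive_sub _ Q F (fun t => t * Gs t)); first exact: ltW.
    by move=> z _; exact: is_derive_prim.
  move=> z /andP[yz _]; rewrite Gs_right//.
  have d1 := is_deriveNT (is_deriveDT (is_deriveMT (is_derive_idT z) (is_deriveCT bet^-1 z)) (is_deriveCT (1 / bet ^+ 2) z)).
  have := is_deriveMT d1 (dexp z).
  by move/is_derive_eq; apply; field; rewrite gt_eqF.
have Q0 : Q 0 = 0 by exact: prim_base.
have Fn : F n%:R = - (n%:R / bet + 1 / bet ^+ 2) * G n.
  by rewrite /F -Gs_n Gs_right ?(ltW y0_lt).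
have Fy : F y0 = - (y0 / bet + 1 / bet ^+ 2) by rewrite /F subrr mulr0 expR0 mulr1.
have nE : n%:R = y0 + c / bet.
  by rewrite /bet; field; rewrite !gt_eqF// subr_gt0 y0_lt.
have -> : Q n%:R = Q n%:R - Q y0 + (Q y0 - Q 0) by rewrite Q0; ring.
rewrite H1 H2 Fn Fy nE -y0E.
by field; rewrite gt_eqF.
Qed.

Let sum_Gs k : \sum_(j < k.+1) Gs j%:R <= P k%:R + 1.
Proof.
elim: k => [|k IH].
  rewrite big_ord_recl big_ord0 addr0 /P prim_base// add0r.
  by have /andP[] := Gs_le1 0.
rewrite big_ord_recr/=.
have := @le_derive_sub _ (fun t => Gs k.+1%:R * t) (fun=> Gs k.+1%:R) P Gs k%:R k.+1%:R _ _ _ _.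
rewrite -mulrBr -natr1 [X in X * _ <= _](_ : _ = Gs k.+1%:R); last by rewrite natr1.
have -> : k%:R + 1 - k%:R = 1 :> R by ring.
rewrite mulr1 natr1 => H.
suff : Gs k.+1%:R <= P k.+1%:R - P k%:R by move: IH; lra.
apply: H.
- by rewrite ler_nat.
- move=> z _; have := is_deriveMT (is_deriveCT (Gs k.+1%:R) z) (is_derive_idT z).
  by move/is_derive_eq; apply; rewrite mul0r add0r mulr1.
- by move=> z _; exact: is_derive_prim.
- by move=> z /andP[_ zk]; apply: Gs_anti; rewrite ltW.
Qed.

Let sum_tGs k : Q k%:R <= \sum_(j < k) j%:R * Gs j%:R + k%:R.
Proof.
elim: k => [|k IH]; first by rewrite big_ord0 addr0 /Q prim_base.
rewrite big_ord_recr/=.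
suff H : Q k.+1%:R - Q k%:R <= k.+1%:R * Gs k%:R.
  have /andP[_ h1] := Gs_le1 k%:R.
  by move: H IH; rewrite -natr1 mulrDl mul1r; lra.
have := @le_derive_sub _ Q (fun t => t * Gs t) (fun t => k.+1%:R * Gs k%:R * t)
  (fun=> k.+1%:R * Gs k%:R) k%:R k.+1%:R _ _ _ _.
have k1 : k.+1%:R - k%:R = 1 :> R by rewrite -natr1; ring.
rewrite -mulrBr k1 mulr1; apply.
- by rewrite ler_nat.
- by move=> z _; exact: is_derive_prim.
- move=> z _; have := is_deriveMT (is_deriveCT (k.+1%:R * Gs k%:R) z) (is_derive_idT z).
  by move/is_derive_eq; apply; rewrite mul0r add0r mulr1.
- move=> z /andP[kz zk]; have z0 : 0 <= z by apply: le_trans (ltW kz).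
  have /andP[gz0 _] := Gs_le1 z.
  by apply: ler_pM => //; [exact: ltW|apply: Gs_anti; exact: ltW].
Qed.

Let Gst j := if (j <= n)%N then Gs j%:R else 0.

(** [G] starts below [Gs] and crosses it once. After the first index [s] where it is above,
    [Gs s < G s <= 1] forces [y0 < s], so [ln Gs] is affine on [[s, n]]; there [ln G - ln Gs] is
    concave, nonnegative at [s] and zero at [n]. Beyond [n] the comparison function is 0. *)
Let crossing_sign : exists2 s, (s <= n)%N &
  forall j, (j <= N)%N -> 0 <= (j%:R - s%:R) * (G j - Gst j).
Proof.
have exn : exists j, ((j <= n)%N && (Gst j < G j)) || (j == n) by exists n; rewrite eqxx orbT.
case: (ex_minnP exn) => s sP smin.
have sn : (s <= n)%N by case/orP: sP => [/andP[]//|/eqP ->].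
exists s => // j jN.
have [js|sj] := ltnP j s.
  apply: mulr_le0; first by rewrite subr_le0 ler_nat ltnW.
  rewrite subr_le0 leNgt; apply/negP => H.
  have := smin j; rewrite (leq_trans (ltnW js) sn) H /= => /(_ isT).
  by rewrite leqNgt js.
apply: mulr_ge0; first by rewrite subr_ge0 ler_nat.
rewrite subr_ge0 /Gst; case: leqP => [jn|_]; last by have /andP[] := G_le1 j.
case/orP: sP => [/andP[_]|/eqP sE]; last first.
  have -> : j = n by apply/eqP; rewrite eqn_leq jn -sE sj.
  by rewrite Gs_n.
rewrite /Gst sn => Gs_lt.
have ys : y0 < s%:R.
  rewrite ltNge; apply/negP => H; move: Gs_lt; rewrite Gs_left// ltNge.
  by have /andP[_ ->] := G_le1 s.
pose D k := D0 k + bet * (k%:R - y0).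
have Dc l : (l.+2 <= n)%N -> D l + D l.+2 <= 2 * D l.+1.
  by move=> ln; have := D0_concave ln; rewrite /D -!natr1; lra.
have Dn : D n = 0.
  rewrite /D /D0 /bet /c; field.
  by rewrite gt_eqF// subr_gt0 y0_lt.
have Ds : 0 <= D s.
  move: Gs_lt; rewrite Gs_right ?(ltW ys)//.
  rewrite -[ltRHS]lnK ?posrE ?G_gt0// ltr_expR mulNr => H.
  by rewrite /D /D0; lra.
have Dj : 0 <= D j.
  have := concave3 Dc sj jn (leqnn n); rewrite Dn mulr0 addr0 => H.
  have [sE|sn'] := eqVneq s n.
    have -> : j = n by apply/eqP; rewrite eqn_leq jn -sE sj.
    by rewrite Dn.
  have ns : (0 : R) < (n - s)%:R by rewrite ltr0n subn_gt0 ltn_neqAle sn' sn.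
  rewrite -(pmulr_rge0 _ ns); apply: le_trans H.
  by rewrite mulr_ge0.
rewrite Gs_right; last by apply: (le_trans (ltW ys)); rewrite ler_nat.
rewrite -[leRHS]lnK ?posrE ?G_gt0// ler_expR mulNr.
by move: Dj; rewrite /D /D0; lra.
Qed.

(** A single crossing between tails of nearly equal sums orders their first-moment sums, so the
    variance for [G] is at least that for [Gs] up to order [n]. For [Gs] the claim is
    [censored_exp_ineq], rescaled by [bet]. *)
Lemma logconcave_tail :
  2 * G n * (n%:R - S) ^+ 2 <= 2 * (\sum_(j < N.+1) j%:R * G j) - S ^+ 2 + 4 * n%:R.
Proof.
have [s sn Hs] := crossing_sign.
have Hsum : 0 <= \sum_(j < N.+1) (j%:R - s%:R) * (G j - Gst j).
  by apply: sumr_ge0 => j _; apply: Hs; rewrite -ltnS.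
have E (h : nat -> R) : \sum_(j < N.+1) h j * Gst j = \sum_(j < n.+1) h j * Gs j%:R.
  rewrite -(big_mkord xpredT (fun j => h j * Gst j)).
  rewrite (big_cat_nat _ (n := n.+1))//=.
  rewrite [X in _ + X]big_nat_cond [X in _ + X]big1 ?addr0; last first.
    by move=> j /andP[/andP[nj _] _]; rewrite /Gst leqNgt nj mulr0.
  rewrite big_mkord; apply: eq_bigr => j _.
  by rewrite /Gst -ltnS ltn_ord.
have H1 : \sum_(j < N.+1) (j%:R - s%:R) * (G j - Gst j) =
  \sum_(j < N.+1) j%:R * G j - s%:R * S
   - (\sum_(j < n.+1) j%:R * Gs j%:R - s%:R * \sum_(j < n.+1) Gs j%:R).
  rewrite -(E (fun j => j%:R)) !mulr_sumr.
  rewrite -[X in _ - (_ - X)](E (fun=> s%:R)).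
  rewrite -!sumrB; apply: eq_bigr => j _; ring.
(* The Riemann sum errors cost [n] each, once directly and once as [s * 1] with [s <= n]; doubled,
   they make the [4 * n] of the statement. *)
have H2 := sum_Gs n; have H3 := sum_tGs n.
have H4 : \sum_(j < n) j%:R * Gs j%:R <= \sum_(j < n.+1) j%:R * Gs j%:R.
  by rewrite [leRHS]big_ord_recr/= lerDl mulr_ge0//; have /andP[] := Gs_le1 n%:R.
have H5 : s%:R * \sum_(j < n.+1) Gs j%:R <= s%:R * S + n%:R.
  apply: (@le_trans _ _ (s%:R * (S + 1))); first by rewrite ler_wpM2l// -Pn.
  by rewrite mulrDr mulr1 lerD2l ler_nat.
rewrite H1 in Hsum.
suff : 2 * G n * (n%:R - S) ^+ 2 <= 2 * Q n%:R - S ^+ 2 by move: Hsum H3 H4 H5; lra.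
rewrite Qn.
have -> : n%:R - S = (c - 1 + G n) / bet.
  rewrite -y0E.
  have nE : n%:R = y0 + c / bet.
    by rewrite /bet; field; rewrite !gt_eqF// subr_gt0 y0_lt.
  by rewrite [in LHS]nE; field; rewrite gt_eqF.
rewrite expr_div_n mulrA ler_wpM2r ?invr_ge0 ?sqr_ge0//.
by have := censored_exp_ineq (ltW c_gt0); rewrite gE.
Qed.

End crossing.

End logconcave_tail.

(** * The tail bound for the survival probabilities at the reflecting end *)

Section survival_tail.
Context {R : realType} (f : R -> R) (b a th : R).
Hypothesis cf : continuous f.
Hypothesis f_gt0 : forall x, 0 < f x.
Hypothesis ba : b <= a.
Hypothesis th_ge2 : 2 <= th.
Implicit Types (x y : R).

Let th_gt0 : 0 < th. Proof. by apply: lt_le_trans th_ge2. Qed.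

(** Since the generator maps [ser k.+1] to [th * ser k], take [A = ser k.+1] and
    [q = th * ser k / ser k.+1]. A relative gap of [1 / th] between the two sums places [q] within 1
    of [th]. *)
Lemma near_eigenfunction_exists : exists A A1 q q1 : R -> R,
  [/\ hasL f A A1 (fun x => q x * A x), A1 b = 0, (forall x, 0 < A x)
    & forall x, b <= x -> 0 <= A1 x] /\
  [/\ (forall x, 0 < q x), (forall x, is_derive x 1 q (q1 x)), continuous q1
    & forall x, b <= x <= a -> th - 1 <= q x <= th].
Proof.
have [k Hk] := ser_gap cf f_gt0 ba th_gt0 (divr_gt0 ltr01 th_gt0).
have A_gt0 j x : 0 < ser f b th j x.
  by apply: (lt_le_trans ltr01); exact: ser_ge1.
have A_neq0 j x : ser f b th j x != 0 by rewrite gt_eqF.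
have dS j x : is_derive x 1 (ser f b th j) (dser f b th j x).
  case: j => [|j]; last exact: (ser_hasL b cf f_gt0 th j).1.
  rewrite /dser big_ord0 (_ : ser f b th 0 = fun=> 1); first exact: is_deriveCT.
  by apply/funext => y; exact: ser0.
have cdS j : continuous (dser f b th j).
  case: j => [|j]; last exact: is_derive_continuousT (ser_hasL b cf f_gt0 th j).2.
  rewrite (_ : dser f b th 0 = fun=> 0); first exact: continuousCT.
  by apply/funext => y; rewrite /dser big_ord0.
have cS j : continuous (ser f b th j) by exact: is_derive_continuousT (dS j).
pose q x := th * ser f b th k x / ser f b th k.+1 x.
pose q1 x := th * (dser f b th k x * ser f b th k.+1 x - ser f b th k x * dser f b th k.+1 x)
   / ser f b th k.+1 x ^+ 2.
exists (ser f b th k.+1), (dser f b th k.+1), q, q1; split; split => //.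
- have [h1 h2] := ser_hasL b cf f_gt0 th k; split=> // x.
  by move/is_derive_eq: (h2 x); apply; rewrite /q divfK.
- exact: dser_base.
- by move=> x bx; exact: dser_ge0.
- by move=> x; rewrite /q divr_gt0// mulr_gt0.
- move=> x; have := is_deriveMT (is_deriveMT (is_deriveCT th x) (dS k x)) (is_deriveVT (A_neq0 k.+1 x) (dS k.+1 x)).
  by move/is_derive_eq; apply; rewrite /q1; field.
- apply: continuousMT.
    apply: continuousMT; first exact: continuousCT.
    by apply: continuousDT; [|apply: continuousNT]; exact: continuousMT.
  by apply: continuousVT => [x|]; [rewrite expf_neq0|exact: continuousXT].
- move=> x xab; rewrite /q ler_pdivlMr// ler_pdivrMr//; apply/andP; split.
    have := Hk x xab; rewrite -(ler_pM2l th_gt0) mulrA mulrBr mulr1 mulrCA mul1r.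
    by rewrite divff ?mulr1// gt_eqF.
  by rewrite ler_pM2l// le_ser.
Qed.

Context (A A1 q : R -> R).
Hypothesis AL : hasL f A A1 (fun x => q x * A x).
Hypothesis A1b : A1 b = 0.
Hypothesis A_gt0 : forall x, 0 < A x.
Hypothesis A1_ge0 : forall x, b <= x -> 0 <= A1 x.
Hypothesis q_gt0 : forall x, 0 < q x.
Hypothesis cq : continuous q.
Hypothesis q_itv : forall x, b <= x <= a -> th - 1 <= q x <= th.

Local Notation G n := (surv f b a A q n b).
Local Notation mu := (mean_exit f b a b).

(** The sums over rings fix the mean and the second moment of the tail up to order [th]. The two
    squares [(th * mu) ^ 2] cancel, and [2 * th ^ 2 * var_exit] remains as leading term. The [+ 1]
    is the term [G 0]. *)
Lemma surv_tail n : th * mu + 1 < n%:R ->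
  2 * G n * (n%:R - (th * mu + 1)) ^+ 2 <=
  2 * th ^+ 2 * var_exit f b a b + 4 * th * mu + 2 * th * mu ^+ 2 + 4 * n%:R.
Proof.
move=> n_gt; have bab : b <= b <= a by rewrite lexx.
have th'_gt0 : 0 < th - 1 by move: th_ge2; lra.
have q_le x : b <= x <= a -> q x <= th by move=> /q_itv/andP[].
have q_ge x : b <= x <= a -> th - 1 <= q x by move=> /q_itv/andP[].
have /andP[_ mu0] : 0 <= mu <= mu by exact: mean_exit_ge0.
have {}mu0 : 0 <= mu by have /andP[] := mean_exit_ge0 cf f_gt0 bab.
have v0 : 0 <= var_exit f b a b by exact: var_exit_ge0.
have G_itv k : 0 <= G k <= 1 by exact: (surv_le1 cf f_gt0 AL).
have [G0|G0] := leP (G n) 0.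
  have -> : G n = 0 by apply/eqP; rewrite eq_le G0; have /andP[] := G_itv n.
  by rewrite mulr0 mul0r !addr_ge0 ?mulr_ge0 ?sqr_ge0 ?ler0n// ltW.
have Gdecr k : G k.+1 <= G k.
  by have /andP[] := surv_itv cf f_gt0 AL A1b A_gt0 A1_ge0 q_gt0 cq k bab.
have Glc k : G k * G k.+2 <= G k.+1 ^+ 2 by exact: (surv_logconcave cf f_gt0 ba AL).
have sum_up N := sum_surv_le cf f_gt0 ba AL A1b A_gt0 q_gt0 cq q_le N.
have sum_lo N := sum_surv_ge cf f_gt0 ba AL A1b A_gt0 q_gt0 cq th'_gt0 q_ge N.
have sum_n N := sum_nat_surv_le cf f_gt0 ba AL A1b A_gt0 q_gt0 cq q_le N.
(* With [N >= (th * mu) ^ 2] and [N * G N <= th * mu], the quantity [(th * mu) ^ 2 * G N] is of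
   order [th]: cutting the sums at [N] is affordable. *)
pose N := maxn n (Num.truncn ((th * mu) ^+ 2)).+1.
have nN : (n <= N)%N by rewrite leq_maxl.
have N_gt0 : (0 : R) < N%:R by rewrite ltr0n (leq_trans _ (leq_maxr _ _)).
have N_ge : (th * mu) ^+ 2 <= N%:R.
  apply: ltW; apply: (lt_le_trans (Num.Theory.truncnS_gt _)).
  by rewrite ler_nat; exact: leq_maxr.
have Ganti k l : (k <= l)%N -> G l <= G k.
  elim: l => [|l IH]; first by rewrite leqn0 => /eqP ->.
  by rewrite leq_eqVlt => /predU1P[->//|kl]; apply: (le_trans (Gdecr l)); exact: IH.
have GN : N%:R * G N <= th * mu.
  apply: le_trans (sum_up N); rewrite mulr_natl.
  have -> : G N *+ N = \sum_(k < N) G N by rewrite sumr_const card_ord.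
  by apply: ler_sum => k _; apply: Ganti.
set S := \sum_(j < N.+1) G j.
have SE : S = 1 + \sum_(k < N) G k.+1 by rewrite /S big_ord_recl.
have S_up : S <= th * mu + 1 by rewrite SE addrC lerD2r.
have S_lt : S < n%:R by exact: le_lt_trans n_gt.
have S_lo : (th - 1) * mu * (1 - G N) <= S.
  have := sum_lo N; rewrite SE => H; apply: (@le_trans _ _ (\sum_(k < N) G k.+1)).
    by apply: le_trans H; rewrite -mulrA mulrBr mulr1.
  by rewrite lerDr.
have M_up : \sum_(j < N.+1) j%:R * G j <= th * mu + th ^+ 2 * (mu ^+ 2 / 2 + var_exit f b a b).
  rewrite big_ord_recl mul0r add0r; apply: (le_trans (sum_n N)).
  by rewrite /mom2_exit mulrDr mulrA expr2.
have := logconcave_tail nN erefl G_itv Glc Gdecr G0 S_lt.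
rewrite -/S => H; apply: (@le_trans _ _ (2 * G n * (n%:R - S) ^+ 2)).
  apply: ler_wpM2l; first by rewrite mulr_ge0// ltW.
  by rewrite lerXn2r ?nnegrE ?subr_ge0 ?lerD2l ?lerN2// ltW.
apply: (le_trans H).
have /andP[gN0 gN1] := G_itv N.
have S2 : ((th - 1) * mu) ^+ 2 * (1 - 2 * G N) <= S ^+ 2.
  have h0 : 0 <= (th - 1) * mu * (1 - G N).
    by apply: mulr_ge0; [rewrite mulr_ge0// ltW|rewrite subr_ge0].
  apply: (@le_trans _ _ (((th - 1) * mu * (1 - G N)) ^+ 2)); last first.
    by rewrite lerXn2r ?nnegrE//; apply: le_trans S_lo.
  rewrite [leRHS]exprMn ler_wpM2l ?sqr_ge0//.
  by have := sqr_ge0 (G N); rewrite sqrrB expr1n mul1r -mulr_natl; lra.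
have GN2 : ((th - 1) * mu) ^+ 2 * G N <= th * mu.
  apply: le_trans GN; apply: ler_wpM2r => //; apply: le_trans N_ge.
  have h0 : 0 <= (th - 1) * mu by rewrite mulr_ge0// ltW.
  have h1 : (th - 1) * mu <= th * mu by rewrite ler_wpM2r// gerBl.
  by rewrite lerXn2r ?nnegrE// (le_trans h0).
have h3 : (th * mu) ^+ 2 - ((th - 1) * mu) ^+ 2 <= 2 * th * mu ^+ 2.
  have -> : (th * mu) ^+ 2 - ((th - 1) * mu) ^+ 2 = (2 * th - 1) * mu ^+ 2 by ring.
  by rewrite ler_wpM2r ?sqr_ge0// gerBl.
have h4 : ((th - 1) * mu) ^+ 2 * (1 - 2 * G N) = ((th - 1) * mu) ^+ 2 - 2 * (((th - 1) * mu) ^+ 2 * G N) by ring.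
rewrite h4 in S2.
have h5 : th ^+ 2 * (mu ^+ 2 / 2 + var_exit f b a b) = (th * mu) ^+ 2 / 2 + th ^+ 2 * var_exit f b a b.
  by rewrite mulrDr exprMn mulrA.
rewrite h5 in M_up.
move: S2 GN2 h3 M_up; rewrite -!mulrA; lra.
Qed.

End survival_tail.

(** * Moments of the normal law *)

Section taylor.
Context {R : realType}.
Implicit Types (x y z t c d al be : R) (k : nat).

Lemma taylor3_unit (h0 h1 h2 h3 : R -> R) (M : R) : 0 <= M ->
  (forall t, 0 <= t <= 1 -> is_derive t 1 h0 (h1 t)) ->
  (forall t, 0 <= t <= 1 -> is_derive t 1 h1 (h2 t)) ->
  (forall t, 0 <= t <= 1 -> is_derive t 1 h2 (h3 t)) ->
  (forall t, 0 <= t <= 1 -> h3 t <= M) ->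
  h0 1 <= h0 0 + h1 0 + h2 0 / 2 + M.
Proof.
move=> M0 d0 d1 d2 h3M.
have h2_le (t : R) : 0 <= t <= 1 -> h2 t <= h2 0 + M.
  move=> /andP[t0 t1].
  have := @le_derive_sub _ h2 h3 (fun t => M * t) (fun=> M) 0 t t0.
  rewrite -mulrBr subr0 => H; have : h2 t - h2 0 <= M * t.
    apply: H => z.
    - by move=> z0; apply: d2; lra.
    - move=> _; have := is_deriveMT (is_deriveCT M z) (is_derive_idT z).
      by move/is_derive_eq; apply; rewrite mul0r add0r mulr1.
    - by move=> z0; apply: h3M; lra.
  by have : M * t <= M by [rewrite ler_piMr]; lra.
have h1_le (t : R) : 0 <= t <= 1 -> h1 t <= h1 0 + (h2 0 + M) * t.
  move=> /andP[t0 t1].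
  have := @le_derive_sub _ h1 h2 (fun t => (h2 0 + M) * t) (fun=> h2 0 + M) 0 t t0.
  rewrite -mulrBr subr0 => H; have : h1 t - h1 0 <= (h2 0 + M) * t.
    apply: H => z.
    - by move=> z0; apply: d1; lra.
    - move=> _; have := is_deriveMT (is_deriveCT (h2 0 + M) z) (is_derive_idT z).
      by move/is_derive_eq; apply; rewrite mul0r add0r mulr1.
    - by move=> z0; apply: h2_le; lra.
  by lra.
have := @le_derive_sub _ h0 h1 (fun t => h1 0 * t + (h2 0 + M) / 2 * (t * t))
  (fun t => h1 0 + (h2 0 + M) * t) 0 1 ler01.
rewrite !mulr0 !mulr1 addr0 subr0 => H.
have : h0 1 - h0 0 <= h1 0 + (h2 0 + M) / 2.
  apply: H => z.
  - move=> _; have := is_deriveDT (is_deriveMT (is_deriveCT (h1 0) z) (is_derive_idT z))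
      (is_deriveMT (is_deriveCT ((h2 0 + M) / 2) z) (is_deriveMT (is_derive_idT z) (is_derive_idT z))).
    by move/is_derive_eq; apply; field.
  - by move=> z0; apply: h1_le; lra.
lra.
Qed.

Lemma taylor3 (g0 g1 g2 g3 : R -> R) (M c d x y : R) : 0 <= M ->
  (forall z, c <= z <= d -> is_derive z 1 g0 (g1 z)) ->
  (forall z, c <= z <= d -> is_derive z 1 g1 (g2 z)) ->
  (forall z, c <= z <= d -> is_derive z 1 g2 (g3 z)) ->
  (forall z, c <= z <= d -> `|g3 z| <= M) ->
  c <= x <= d -> c <= y <= d ->
  g0 y <= g0 x + (y - x) * g1 x + (y - x) ^+ 2 / 2 * g2 x + M * `|y - x| ^+ 3.
Proof.
move=> M0 d0 d1 d2 g3M /andP[cx xd] /andP[cy yd].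
pose l t := x + t * (y - x).
have lP (t : R) : 0 <= t <= 1 -> c <= l t <= d.
  move=> /andP[t0 t1].
  have -> : l t = (1 - t) * x + t * y by rewrite /l; ring.
  have h1 : 0 <= t * (y - c) by rewrite mulr_ge0// subr_ge0.
  have h2 : 0 <= (1 - t) * (x - c) by rewrite mulr_ge0// subr_ge0.
  have h3 : 0 <= t * (d - y) by rewrite mulr_ge0// subr_ge0.
  have h4 : 0 <= (1 - t) * (d - x) by rewrite mulr_ge0// subr_ge0.
  apply/andP; split; lra.
have dl (t : R) : is_derive t 1 l (y - x).
  have := is_deriveDT (is_deriveCT x t) (is_deriveMT (is_derive_idT t) (is_deriveCT (y - x) t)).
  by move/is_derive_eq; apply; ring.
have dcomp (G G1 : R -> R) k (t : R) : 0 <= t <= 1 ->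
    (forall z, c <= z <= d -> is_derive z 1 G (G1 z)) ->
    is_derive t 1 (fun t => (y - x) ^+ k * G (l t)) ((y - x) ^+ k.+1 * G1 (l t)).
  move=> t01 dG; have := is_derive1_comp (dG _ (lP t t01)) (dl t) => dc.
  have := is_deriveMT (is_deriveCT ((y - x) ^+ k) t) dc.
  by move/is_derive_eq; apply; rewrite exprS; ring.
have := @taylor3_unit (fun t => (y - x) ^+ 0 * g0 (l t)) (fun t => (y - x) ^+ 1 * g1 (l t))
  (fun t => (y - x) ^+ 2 * g2 (l t)) (fun t => (y - x) ^+ 3 * g3 (l t)) (M * `|y - x| ^+ 3).
have l0 : l 0 = x by rewrite /l mul0r addr0.
have l1 : l 1 = y by rewrite /l mul1r addrC subrK.
rewrite l0 l1 expr0 !mul1r expr1 => H.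
have -> : (y - x) ^+ 2 / 2 * g2 x = (y - x) ^+ 2 * g2 x / 2 by ring.
apply: H.
- by rewrite mulr_ge0// exprn_ge0.
- move=> t t01; move/is_derive_eq: (dcomp g0 g1 0%N t t01 d0).
  by under eq_fun do rewrite expr0 mul1r; move=> H; apply: H; rewrite expr1.
- by move=> t t01; exact: (dcomp g1 g2 1%N t t01 d1).
- by move=> t t01; exact: (dcomp g2 g3 2%N t t01 d2).
- move=> t t01; apply: (le_trans (ler_norm _)).
  rewrite normrM normrX mulrC ler_wpM2r ?exprn_ge0//; exact: g3M (lP t t01).
Qed.

(* The second bound is a Richardson extrapolation: the quartic terms of the two
   hyperbolic cosines cancel. *)
Lemma sqr_cosh_bounds (y : R) : y ^+ 2 <= expR y + expR (- y) - 2 /\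
  16 * (expR (y / 2) + expR (- (y / 2)) - 2) - (expR y + expR (- y) - 2) <= 3 * y ^+ 2.
Proof.
wlog y0 : y / 0 <= y.
  move=> H; have [/H//|/ltW yn] := leP 0 y.
  have [|+ +] := H (- y); first by rewrite oppr_ge0.
  rewrite sqrrN opprK mulNr opprK [expR (- y) + _]addrC [expR (- (y / 2)) + _]addrC.
  by move=> h1 h2; split.
pose ch c (x : R) := expR (c * x) + expR (- c * x).
pose sh c (x : R) := expR (c * x) - expR (- c * x).
have dE c x : is_derive x 1 (fun z : R => expR (c * z)) (c * expR (c * x)).
  have := is_derive_expRT (is_deriveMT (is_deriveCT c x) (is_derive_idT x)).
  by move/is_derive_eq; apply; rewrite mul0r add0r mulr1.
have dch c x : is_derive x 1 (ch c) (c * sh c x).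
  by have := is_deriveDT (dE c x) (dE (- c) x); move/is_derive_eq; apply; rewrite /sh; ring.
have dsh c x : is_derive x 1 (sh c) (c * ch c x).
  by have := is_deriveDT (dE c x) (is_deriveNT (dE (- c) x)); move/is_derive_eq; apply; rewrite /ch; ring.
have dl c x : is_derive x 1 (fun z : R => c * z) c.
  by have := is_deriveMT (is_deriveCT c x) (is_derive_idT x); move/is_derive_eq; apply; rewrite mul0r add0r mulr1.
have dq c x : is_derive x 1 (fun z : R => c * z ^+ 2) (2 * c * x).
  by have := is_deriveMT (is_deriveCT c x) (is_deriveXT 1 (is_derive_idT x)); move/is_derive_eq; apply; ring.
have ch_ge2 c x : 2 <= ch c x.
  by have := expR_ge1Dx (c * x); have := expR_ge1Dx (- c * x); rewrite /ch mulNr; lra.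
have chD x : ch 1 x = ch 2^-1 x ^+ 2 - 2.
  have e2 c : expR (c * x) = expR (c / 2 * x) ^+ 2 by rewrite -expRM_natl; congr expR; field.
  have e1 : expR (2^-1 * x) * expR (- 2^-1 * x) = 1 by rewrite -expRD mulNr subrr expR0.
  by rewrite /ch (e2 1) (e2 (- 1)) mulNr !div1r sqrrD e1; ring.
have sh1 x : 0 <= x -> 2 * x <= sh 1 x /\ 8 * sh 2^-1 x - sh 1 x <= 6 * x.
  move=> x0; split.
    have := @le_derive_sub _ _ _ _ _ _ _ x0 (fun z _ => dl 2 z) (fun z _ => dsh 1 z).
    rewrite /sh !mulr0 !expR0 subrr !subr0; apply=> z _.
    by rewrite mul1r ch_ge2.
  (* With [c = ch 2^-1 z], the derivative is [4 * c - (c ^ 2 - 2) = 6 - (c - 2) ^ 2]. *)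
  have dd z := is_deriveDT (is_deriveMT (is_deriveCT 8 z) (dsh 2^-1 z)) (is_deriveNT (dsh 1 z)).
  have := @le_derive_sub _ _ _ _ _ _ _ x0 (fun z _ => dd z) (fun z _ => dl 6 z).
  rewrite /sh !mulr0 !expR0 !subrr !mulr0 !subr0; apply=> z _.
  by rewrite mul0r add0r mul1r chD; have := sqr_ge0 (ch 2^-1 z - 2); lra.
split.
  have := @le_derive_sub _ _ _ _ _ _ _ y0 (fun z _ => dq 1 z) (fun z _ => dch 1 z).
  rewrite /ch !mulr0 !expR0 expr0n/= mulr0 subr0 !mul1r mulN1r; apply=> z /andP[z0 _].
  by have [] := sh1 z (ltW z0); lra.
have dd z := is_deriveDT (is_deriveMT (is_deriveCT 16 z) (dch 2^-1 z)) (is_deriveNT (dch 1 z)).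
have := @le_derive_sub _ _ _ _ _ _ _ y0 (fun z _ => dd z) (fun z _ => dq 3 z).
rewrite /ch !mulr0 !expR0 expr0n/= mulr0 subr0 !mul1r mulN1r ![2^-1 * y]mulrC mulNr ![2^-1 * y]mulrC.
move=> H; have {}H := H _; apply: le_trans (H _); first lra.
by move=> z /andP[z0 _]; have [_] := sh1 z (ltW z0); lra.
Qed.

End taylor.

(** * Gaussian integrals of functions of quartic growth *)

Section gaussian.
Context {R : realType} (sigma : R).
Hypothesis sigma_gt0 : 0 < sigma.
Local Notation mu := (@lebesgue_measure R).
Local Notation N := (normal_prob (0 : R) sigma).

Lemma integral_normal_prob (g : R -> R) : (forall x, 0 <= g x) -> measurable_fun setT g ->
  (\int[N]_x (g x)%:E = \int[mu]_x (g x * normal_pdf 0 sigma x)%:E)%E.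
Proof.
move=> g0 mg; have dom := normal_prob_dominates (0 : R) sigma.
rewrite -(Radon_Nikodym_SigmaFinite.change_of_variables dom)//=; last exact/measurable_EFinP.
have mpdf : measurable_fun [set: R] (fun x => (normal_pdf 0 sigma x)%:E).
  by apply/measurable_EFinP; exact: measurable_normal_pdf.
have intRN := Radon_Nikodym_SigmaFinite.f_integrable dom.
apply: ge0_ae_eq_integral => //.
- by apply: emeasurable_funM; [exact/measurable_EFinP|exact: measurable_int intRN].
- by apply/measurable_EFinP; apply: measurable_funM => //; exact: measurable_normal_pdf.
- move=> x _; rewrite mule_ge0 ?lee_fin//.
  exact: Radon_Nikodym_SigmaFinite.f_ge0.
- by move=> x _; rewrite lee_fin mulr_ge0 ?normal_pdf_ge0.
have : ae_eq mu setT (Radon_Nikodym_SigmaFinite.f N mu) (fun x => (normal_pdf 0 sigma x)%:E).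
  apply: integral_ae_eq => // E _ mE.
  by rewrite -Radon_Nikodym_SigmaFinite.f_integral.
by apply: filterS => x /= H _; rewrite H// EFinM.
Qed.

Lemma normal_mgf (s : R) :
  (\int[N]_x (expR (s * x))%:E = (expR (s ^+ 2 * sigma ^+ 2 / 2))%:E)%E.
Proof.
have s0 : sigma != 0 by rewrite gt_eqF.
rewrite integral_normal_prob; last 2 first.
- by move=> x; exact: expR_ge0.
- by apply: measurableT_comp => //; exact: measurable_funM.
(* Completing the square: the exponential tilts the centred law into the normal law of mean
   [s * sigma ^ 2]. *)
transitivity (\int[mu]_x ((expR (s ^+ 2 * sigma ^+ 2 / 2))%:E *
   (normal_pdf (s * sigma ^+ 2) sigma x)%:E))%E.
  apply: eq_integral => x _; rewrite -EFinM !normal_pdfE//; congr EFin.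
  rewrite mulrCA [RHS]mulrCA; congr (_ * _); rewrite /normal_fun -!expRD; congr expR.
  by rewrite -mulr_natr; field.
rewrite ge0_integralZl//; last 2 first.
- by apply/measurable_EFinP; exact: measurable_normal_pdf.
- by move=> x _; rewrite lee_fin normal_pdf_ge0.
by rewrite integral_normal_pdf mule1.
Qed.

Let mexp (s : R) : measurable_fun [set: R] (fun x => expR (s * x)).
Proof. by apply: measurableT_comp => //; exact: measurable_funM. Qed.

Lemma normal_exp_integrable (s : R) : N.-integrable setT (EFin \o (fun x => expR (s * x))).
Proof.
apply/integrableP; split; first by apply/measurable_EFinP; exact: mexp.
under eq_integral do rewrite /= ger0_norm ?expR_ge0//.
by rewrite normal_mgf ltry.
Qed.

Let ch (s x : R) := expR (s * x) + expR (- s * x).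

Let ch_integrable s : N.-integrable setT (EFin \o ch s).
Proof.
have := integrableD measurableT (normal_exp_integrable s) (normal_exp_integrable (- s)).
by apply: eq_integrable => // x _; rewrite /= EFinD.
Qed.

Let ch_int s : \int[N]_x ch s x = 2 * expR (s ^+ 2 * sigma ^+ 2 / 2).
Proof.
rewrite /ch RintegralD//; [|exact: normal_exp_integrable..].
by rewrite /Rintegral !normal_mgf/= sqrrN; ring.
Qed.

Let quartic_le (x : R) : x ^+ 4 <= 24 * sigma ^+ 4 * ch (sigma^-1) x.
Proof.
wlog x0 : x / 0 <= x.
  move=> H; have [|x0] := leP 0 x; first exact: H.
  have := H (- x); rewrite oppr_ge0 (ltW x0) => /(_ isT).
  have -> : (- x) ^+ 4 = x ^+ 4 by ring.
  by have -> : ch sigma^-1 (- x) = ch sigma^-1 x by rewrite /ch !mulrN !mulNr opprK addrC.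
have h1 := @expR_ge1Dxn R (x / sigma) 3 (divr_ge0 x0 (ltW sigma_gt0)).
have -> : x ^+ 4 = 24 * sigma ^+ 4 * ((x / sigma) ^+ 4 / 24).
  by field; rewrite gt_eqF.
rewrite ler_wpM2l ?mulr_ge0 ?exprn_ge0 ?(ltW sigma_gt0)//.
rewrite /ch (mulrC sigma^-1); have := expR_ge0 (- sigma^-1 * x).
by move: h1; rewrite (_ : 4`! = 24)%N//; lra.
Qed.

Lemma normal_quartic_integrable : N.-integrable setT (EFin \o (fun x : R => x ^+ 4)).
Proof.
have H := integrableZl measurableT (24 * sigma ^+ 4) (ch_integrable sigma^-1).
apply: (le_integrable measurableT _ _ H).
  by apply/measurable_EFinP; exact: measurable_funX.
move=> x _ /=; rewrite !ger0_norm; first by rewrite lee_fin; exact: quartic_le.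
  by rewrite !mulr_ge0 ?exprn_ge0 ?(ltW sigma_gt0)// addr_ge0 ?expR_ge0.
by rewrite exprn_even_ge0.
Qed.

(** The exact constant is 3, but only the order in [sigma] matters. From [y ^ 4 / 4! <= expR y] at
    [y = |x| / sigma] the bound is [24 * 2 * expR (1 / 2)], and [expR (1 / 2) <= 2]. *)
Lemma normal_quartic_le : \int[N]_x x ^+ 4 <= 96 * sigma ^+ 4.
Proof.
apply: (@le_trans _ _ (\int[N]_x (24 * sigma ^+ 4 * ch sigma^-1 x))).
  apply: le_Rintegral => //; first exact: normal_quartic_integrable.
  exact: (integrableZl measurableT (24 * sigma ^+ 4) (ch_integrable sigma^-1)).
rewrite RintegralZl// ch_int.
have -> : sigma^-1 ^+ 2 * sigma ^+ 2 / 2 = 2^-1 by field; rewrite gt_eqF.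
have e2 : expR 2^-1 <= 2 :> R.
  have := @expR_ge1Dx R (- 2^-1); rewrite expRN => h.
  have : 2^-1 <= (expR 2^-1)^-1 :> R by lra.
  by rewrite lef_pV2 ?posrE ?expR_gt0.
have : sigma ^+ 4 * expR 2^-1 <= sigma ^+ 4 * 2 by rewrite ler_wpM2l// exprn_ge0// ltW.
lra.
Qed.

Let cst_integrable (k : R) : N.-integrable setT (EFin \o cst k).
Proof. exact: finite_measure_integrable_cst. Qed.

Let sq_integrable : N.-integrable setT (EFin \o (fun x : R => x ^+ 2)).
Proof.
have H := integrableD measurableT (cst_integrable 1) normal_quartic_integrable.
apply: (le_integrable measurableT _ _ H).
  by apply/measurable_EFinP; exact: measurable_funX.
move=> x _ /=; rewrite lee_fin ger0_norm ?sqr_ge0// ger0_norm; last first.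
  by rewrite addr_ge0// exprn_even_ge0.
by have := sqr_ge0 (x ^+ 2 - 1); rewrite (_ : x ^+ 4 = (x ^+ 2) ^+ 2) -?exprM//; nra.
Qed.

Let id_integrable : N.-integrable setT (EFin \o (fun x : R => x)).
Proof.
have H := integrableD measurableT (cst_integrable 1) sq_integrable.
apply: (le_integrable measurableT _ _ H).
  by apply/measurable_EFinP; exact: measurable_id.
move=> x _ /=; rewrite lee_fin [leRHS]ger0_norm; last first.
  by rewrite addr_ge0// sqr_ge0.
by have := sqr_ge0 (`|x| - 1); rewrite sqrrB real_normK ?num_real//; have := normr_ge0 x; nra.
Qed.

Let small_le0 (c K t0 : R) : 0 < t0 -> (forall t, 0 < t <= t0 -> c <= t * K) -> c <= 0.
Proof.
move=> t00 H; apply/ler_addgt0Pl => e e0; rewrite addr0.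
pose t := Num.min t0 (e / (`|K| + 1)).
have k0 : 0 < `|K| + 1 by rewrite ltr_pwDr.
have t_gt0 : 0 < t by rewrite lt_min t00 divr_gt0.
apply: (le_trans (H t _)); first by rewrite t_gt0 ge_min lexx.
apply: (@le_trans _ _ (t * (`|K| + 1))).
  by rewrite ler_pM2l//; have := ler_norm K; lra.
by rewrite -ler_pdivlMr// ge_min lexx orbT.
Qed.

Let si0 : 0 < sigma^-1. Proof. by rewrite invr_gt0. Qed.

Let mgf_le (t : R) : 0 < t <= sigma^-1 ->
  expR (t ^+ 2 * sigma ^+ 2 / 2) <= 1 + t ^+ 2 * sigma ^+ 2 / 2 + t ^+ 4 * sigma ^+ 4 / 2.
Proof.
move=> /andP[t0 ts]; pose y := t ^+ 2 * sigma ^+ 2 / 2.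
have -> : t ^+ 4 * sigma ^+ 4 / 2 = 2 * y ^+ 2 by rewrite /y; field.
rewrite -/y; have y1 : y <= 2^-1.
  rewrite /y ler_pdivrMr// mulVf// -exprMn exprn_ile1 ?mulr_ge0 ?(ltW sigma_gt0) ?(ltW t0)//.
  by rewrite -ler_pdivlMr// mul1r.
have h := expR_ge1Dx (- y); rewrite expRN in h.
have h2 : (1 - y) * expR y <= 1.
  by have := h; rewrite -(ler_pM2r (expR_gt0 y)) mulVf ?gt_eqF ?expR_gt0.
have y2 : 0 < 1 - y by lra.
rewrite -(ler_pM2l y2); apply: (le_trans h2).
have -> : (1 - y) * (1 + y + 2 * y ^+ 2) = 1 + y ^+ 2 * (1 - 2 * y) by ring.
by rewrite lerDl mulr_ge0 ?sqr_ge0//; lra.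
Qed.

(** Integrating [1 + e * t * x <= expR (e * t * x)] for [e] equal to 1 and to -1 bounds both signs
    of the mean by a multiple of [t], which tends to 0. *)
Lemma normal_mean : \int[N]_x x = 0.
Proof.
have key (e t : R) : e ^+ 2 = 1 -> 0 < t <= sigma^-1 ->
    e * \int[N]_x x <= t * (sigma ^+ 2 / 2 + sigma ^+ 2 / 2).
  move=> ee /[dup] tt /andP[t0 ts].
  have i1 : N.-integrable setT (EFin \o (fun x : R => e * t * x)).
    exact: (integrableZl measurableT (e * t) id_integrable).
  have i2 := integrableD measurableT (cst_integrable 1) i1.
  have : \int[N]_x (1 + e * t * x) <= \int[N]_x expR (e * t * x).
    apply: le_Rintegral => //; first exact: normal_exp_integrable.
    by move=> x _; exact: expR_ge1Dx.
  rewrite (@RintegralD _ _ _ N setT _ _ measurableT (cst_integrable 1) i1).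
  rewrite (RintegralZl (e * t) measurableT id_integrable).
  rewrite Rintegral_cst//= probability_setT /= mulr1.
  rewrite {2}/Rintegral normal_mgf /= exprMn ee mul1r => H.
  have := mgf_le tt; set I := \int[N]_x x in H *.
  have -> : t ^+ 4 * sigma ^+ 4 / 2 = t * (t ^+ 2 * sigma ^+ 2 * (t * sigma ^+ 2 / 2)) by field.
  have u1 : t ^+ 2 * sigma ^+ 2 <= 1.
    rewrite -exprMn exprn_ile1 ?mulr_ge0 ?(ltW sigma_gt0) ?(ltW t0)//.
    by rewrite -ler_pdivlMr// mul1r.
  have u2 : 0 <= t * sigma ^+ 2 / 2 by rewrite divr_ge0// mulr_ge0 ?sqr_ge0// ltW.
  have u3 : t * (t ^+ 2 * sigma ^+ 2 * (t * sigma ^+ 2 / 2)) <= t * (t * sigma ^+ 2 / 2).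
    by rewrite ler_pM2l// ler_piMl.
  move=> h; rewrite -(ler_pM2l t0); lra.
apply/eqP; rewrite eq_le; apply/andP; split.
  apply: (small_le0 si0) => t tt; rewrite -[leLHS]mul1r.
  by apply: key => //; rewrite expr1n.
rewrite -oppr_le0; apply: (small_le0 si0) => t tt; rewrite -mulN1r.
by apply: key => //; rewrite sqrrN expr1n.
Qed.

(** The two halves of [sqr_cosh_bounds] at [t * x] squeeze [t ^ 2 * I] between combinations of
    moment generating functions equal to [t ^ 2 * sigma ^ 2] up to order [t ^ 4]. *)
Lemma normal_variance : \int[N]_x x ^+ 2 = sigma ^+ 2.
Proof.
have i0 t : N.-integrable setT (EFin \o (fun x : R => ch t x - 2)).
  have := integrableD measurableT (ch_integrable t) (cst_integrable (-2)).
  by apply: eq_integrable => // x _; rewrite /= EFinD.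
have E0 t : \int[N]_x (ch t x - 2) = 2 * expR (t ^+ 2 * sigma ^+ 2 / 2) - 2.
  rewrite (@RintegralB _ _ _ N setT (ch t) (cst 2) measurableT (ch_integrable t) (cst_integrable 2)).
  by rewrite ch_int Rintegral_cst//= probability_setT /= mulr1.
set I := \int[N]_x x ^+ 2.
have up t : t ^+ 2 * I <= 2 * expR (t ^+ 2 * sigma ^+ 2 / 2) - 2.
  rewrite -E0 -(RintegralZl (t ^+ 2) measurableT sq_integrable).
  apply: le_Rintegral => //.
    exact: (integrableZl measurableT (t ^+ 2) sq_integrable).
  by move=> x _; have [+ _] := sqr_cosh_bounds (t * x); rewrite exprMn /ch mulNr.
have lo t : 16 * (2 * expR ((t / 2) ^+ 2 * sigma ^+ 2 / 2) - 2) <=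
    3 * t ^+ 2 * I + (2 * expR (t ^+ 2 * sigma ^+ 2 / 2) - 2).
  have i1 : N.-integrable setT (EFin \o (fun x : R => 3 * t ^+ 2 * x ^+ 2)).
    exact: (integrableZl measurableT (3 * t ^+ 2) sq_integrable).
  rewrite -!E0 -(RintegralZl 16 measurableT (i0 (t / 2))).
  rewrite -(RintegralZl (3 * t ^+ 2) measurableT sq_integrable).
  rewrite -(@RintegralD _ _ _ N setT _ _ measurableT i1 (i0 t)).
  apply: le_Rintegral => //.
  - exact: (integrableZl measurableT 16 (i0 (t / 2))).
  - exact: (integrableD measurableT i1 (i0 t)).
  move=> x _; have [_] := sqr_cosh_bounds (t * x).
  by rewrite exprMn /ch !mulNr (mulrAC t x) => h; lra.
have key (t : R) : 0 < t <= sigma^-1 -> `|I - sigma ^+ 2| <= t * (t * sigma ^+ 4).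
  move=> /[dup] tt /andP[t0 ts]; have t2 : 0 < t ^+ 2 by rewrite exprn_gt0.
  have := mgf_le tt; have := up t; have := lo t.
  have := expR_ge1Dx ((t / 2) ^+ 2 * sigma ^+ 2 / 2).
  have s4 : 0 <= t ^+ 4 * sigma ^+ 4 by rewrite mulr_ge0// exprn_ge0// ltW.
  have -> : (t / 2) ^+ 2 * sigma ^+ 2 / 2 = t ^+ 2 * sigma ^+ 2 / 8 by field.
  move=> h1 h2 h3 h4; rewrite -(ler_pM2l t2) -{1}(gtr0_norm t2) -normrM mulrBr.
  rewrite (_ : t ^+ 2 * (t * (t * sigma ^+ 4)) = t ^+ 4 * sigma ^+ 4); last by ring.
  by rewrite ler_norml; apply/andP; split; lra.
apply/eqP; rewrite -subr_eq0 -normr_le0.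
apply: (@small_le0 _ (sigma^-1 * sigma ^+ 4) _ si0) => t /[dup] tt /andP[t0 ts].
apply: (le_trans (key t tt)).
by rewrite ler_pM2l// ler_wpM2r// exprn_ge0// ltW.
Qed.

Lemma normal_integral_le (g : R -> R) (al be ga de : R) : 0 <= de ->
  measurable_fun setT g -> (forall x, 0 <= g x) ->
  (forall x, g x <= al + be * x + ga * x ^+ 2 + de * x ^+ 4) ->
  (\int[N]_x (g x)%:E <= (al + ga * sigma ^+ 2 + 96 * de * sigma ^+ 4)%:E)%E.
Proof.
move=> de0 mg g0 gle.
have i1 : N.-integrable setT (EFin \o (fun x : R => be * x)).
  exact: (integrableZl measurableT be id_integrable).
have i2 : N.-integrable setT (EFin \o (fun x : R => ga * x ^+ 2)).
  exact: (integrableZl measurableT ga sq_integrable).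
have i4 : N.-integrable setT (EFin \o (fun x : R => de * x ^+ 4)).
  exact: (integrableZl measurableT de normal_quartic_integrable).
have j1 := integrableD measurableT (cst_integrable al) i1.
have j2 := integrableD measurableT j1 i2.
have j3 := integrableD measurableT j2 i4.
have ig : N.-integrable setT (EFin \o g).
  apply: (le_integrable measurableT _ _ j3); first by apply/measurable_EFinP.
  move=> x _ /=; rewrite lee_fin ger0_norm//; apply: le_trans (ler_norm _).
  exact: gle.
have : \int[N]_x g x <= \int[N]_x (al + be * x + ga * x ^+ 2 + de * x ^+ 4).
  by apply: le_Rintegral.
rewrite (@RintegralD _ _ _ N setT (fun x => al + be * x + ga * x ^+ 2) (fun x => de * x ^+ 4) measurableT j2 i4).
rewrite (@RintegralD _ _ _ N setT (fun x => al + be * x) (fun x => ga * x ^+ 2) measurableT j1 i2).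
rewrite (@RintegralD _ _ _ N setT (cst al) (fun x => be * x) measurableT (cst_integrable al) i1).
rewrite (RintegralZl be measurableT id_integrable) (RintegralZl ga measurableT sq_integrable).
rewrite (RintegralZl de measurableT normal_quartic_integrable) normal_mean normal_variance mulr0 addr0.
rewrite Rintegral_cst//= probability_setT /= mulr1 => H.
have fin : (\int[N]_x (g x)%:E)%E \is a fin_num by exact: integrable_fin_num ig.
rewrite -(fineK fin) lee_fin; apply: (le_trans H); rewrite lerD2l.
have -> : 96 * de * sigma ^+ 4 = de * (96 * sigma ^+ 4) by ring.
by apply: ler_wpM2l => //; exact: normal_quartic_le.
Qed.

End gaussian.

(** * One Euler step *)

Section one_step.
Context {R : realType} (f f1 : R -> R) (b b' a' a : R) (A A1 q q1 : R -> R).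
Implicit Types (x y z h : R).
Hypothesis cf : continuous f.
Hypothesis cf1 : continuous f1.
Hypothesis f_gt0 : forall x, 0 < f x.
Hypothesis df : forall x, b <= x <= a -> is_derive x 1 f (f1 x).
Hypothesis bb' : b < b'.
Hypothesis ba' : b' <= a'.
Hypothesis aa' : a' < a.
Hypothesis AL : hasL f A A1 (fun x => q x * A x).
Hypothesis A1b : A1 b = 0.
Hypothesis A_gt0 : forall x, 0 < A x.
Hypothesis A1_ge0 : forall x, b <= x -> 0 <= A1 x.
Hypothesis q_gt0 : forall x, 0 < q x.
Hypothesis dq : forall x, is_derive x 1 q (q1 x).
Hypothesis cq1 : continuous q1.

Let cq : continuous q. Proof. exact: is_derive_continuousT dq. Qed.
Let ba : b <= a. Proof. by apply/ltW/(lt_trans bb')/(le_lt_trans ba'). Qed.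

Local Notation sv := (surv f b a A q).

Let csv k : continuous (sv k).
Proof. exact: (continuous_surv cf f_gt0 AL A_gt0 cq). Qed.

Definition dsurv k : R -> R :=
  if k is k'.+1 then dresolv f b a A A1 q (sv k') else fun=> 0.

Let dsurvP k x : is_derive x 1 (sv k) (dsurv k x).
Proof.
case: k => [|k] /=; first exact: is_deriveCT.
by have [h1 h2] := resolv_hasL b a cf f_gt0 AL A_gt0 cq (@csv k); exact: h1.
Qed.

Let d2surv k x := q x * (sv k.+1 x - sv k x) - dsurv k.+1 x / f x.

Let d2survP k x : is_derive x 1 (dsurv k.+1) (d2surv k x).
Proof.
by have [h1 h2] := resolv_hasL b a cf f_gt0 AL A_gt0 cq (@csv k); exact: h2.
Qed.

Let d3surv k x := q1 x * (sv k.+1 x - sv k x) + q x * (dsurv k.+1 x - dsurv k x)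
  - (d2surv k x * f x - dsurv k.+1 x * f1 x) / f x ^+ 2.

Let d3survP k x : b <= x <= a -> is_derive x 1 (d2surv k) (d3surv k x).
Proof.
move=> xab; have fx0 : f x != 0 by rewrite gt_eqF.
have d1 := is_deriveMT (dq x) (is_deriveDT (dsurvP k.+1 x) (is_deriveNT (dsurvP k x))).
have d2 := is_deriveMT (d2survP k x) (is_deriveVT fx0 (df xab)).
have := is_deriveDT d1 (is_deriveNT d2).
by move/is_derive_eq; apply; rewrite /d3surv; field.
Qed.

Let cds k : continuous (dsurv k).
Proof.
case: k => [|k]; first exact: continuousCT.
exact: is_derive_continuousT (d2survP k).
Qed.

Let cVf : continuous (fun x => (f x)^-1).
Proof. by apply: continuousVT => // x; rewrite gt_eqF. Qed.

Let cd2 k : continuous (d2surv k).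
Proof.
apply: continuousDT.
  by apply: continuousMT => //; apply: continuousDT => //; exact: continuousNT.
by apply: continuousNT; exact: continuousMT.
Qed.

Let cd3 k : continuous (d3surv k).
Proof.
apply: continuousDT.
  apply: continuousDT.
    by apply: continuousMT => //; apply: continuousDT => //; exact: continuousNT.
  by apply: continuousMT => //; apply: continuousDT => //; exact: continuousNT.
apply: continuousNT; apply: continuousMT.
  by apply: continuousDT; [|apply: continuousNT]; apply: continuousMT.
by apply: continuousVT => [x|]; [rewrite expf_neq0// gt_eqF|exact: continuousXT].
Qed.

Let bounded_on (g : R -> R) : continuous g ->
  exists2 M, 0 <= M & forall x, b <= x <= a -> `|g x| <= M.
Proof.
move=> cg.
have cn : {within `[b, a], continuous (fun x => `|g x|)}.
  by apply: continuous_subspaceT => x; apply: cvg_norm; exact: cg.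
have [c _ Hc] := EVT_max ba cn.
exists `|g c| => // x xab; apply: Hc; rewrite in_itv/=; exact: xab.
Qed.

(** Gaussian increments are unbounded while survival functions are controlled on an interval only;
    composition with this projection extends their bounds and Lipschitz constants to the line. *)
Definition clamp (l u y : R) : R := Num.max l (Num.min y u).

Lemma clamp_id (l u y : R) : l <= y <= u -> clamp l u y = y.
Proof. by move=> /andP[ly yu]; rewrite /clamp (min_idPl yu) (max_idPr ly). Qed.

Lemma clamp_itv (l u y : R) : l <= u -> l <= clamp l u y <= u.
Proof. by move=> lu; rewrite /clamp le_max lexx/= ge_max lu ge_min lexx orbT. Qed.

Lemma continuous_clamp (l u : R) : continuous (clamp l u).
Proof.
move=> x; apply: (@continuous_max _ R (fun=> l) (fun y => Num.min y u)).
  exact: continuousCT.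
apply: (@continuous_min _ R (fun y => y) (fun=> u)); first exact: cvg_id.
exact: continuousCT.
Qed.

Lemma clamp_lip (l u x y : R) : `|clamp l u x - clamp l u y| <= `|x - y|.
Proof.
wlog yx : x y / y <= x.
  by move=> H; have [/H//|/ltW/H] := leP y x; rewrite distrC [leRHS]distrC.
rewrite (ger0_norm (_ : 0 <= x - y)) ?subr_ge0// ler_norml /clamp /Num.max /Num.min.
case: (ltP x u) => xu; case: (ltP y u) => yu;
  [case: (ltP l x) => ?; case: (ltP l y) => ?|case: (ltP l x) => ?; case: (ltP l u) => ?
  |case: (ltP l u) => ?; case: (ltP l y) => ?|case: (ltP l u) => ?];
  by apply/andP; split; lra.
Qed.

Lemma surv_lip k : exists2 L : R, 0 <= L &
  forall x y, `|sv k (clamp b a x) - sv k (clamp b a y)| <= L * `|x - y|.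
Proof.
have [M M0 HM] := bounded_on (@cds k); exists M => // x y.
suff H u v : b <= u <= a -> b <= v <= a -> u <= v -> `|sv k v - sv k u| <= M * (v - u).
  apply: (@le_trans _ _ (M * `|clamp b a x - clamp b a y|)); last by rewrite ler_wpM2l// clamp_lip.
  have hx := clamp_itv x ba; have hy := clamp_itv y ba.
  have [xy|/ltW xy] := leP (clamp b a x) (clamp b a y).
    by rewrite distrC [X in M * X]distrC [X in M * X]ger0_norm ?subr_ge0// H.
  by rewrite [X in M * X]ger0_norm ?subr_ge0// H.
move=> uab vab uv.
have dM (c : R) z : is_derive z 1 (fun x : R => c * x) c.
  by have := is_deriveMT (is_deriveCT c z) (is_derive_idT z); move/is_derive_eq; apply; rewrite mul0r add0r mulr1.
have Hz z : u < z < v -> - M <= dsurv k z <= M.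
  by move=> zuv; rewrite -ler_norml; apply: HM; lra.
have h1 := @le_derive_sub _ (sv k) (dsurv k) (fun x => M * x) (fun=> M) u v uv
  (fun z _ => dsurvP k z) (fun z _ => dM M z) (fun z zuv => proj2 (andP (Hz z zuv))).
have h2 := @le_derive_sub _ (fun x => - M * x) (fun=> - M) (sv k) (dsurv k) u v uv
  (fun z _ => dM (- M) z) (fun z _ => dsurvP k z) (fun z zuv => proj1 (andP (Hz z zuv))).
by rewrite ler_norml; apply/andP; split; lra.
Qed.

(** Inside [[b, a]] this is Taylor's formula. A jump out of it has [|D| >= dl], and suitable powers
    of [|D| / dl] then absorb the bound 1 and the linear and quadratic terms into the cubic
    error. *)
Lemma surv_taylor k : exists K M2 : R, [/\ 0 <= K, 0 <= M2,
  forall x, b <= x <= a -> `|d2surv k x| <= M2 &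
  forall x D, b' <= x <= a' -> sv k.+1 (clamp b a (x + D)) <=
    sv k.+1 x + D * dsurv k.+1 x + D ^+ 2 / 2 * d2surv k x + K * `|D| ^+ 3].
Proof.
have [M1 M10 HM1] := bounded_on (@cds k.+1).
have [M2 M20 HM2] := bounded_on (@cd2 k).
have [M3 M30 HM3] := bounded_on (@cd3 k).
pose dl := Num.min (b' - b) (a - a').
have dl0 : 0 < dl by rewrite lt_min !subr_gt0 bb' aa'.
have e1 : 0 <= dl^-1 ^+ 3 by rewrite exprn_ge0// invr_ge0 ltW.
have e2 : 0 <= M1 * dl^-1 ^+ 2 by rewrite mulr_ge0// exprn_ge0// invr_ge0 ltW.
have e3 : 0 <= M2 * dl^-1 by rewrite mulr_ge0// invr_ge0 ltW.
exists (M3 + (dl^-1 ^+ 3 + M1 * dl^-1 ^+ 2 + M2 * dl^-1)), M2; split => //.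
  by rewrite !addr_ge0.
move=> x D /andP[bx xa].
have xab : b <= x <= a by rewrite (le_trans (ltW bb') bx) (le_trans xa (ltW aa')).
have svx : 0 <= sv k.+1 x.
  by have /andP[] := surv_le1 cf f_gt0 AL A1b A_gt0 A1_ge0 q_gt0 cq k.+1 xab.
have D3 : 0 <= `|D| ^+ 3 by rewrite exprn_ge0.
have [xDab|xDab] := boolP (b <= x + D <= a).
  rewrite clamp_id//.
  have := @taylor3 _ _ _ _ _ M3 b a x (x + D) M30 (fun z _ => dsurvP k.+1 z)
    (fun z _ => d2survP k z) (fun z zab => d3survP k zab) HM3 xab xDab.
  rewrite [x + D - x]addrAC subrr add0r => H; apply: (le_trans H).
  rewrite lerD2l mulrDl lerDl mulr_ge0// !addr_ge0//.
have dlD : dl <= `|D|.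
  rewrite ge_min; move: xDab; rewrite negb_and -!ltNge => /orP[h|h]; apply/orP.
    by left; have := ler_norm (- D); rewrite normrN; lra.
  by right; have := ler_norm D; lra.
have /andP[_ W1] := surv_le1 cf f_gt0 AL A1b A_gt0 A1_ge0 q_gt0 cq k.+1 (clamp_itv (x + D) ba).
apply: (le_trans W1).
have D1 : 1 <= `|D| * dl^-1 by rewrite ler_pdivlMr// mul1r.
have p1 : 1 <= dl^-1 ^+ 3 * `|D| ^+ 3.
  by rewrite -exprMn exprn_ege1// mulrC.
have p2 : M1 * `|D| <= M1 * dl^-1 ^+ 2 * `|D| ^+ 3.
  have -> : M1 * dl^-1 ^+ 2 * `|D| ^+ 3 = M1 * `|D| * (`|D| * dl^-1) ^+ 2 by ring.
  by rewrite ler_peMr ?mulr_ge0// exprn_ege1.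
have p3 : M2 * `|D| ^+ 2 <= M2 * dl^-1 * `|D| ^+ 3.
  have -> : M2 * dl^-1 * `|D| ^+ 3 = M2 * `|D| ^+ 2 * (`|D| * dl^-1) by ring.
  by rewrite ler_peMr ?mulr_ge0// exprn_ge0.
have p4 : - (M1 * `|D|) <= D * dsurv k.+1 x.
  have : `|D * dsurv k.+1 x| <= M1 * `|D| by rewrite normrM mulrC ler_wpM2r// HM1.
  by rewrite ler_norml => /andP[].
have p5 : - (M2 * `|D| ^+ 2) <= D ^+ 2 / 2 * d2surv k x.
  have : `|D ^+ 2 / 2 * d2surv k x| <= M2 * `|D| ^+ 2.
    rewrite normrM mulrC normrM normrX (@ger0_norm _ (2^-1))//.
    have h := HM2 x xab; have h2 : 0 <= `|D| ^+ 2 by rewrite exprn_ge0.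
    have : `|d2surv k x| * (`|D| ^+ 2 / 2) <= M2 * (`|D| ^+ 2 / 2) by rewrite ler_wpM2r// divr_ge0.
    have : 0 <= M2 * `|D| ^+ 2 by rewrite mulr_ge0.
    lra.
  by rewrite ler_norml => /andP[].
have p6 : 0 <= M3 * `|D| ^+ 3 by rewrite mulr_ge0.
by rewrite !mulrDl; lra.
Qed.

(** The terms of order [h] add up to [h] times the generator applied to [sv k.+1], that is
    [h * q * (sv k.+1 - sv k)]; what remains is of order [h ^ (3/2)]. *)
Lemma one_step k : exists2 C : R, 0 <= C & forall h x, 0 < h <= 1 -> b' <= x <= a' ->
  (\int[normal_prob (0 : R) (Num.sqrt h)]_z
      (sv k.+1 (clamp b a (x + (Num.sqrt 2 * z + h / f x))))%:E
   <= (sv k.+1 x + h * (q x * (sv k.+1 x - sv k x)) + C * (h * Num.sqrt h))%:E)%E.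
Proof.
have [K [M2 [K0 M20 HM2 HT]]] := surv_taylor k.
have [mu mu0 Hmu] := bounded_on cVf.
(* 96 is the constant of the Gaussian fourth moment and [16 = 8 * 4 / 2] the coefficient of
   [K * z ^ 4 / s] in the bound of the cubic term. *)
pose c1 : R := 96 * 16.
have c10 : 0 <= c1 by rewrite /c1 -natrM ler0n.
exists (K + (M2 + K) / 2 * mu ^+ 2 + 4 * K * mu ^+ 4 + c1 * K).
  by rewrite !addr_ge0// !mulr_ge0// ?exprn_ge0// addr_ge0.
move=> h x /andP[h0 h1] xba'.
have xab : b <= x <= a by case/andP: xba' => ? ?; rewrite (le_trans (ltW bb'))//= (le_trans _ (ltW aa')).
set s := Num.sqrt h; have s0 : 0 < s by rewrite sqrtr_gt0.
have s1 : s <= 1 by rewrite -sqrtr1 ler_wsqrtr.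
have hE : h = s ^+ 2 by rewrite sqr_sqrtr// ltW.
set W := sv k.+1 x; set W1 := dsurv k.+1 x; set W2 := d2surv k x; set m := (f x)^-1.
have m0 : 0 <= m by rewrite invr_ge0 ltW.
have mmu : m <= mu by apply: le_trans (ler_norm _) (Hmu x xab).
pose al := W + h * m * W1 + (W2 + K * s) / 2 * (h ^+ 2 * m ^+ 2) + 4 * K * (h ^+ 4 * m ^+ 4) / s.
pose be := Num.sqrt 2 * W1 + (W2 + K * s) * (Num.sqrt 2 * (h * m)).
have sq2 : Num.sqrt 2 ^+ 2 = 2 :> R by rewrite sqr_sqrtr.
apply: (@le_trans _ _ (al + (W2 + K * s) * s ^+ 2 + 96 * (16 * K / s) * s ^+ 4)%:E).
  apply: (@normal_integral_le _ _ s0 _ al be).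
  - by rewrite divr_ge0 ?mulr_ge0// ltW.
  - apply: continuous_measurable_fun => z.
    apply: (@continuous_comp _ _ _ (fun z => x + (Num.sqrt 2 * z + h / f x)) (sv k.+1 \o clamp b a)).
      apply: continuousDT; first exact: continuousCT.
      apply: continuousDT; last exact: continuousCT.
      by apply: continuousMT; [exact: continuousCT|move=> u; exact: cvg_id].
    by apply: continuous_comp; [exact: continuous_clamp|exact: csv].
  - move=> z; have zc := clamp_itv (x + (Num.sqrt 2 * z + h / f x)) ba.
    by have /andP[] := surv_le1 cf f_gt0 AL A1b A_gt0 A1_ge0 q_gt0 cq k.+1 zc.
  move=> z; set D := Num.sqrt 2 * z + h / f x.
  apply: (le_trans (HT x D xba')); rewrite -/W -/W1 -/W2.
  (* The arithmetic-geometric inequality with weight [s = sqrt h] trades the cubic for even powers,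
     whose Gaussian integrals are available, and keeps the order [s ^ 3]. *)
  have D3 : `|D| ^+ 3 <= (s * D ^+ 2 + D ^+ 4 / s) / 2.
    have := sqr_ge0 (s * `|D| - `|D| ^+ 2).
    have -> : (s * `|D| - `|D| ^+ 2) ^+ 2 = s * (s * `|D| ^+ 2 + `|D| ^+ 4 / s - 2 * `|D| ^+ 3).
      by field; rewrite gt_eqF.
    rewrite pmulr_rge0// (_ : `|D| ^+ 2 = D ^+ 2); last by rewrite -normrX ger0_norm ?sqr_ge0.
    rewrite (_ : `|D| ^+ 4 = D ^+ 4); first lra.
    by rewrite -normrX ger0_norm ?exprn_even_ge0.
  have D4 : D ^+ 4 <= 8 * (4 * z ^+ 4 + h ^+ 4 * m ^+ 4).
    have -> : 4 * z ^+ 4 = (Num.sqrt 2 * z) ^+ 4.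
      have -> : (Num.sqrt 2 * z) ^+ 4 = (Num.sqrt 2 ^+ 2) ^+ 2 * z ^+ 4 by ring.
      by rewrite sq2; ring.
    have -> : h ^+ 4 * m ^+ 4 = (h / f x) ^+ 4 by rewrite -exprMn.
    rewrite /D; move: (Num.sqrt 2 * z) (h / f x) => u v.
    have h2 : (u + v) ^+ 2 <= 2 * (u ^+ 2 + v ^+ 2) by have := sqr_ge0 (u - v); lra.
    have h3 : (u ^+ 2 + v ^+ 2) ^+ 2 <= 2 * (u ^+ 4 + v ^+ 4).
      by have := sqr_ge0 (u ^+ 2 - v ^+ 2); lra.
    have -> : (u + v) ^+ 4 = ((u + v) ^+ 2) ^+ 2 by ring.
    apply: (@le_trans _ _ ((2 * (u ^+ 2 + v ^+ 2)) ^+ 2)).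
      by rewrite lerXn2r ?nnegrE ?sqr_ge0// mulr_ge0// addr_ge0 ?sqr_ge0.
    by rewrite exprMn; lra.
  have K3 : K * `|D| ^+ 3 <= K * ((s * D ^+ 2 + D ^+ 4 / s) / 2) by rewrite ler_wpM2l.
  have K4 : K * (D ^+ 4 / s) <= K * (8 * (4 * z ^+ 4 + h ^+ 4 * m ^+ 4) / s).
    by rewrite ler_wpM2l// ler_wpM2r// invr_ge0 ltW.
  have D2 : D ^+ 2 = 2 * z ^+ 2 + 2 * (Num.sqrt 2 * (h * m)) * z + h ^+ 2 * m ^+ 2.
    have -> : D ^+ 2 = Num.sqrt 2 ^+ 2 * z ^+ 2 + 2 * (Num.sqrt 2 * (h * m)) * z + h ^+ 2 * m ^+ 2.
      by rewrite /D -/m; ring.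
    by rewrite sq2.
  have E : al + be * z + (W2 + K * s) * z ^+ 2 + 16 * K / s * z ^+ 4 =
    W + D * W1 + D ^+ 2 / 2 * W2 + K * (s * D ^+ 2) / 2 + K * (8 * (4 * z ^+ 4 + h ^+ 4 * m ^+ 4) / s) / 2.
    rewrite D2 /al /be /D -/m; field; by rewrite gt_eqF.
  by rewrite E; lra.
rewrite lee_fin /al.
have -> : q x * (W - sv k x) = W2 + W1 * m by rewrite /W2 /d2surv -/W -/W1 -/m; ring.
have hs : h * s = s ^+ 3 by rewrite hE; ring.
rewrite hs.
have s3 : 0 <= s ^+ 3 by rewrite exprn_ge0// ltW.
have m2 : m ^+ 2 <= mu ^+ 2 by rewrite lerXn2r ?nnegrE.
have m4 : m ^+ 4 <= mu ^+ 4 by rewrite lerXn2r ?nnegrE.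
have t1 : (W2 + K * s) / 2 * (h ^+ 2 * m ^+ 2) <= (M2 + K) / 2 * mu ^+ 2 * s ^+ 3.
  have -> : (W2 + K * s) / 2 * (h ^+ 2 * m ^+ 2) = (W2 + K * s) * s * m ^+ 2 / 2 * s ^+ 3.
    by rewrite hE; field.
  apply: ler_wpM2r => //.
  have w0 : W2 + K * s <= M2 + K.
    apply: lerD; first exact: le_trans (ler_norm _) (HM2 x xab).
    by rewrite ler_piMr.
  have mk : 0 <= M2 + K by rewrite addr_ge0.
  rewrite [leRHS](_ : _ = (M2 + K) * mu ^+ 2 / 2); last by ring.
  rewrite ler_wpM2r// -mulrA.
  apply: (@le_trans _ _ ((M2 + K) * (s * m ^+ 2))).
    by rewrite ler_wpM2r// mulr_ge0 ?sqr_ge0// ltW.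
  rewrite ler_wpM2l//; apply: le_trans m2.
  by rewrite ler_piMl ?sqr_ge0.
have t2 : 4 * K * (h ^+ 4 * m ^+ 4) / s <= 4 * K * mu ^+ 4 * s ^+ 3.
  have -> : 4 * K * (h ^+ 4 * m ^+ 4) / s = 4 * K * (s ^+ 4 * m ^+ 4) * s ^+ 3.
    by rewrite hE; field; rewrite gt_eqF.
  apply: ler_wpM2r => //; apply: ler_wpM2l; first by rewrite mulr_ge0.
  apply: le_trans m4; rewrite ler_piMl ?exprn_ge0//.
  by rewrite exprn_ile1// ltW.
have t3 : 96 * (16 * K / s) * s ^+ 4 = c1 * K * s ^+ 3 by rewrite /c1; field; rewrite gt_eqF.
have t4 : (W2 + K * s) * s ^+ 2 = h * W2 + K * s ^+ 3 by rewrite hE; ring.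
by rewrite t3 t4; lra.
Qed.

End one_step.

(** * Negative binomial mixtures of survival functions *)

Section negative_binomial.
Context {R : realType} (s : R).
Hypothesis s_ge0 : 0 <= s.

(* The coefficients of the power series [(1 + s * (1 - z)) ^- i] in [z]. *)
Fixpoint nbinom (i : nat) : nat -> R :=
  if i is i'.+1 then
    fix g j := (nbinom i' j + s * (if j is j'.+1 then g j' else 0)) / (1 + s)
  else fun j => (j == 0)%:R.

Arguments nbinom : simpl never.

Lemma nbinom0 j : nbinom 0 j = (j == 0)%:R. Proof. by []. Qed.

Lemma nbinomS0 i : nbinom i.+1 0 = nbinom i 0 / (1 + s).
Proof. by rewrite /nbinom/= mulr0 addr0. Qed.

Lemma nbinomSS i j : nbinom i.+1 j.+1 = (nbinom i j.+1 + s * nbinom i.+1 j) / (1 + s).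
Proof. by []. Qed.

Let s1_gt0 : 0 < 1 + s. Proof. by rewrite ltr_pwDl. Qed.
Let s1_neq0 : 1 + s != 0. Proof. by rewrite gt_eqF. Qed.

Lemma nbinom_ge0 i j : 0 <= nbinom i j.
Proof.
elim: i j => [|i IH] j; first by rewrite nbinom0 ler0n.
elim: j => [|j IHj]; first by rewrite nbinomS0 divr_ge0// ltW.
by rewrite nbinomSS divr_ge0 ?(ltW s1_gt0)// addr_ge0// mulr_ge0.
Qed.

(** Multiplying the generating function by [1 + s * (1 - z)] lowers [i] by one. On coefficients this
    is a summation by parts, whose boundary term vanishes with [g 0]. *)
Lemma sum_nbinom_parts (g : nat -> R) i n : g 0%N = 0 ->
  \sum_(j < n) nbinom i.+1 j * ((1 + s) * g (n - j)%N - s * g (n - j).-1) =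
  \sum_(j < n) nbinom i j * g (n - j)%N.
Proof.
move=> g0; case: n => [|n]; first by rewrite !big_ord0.
under eq_bigr do rewrite mulrBr.
rewrite sumrB big_ord_recl [X in _ - X]big_ord_recr/= subSnn g0 !mulr0 addr0.
rewrite [RHS]big_ord_recl -addrA; congr (_ + _); first by rewrite nbinomS0; field.
rewrite -sumrB; apply: eq_bigr => j _.
rewrite lift0 -/(nbinom i.+1 j.+1) nbinomSS subSS.
have -> : (n.+1 - j).-1 = (n - j)%N by rewrite subSKn.
by field.
Qed.

Lemma sum_nbinom_exp (z : R) i n : 0 <= z <= 1 ->
  \sum_(j < n) nbinom i j * z ^+ j <= (1 + s * (1 - z))^-1 ^+ i.
Proof.
move=> /andP[z0 z1].
have d0 : 0 < 1 + s * (1 - z) by rewrite ltr_pwDl// mulr_ge0// subr_ge0.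
elim: i => [|i IH].
  rewrite expr0; case: n => [|n]; first by rewrite big_ord0.
  by rewrite big_ord_recl nbinom0 mul1r big1 ?addr0// => j _; rewrite nbinom0 mul0r.
set S := \sum_(j < n) _.
suff E : (1 + s) * S <= (1 + s * (1 - z))^-1 ^+ i + s * z * S.
  rewrite exprSr ler_pdivlMr//; lra.
apply: (le_trans _ (lerD IH (lexx _))).
rewrite /S mulr_sumr; case: n {S IH} => [|n]; first by rewrite !big_ord0 mulr0 addr0.
rewrite big_ord_recl nbinomS0 [X in _ <= X + _]big_ord_recl -addrA.
apply: lerD; first by rewrite le_eqVlt; apply/orP; left; apply/eqP; field.
rewrite [X in _ <= _ + X](_ : _ = \sum_(j < n.+1) s * nbinom i.+1 j * z ^+ j.+1); last first.
  by rewrite mulr_sumr; apply: eq_bigr => j _; rewrite exprS; ring.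
apply: (@le_trans _ _ (\sum_(j < n) nbinom i (lift ord0 j) * z ^+ lift ord0 j
    + \sum_(j < n) s * nbinom i.+1 j * z ^+ j.+1)).
  rewrite -big_split; apply: ler_sum => j _; rewrite lift0 -/(nbinom i.+1 j.+1) nbinomSS.
  by rewrite le_eqVlt; apply/orP; left; apply/eqP; rewrite /=; field.
rewrite lerD2l big_ord_recr/= lerDl !mulr_ge0// ?exprn_ge0//.
exact: (nbinom_ge0 i.+1 n).
Qed.

Lemma sum_nbinom_le1 i n : \sum_(j < n) nbinom i j <= 1.
Proof.
have := @sum_nbinom_exp 1 i n; rewrite ler01 lexx subrr mulr0 addr0 invr1 expr1n.
by under eq_bigr do rewrite expr1n mulr1; exact.
Qed.

(** Chernoff's bound: [z ^ j >= z ^ n] for the indices [j] below [n]. *)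
Lemma sum_nbinom_le (z : R) i n : 0 < z <= 1 ->
  \sum_(j < n) nbinom i j <= z^-1 ^+ n * (1 + s * (1 - z))^-1 ^+ i.
Proof.
move=> /andP[z0 z1]; have zn0 : 0 < z ^+ n by rewrite exprn_gt0.
rewrite exprVn mulrC ler_pdivlMr//.
apply: le_trans (sum_nbinom_exp i n (_ : 0 <= z <= 1)); last by rewrite ltW.
rewrite mulr_suml ler_sum// => j _; rewrite ler_wpM2l ?nbinom_ge0//.
by apply: ler_wiXn2l => //; [exact: ltW|exact: ltnW].
Qed.

Context (G : nat -> R -> R) (n : nat).
Hypothesis G_itv : forall k x, 0 <= G k x <= 1.
Hypothesis G0 : forall x, G 0%N x = 1.

(** The mean of [G (n - J)] for a negative binomial [J], the number of rings during [i] steps, with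
    value 1 once [J >= n]. As the full weights sum to 1, the complement form involves only indices
    below [n]. *)
Definition barrier (i : nat) (x : R) : R :=
  1 - \sum_(j < n) nbinom i j * (1 - G (n - j)%N x).

Lemma barrier0 x : barrier 0 x = G n x.
Proof.
rewrite /barrier; case: n => [|n']; first by rewrite big_ord0 subr0 G0.
by rewrite big_ord_recl big1 => [|j _]; rewrite nbinom0 ?mul0r//= mul1r subn0; ring.
Qed.

Lemma barrier_ge i x : 1 - \sum_(j < n) nbinom i j <= barrier i x.
Proof.
rewrite /barrier lerB// ler_sum// => j _.
by rewrite ler_piMr ?nbinom_ge0// gerBl; case/andP: (G_itv (n - j) x).
Qed.

Lemma barrier_ge0 i x : 0 <= barrier i x.
Proof. by apply: le_trans (barrier_ge i x); rewrite subr_ge0 sum_nbinom_le1. Qed.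

Lemma barrier_lip i (L : R) : 0 <= L ->
  (forall k x y, (k <= n)%N -> `|G k x - G k y| <= L * `|x - y|) ->
  forall x y, `|barrier i x - barrier i y| <= L * `|x - y|.
Proof.
move=> L0 HL x y; rewrite /barrier.
rewrite (_ : 1 - _ - _ = \sum_(j < n) nbinom i j * (G (n - j)%N x - G (n - j)%N y)); last first.
  rewrite [RHS](_ : _ = \sum_(j < n) (nbinom i j * (1 - G (n - j)%N y) -
    nbinom i j * (1 - G (n - j)%N x))); last by apply: eq_bigr => j _; ring.
  by rewrite sumrB; ring.
apply: (le_trans (ler_norm_sum _ _ _)).
apply: (@le_trans _ _ (\sum_(j < n) nbinom i j * (L * `|x - y|))).
  rewrite ler_sum// => j _; rewrite normrM ger0_norm ?nbinom_ge0//.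
  by rewrite ler_wpM2l ?nbinom_ge0// HL// leq_subr.
by rewrite -mulr_suml ler_piMl ?sum_nbinom_le1// mulr_ge0.
Qed.

Lemma measurable_barrier i (cG : forall k, measurable_fun setT (G k)) :
  measurable_fun setT (barrier i).
Proof.
apply: measurable_funB => //; apply: measurable_sum => j.
by apply: measurable_funM => //; exact: measurable_funB.
Qed.

(** The weights obey an implicit recursion, [(1 + s)] times the new one minus [s] times its
    predecessor, dual to the right side of the hypothesis; [sum_nbinom_parts] therefore recombines
    the bounds for all [k] into [barrier i]. *)
Lemma barrier_step i (dS : measure_display) (S : measurableType dS)
    (P : probability S R) (y : S -> R) (x e : R) :
  0 <= e -> (forall k, measurable_fun setT (G k)) -> measurable_fun setT y ->
  (forall k, (k < n)%N -> (\int[P]_z (G k.+1 (y z))%:E <=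
    ((1 + s) * G k.+1 x - s * G k x + e)%:E)%E) ->
  (\int[P]_z (barrier i.+1 (y z))%:E <= (barrier i x + e)%:E)%E.
Proof.
move=> e0 mG my Hstep.
set c := 1 - \sum_(j < n) nbinom i.+1 j.
have c0 : 0 <= c by rewrite subr_ge0 sum_nbinom_le1.
have bE z : (barrier i.+1 (y z))%:E =
    (c%:E + \sum_(j < n) (nbinom i.+1 j)%:E * (G (n - j)%N (y z))%:E)%E.
  rewrite sumEFin -EFinD; congr EFin; rewrite /barrier /c -addrA; congr (_ + _).
  by rewrite -sumrN -sumrN -big_split/=; apply: eq_bigr => j _; ring.
have mGy k : measurable_fun setT (fun z => (G k (y z))%:E).
  by apply/measurable_EFinP; apply: measurableT_comp.
have Gy0 k z : (0 <= (G k (y z))%:E)%E by rewrite lee_fin; case/andP: (G_itv k (y z)).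
under eq_integral do rewrite bE.
rewrite ge0_integralD//; first last.
- by apply: emeasurable_sum => j _; exact: measurable_funeM.
- by move=> z _; apply: sume_ge0 => j _; rewrite mule_ge0// lee_fin nbinom_ge0.
rewrite ge0_integral_sum//; first last.
- by move=> j z _; rewrite mule_ge0// lee_fin nbinom_ge0.
- by move=> j; exact: measurable_funeM.
rewrite [X in (X + _)%E](_ : _ = c%:E); last first.
  by rewrite integral_cst//= [X in (_ * X)%E]probability_setT mule1.
apply: (@le_trans _ _ (c%:E + \sum_(j < n) (nbinom i.+1 j *
    ((1 + s) * G (n - j)%N x - s * G (n - j).-1 x + e))%:E)%E).
  rewrite leeD2l//; apply: lee_sum => j _.
  rewrite ge0_integralZl//; last by rewrite lee_fin nbinom_ge0.
  rewrite EFinM lee_wpmul2l ?lee_fin ?nbinom_ge0//.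
  have nj : (n - j)%N = (n - j).-1.+1 by rewrite prednK// subn_gt0.
  by rewrite nj; apply: Hstep; rewrite -nj leq_subr.
rewrite sumEFin -EFinD lee_fin /c /barrier.
have := @sum_nbinom_parts (fun k => 1 - G k x) i n; rewrite G0 subrr => /(_ erefl) <-.
rewrite [X in _ - _ + X <= _](eq_bigr (fun j : 'I_n => nbinom i.+1 j - nbinom i.+1 j * ((1 + s) * (1 - G (n - j)%N x) - s * (1 - G (n - j).-1 x))
   + nbinom i.+1 j * e)); last by move=> j _; ring.
rewrite big_split sumrB -mulr_suml /=.
have : (\sum_(j < n) nbinom i.+1 j) * e <= e by rewrite ler_piMl ?sum_nbinom_le1.
rewrite /=; lra.
Qed.

End negative_binomial.

(** * Integration along the process *)

Section freezing.
Context {R : realType} {d : measure_display} {T : measurableType d}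
  (P : probability T R) (A : set T) (mA : measurable A).
Local Open Scope ereal_scope.

Lemma ge0_integral_mrestr (g : T -> \bar R) :
  measurable_fun setT g -> (forall w, 0 <= g w) ->
  \int[mrestr P mA]_w g w = \int[P]_(w in A) g w.
Proof.
move=> mg g0; have mCA : measurable (~` A) by exact: measurableC.
rewrite -(setUv A) ge0_integral_setU//; first last.
- by apply/disj_set2P; rewrite setICr.
- by rewrite setUv.
rewrite [X in _ + X](_ : _ = 0) ?adde0; last first.
  apply: null_set_integral => //.
  - by apply: measurable_funS mg.
  - have : P (~` A `&` A) = 0 by rewrite setICl measure0.
    exact.
apply: eq_measure_integral => B mB BA.
by change (P (B `&` A) = P B); rewrite setIidl.
Qed.

Context {d1 d2 : measure_display} {T1 : measurableType d1} {T2 : measurableType d2}.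
Context (X : T -> T1) (Y : T -> T2) (N : probability T2 R).
Hypothesis mX : measurable_fun setT X.
Hypothesis mY : measurable_fun setT Y.

Definition frozen_law : set T1 -> \bar R := fun U => P (X @^-1` U `&` A).
Let m : {measure set T1 -> \bar R} :=
  measure_function_pushforward__canonical__measure_function_Measure (mrestr P mA) mX.
HB.instance Definition _ := isMeasure.Build _ _ _ frozen_law (measure0 m) (measure_ge0 m)
  (@measure_semi_sigma_additive _ _ _ m).
Let frozen_law_fin : fin_num_fun frozen_law.
Proof.
move=> U mU; rewrite /frozen_law fin_num_measure//; apply: measurableI => //.
by rewrite -[_ @^-1` _]setTI; exact: mX.
Qed.
HB.instance Definition _ := Measure_isFinite.Build _ _ _ frozen_law frozen_law_fin.

(* Conditioning on the past freezes [X], while [Y] is integrated against its law. *)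
Lemma integral_freezing (psi : T1 * T2 -> \bar R) :
  (forall U V, measurable U -> measurable V ->
    P (A `&` X @^-1` U `&` Y @^-1` V) = P (A `&` X @^-1` U) * N V) ->
  measurable_fun setT psi -> (forall p, 0 <= psi p) ->
  \int[P]_(w in A) psi (X w, Y w) = \int[P]_(w in A) \int[N]_z psi (X w, z).
Proof.
move=> ind mpsi psi0.
have mXY : measurable_fun setT (fun w => (X w, Y w)).
  exact: measurable_fun_pair.
rewrite -(ge0_integral_mrestr); [|exact: (measurableT_comp mpsi mXY)|by []].
have mF := @measurable_fun_fubini_tonelli_F _ _ _ _ _ N psi mpsi psi0.
rewrite -(ge0_integral_mrestr); first last.
- by move=> w; exact: integral_ge0.
- exact: (measurableT_comp mF mX).
pose nu2 : {measure set (T1 * T2) -> \bar R} :=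
  measure_function_pushforward__canonical__measure_function_Measure (mrestr P mA) mXY.
(* Independence identifies the joint law with the product on rectangles, hence on all measurable
   sets. *)
have E : forall Z, measurable Z -> (frozen_law \x N) Z = nu2 Z.
  apply: product_measure_unique => U V mU mV.
  transitivity (P (A `&` X @^-1` U `&` Y @^-1` V)).
    congr (P _); apply/seteqP; split => w /=; rewrite /mrestr/=; tauto.
  by rewrite ind// setIC.
transitivity (\int[nu2]_p psi p).
  by rewrite ge0_integral_pushforward.
transitivity (\int[(frozen_law \x N)%E]_p psi p).
  by apply: eq_measure_integral => Z mZ _; exact/esym/E.
rewrite fubini_tonelli1//.
rewrite (eq_measure_integral m)//.
rewrite ge0_integral_pushforward// => x _.
by apply: integral_ge0 => z _; exact: psi0.
Qed.
End freezing.

(** * Continuous paths and their observation on a countable grid *)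

Section path_regularity.
Context {R : realType}.
Implicit Types (u v s t x y e : R) (g : R -> R).

Lemma continuous_dist g x e : {for x, continuous g} -> 0 < e ->
  exists2 dl : R, 0 < dl & forall y, `|x - y| < dl -> `|g x - g y| < e.
Proof.
move=> /cvgrPdist_lt cg e0; have /nbhs_ballP[dl dl0 H] := cg e e0.
by exists dl => // y xy; apply: H.
Qed.

Lemma heine_cantor g u v e : continuous g -> 0 < e ->
  exists2 dl : R, 0 < dl & forall s t, u <= s <= v -> u <= t <= v ->
    `|s - t| < dl -> `|g s - g t| < e.
Proof.
move=> cg e0; have e2 : 0 < e / 2 by rewrite divr_gt0.
have /compact_near_coveringP cuv := @segment_compact R u v.
pose Q (n : nat) s := forall t, `|s - t| < n.+1%:R^-1 -> `|g s - g t| < e.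
have [|n _ Hn] := cuv nat \oo Q _.
  move=> x _; have [dl dl0 Hdl] := continuous_dist (cg x) e2.
  have dl2 : 0 < dl / 2 by rewrite divr_gt0.
  exists (ball x (dl / 2), [set n : nat | n.+1%:R^-1 < dl / 2]).
    split; first exact: nbhsx_ballx.
    exact: (near_infty_natSinv_lt (PosNum dl2)).
  move=> [s n] [/= xs nd] t st; have xt : `|x - t| < dl.
    rewrite (_ : x - t = (x - s) + (s - t)); last by ring.
    rewrite (le_lt_trans (ler_normD _ _))// [ltRHS](splitr dl).
    by apply: ltrD => //; exact: lt_trans st nd.
  have xs' : `|x - s| < dl by apply: lt_trans xs _; rewrite gtr_pMr// invf_lt1// ltr1n.
  rewrite (_ : g s - g t = (g x - g t) - (g x - g s)); last by ring.
  by rewrite (le_lt_trans (ler_normB _ _))// [ltRHS](splitr e) ltrD// Hdl.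
exists n.+1%:R^-1; first by rewrite invr_gt0.
by move=> s t suv _ st; apply: (Hn n (leqnn n) s).
Qed.

Lemma continuous_max0 g : {within `[0, +oo[, continuous g} ->
  continuous (fun t => g (Num.max 0 t)).
Proof.
move=> /subspace_continuousP cg x; apply/cvgrPdist_lt => e e0.
have x0 : `[0, +oo[%classic (Num.max 0 x) by rewrite /= in_itv/= andbT le_max lexx.
have /cvgrPdist_lt/(_ e e0)/nbhs_ballP[dl dl0 H] := cg _ x0.
apply/nbhs_ballP; exists dl => // t xt; apply: H; last first.
  by rewrite /= in_itv/= andbT le_max lexx.
move: xt; rewrite /ball/= => xt; apply: le_lt_trans xt.
rewrite /Num.max; case: ltP => hx; case: ltP => ht //.
- by rewrite subr0 [`|x|]gtr0_norm// ler_normr; apply/orP; left; lra.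
- by rewrite sub0r normrN [`|t|]gtr0_norm// ler_normr; apply/orP; right; lra.
- by rewrite subrr normr0.
Qed.

Lemma dense_grid u v s e : u <= s <= v -> 0 < e -> exists n k,
  `|s - (u + (v - u) * ((minn k n.+1)%:R / n.+1%:R))| < e.
Proof.
move=> /andP[us sv] e0; have uv : 0 <= v - u by lra.
have [n _ /(_ n (leqnn n)) Hn] := near_infty_natSinv_lt (PosNum (divr_gt0 e0 (ltr_pwDl ltr01 uv))).
rewrite /= ltr_pdivlMr ?ltr_pwDl// in Hn.
move: uv; rewrite le_eqVlt => /predU1P[uv|uv].
  by exists n, 0%N; rewrite -uv mul0r addr0 (_ : s - u = 0) ?normr0//; lra.
pose r := (s - u) / (v - u) * n.+1%:R; exists n, (Num.trunc r).
have r0 : 0 <= r by rewrite mulr_ge0// divr_ge0//; lra.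
have rn : r <= n.+1%:R.
  by rewrite /r ler_piMl// ler_pdivrMr// mul1r lerD2r.
have /andP[h1 h2] := truncn_itv r0.
have kn : (Num.trunc r <= n.+1)%N by rewrite -(ler_nat R) (le_trans h1).
rewrite (minn_idPl kn).
have -> : s - (u + (v - u) * ((Num.trunc r)%:R / n.+1%:R)) =
    (v - u) * (r - (Num.trunc r)%:R) * n.+1%:R^-1.
  have N0 : 0 < n.+1%:R :> R by rewrite ltr0n.
  set k := (Num.trunc r)%:R; rewrite /r; move: (n.+1%:R) N0 => N N0.
  by field; rewrite !gt_eqF.
have h3 : 0 <= r - (Num.trunc r)%:R <= 1 by rewrite subr_ge0 h1/= lerBlDr; move: h2; rewrite -natr1; lra.
case/andP: h3 => h3 h4.
rewrite ger0_norm; last by rewrite !mulr_ge0// ltW.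
apply: le_lt_trans Hn; rewrite mulrC ler_wpM2l ?invr_ge0//.
apply: (@le_trans _ _ (v - u)); last by rewrite lerDr.
by rewrite ler_piMr// ltW.
Qed.

Lemma grid_itv u v n k : u <= v ->
  u <= u + (v - u) * ((minn k n.+1)%:R / n.+1%:R) <= v.
Proof.
move=> uv; have q0 : 0 <= (minn k n.+1)%:R / n.+1%:R :> R by rewrite divr_ge0.
have q1 : (minn k n.+1)%:R / n.+1%:R <= 1 :> R.
  by rewrite ler_pdivrMr ?ltr0n// mul1r ler_nat geq_minr.
have uv0 : 0 <= v - u by rewrite subr_ge0.
by rewrite lerDl mulr_ge0//= -lerBrDl ler_piMr.
Qed.

End path_regularity.

Section confinement.
Context {R : realType} {d : measure_display} {T : measurableType d}.
Context (F : R -> set (set T)) (X : R -> T -> R).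
Hypothesis filF : filtration F.
Hypothesis adX : adapted F X.
Hypothesis cX : continuous_paths X.
Implicit Types (u v s t e : R).

Let Xm (w : T) (t : R) := X (Num.max 0 t) w.

Lemma continuous_path w : continuous (Xm w).
Proof. exact: (@continuous_max0 _ (fun t => X t w) (@cX w)). Qed.

Lemma path_grid_le u v c w : 0 <= u -> u <= v ->
  (forall n k, X (u + (v - u) * ((minn k n.+1)%:R / n.+1%:R)) w <= c) ->
  forall s, u <= s <= v -> X s w <= c.
Proof.
move=> u0 uv H s suv; rewrite leNgt; apply/negP => cs.
have s0 : 0 <= s by lra.
have Xms t : 0 <= t -> Xm w t = X t w by move=> t0; rewrite /Xm (max_idPr t0).
have Xc : 0 < X s w - c by rewrite subr_gt0.
have [dl dl0 Hdl] := continuous_dist (@continuous_path w s) Xc.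
have [n [k Hnk]] := dense_grid suv dl0.
have /andP[/(le_trans u0) t0 _] := grid_itv n k uv.
have := Hdl _ Hnk; rewrite !Xms// ltr_norml => /andP[_].
have := H n k; lra.
Qed.

Lemma sigma_algebra_bigcap (G : set (set T)) (A : nat -> set T) :
  sigma_algebra setT G -> (forall n, G (A n)) -> G (\bigcap_n A n).
Proof.
move=> [G0 GC GU] GA; rewrite -[X in G X]setCK setC_bigcap -setTD.
by apply: (GC); apply: GU => n; rewrite -setTD; exact: GC.
Qed.

Lemma sigma_algebra_setI (G : set (set T)) (A B : set T) :
  sigma_algebra setT G -> G A -> G B -> G (A `&` B).
Proof.
move=> sG GA GB; rewrite -bigcap2E; apply: sigma_algebra_bigcap => // -[|[|n]]//=.
by case: sG => G0 GC _; rewrite -(setD0 setT); exact: GC.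
Qed.

(** By continuity the constraint on all of [[u, v]] reduces to countably many grid points, all
    observed by time [v]; [minn] keeps each of them inside the interval. *)
Lemma measurable_path_le u v c : 0 <= u -> u <= v ->
  F v [set w | forall s, u <= s <= v -> X s w <= c].
Proof.
move=> u0 uv; have v0 : 0 <= v by lra.
have [F1 F2 F3] := filF.
rewrite (_ : mkset _ = \bigcap_n \bigcap_k
    (X (u + (v - u) * ((minn k n.+1)%:R / n.+1%:R)) @^-1` `]-oo, c])); last first.
  apply/seteqP; split => w /=.
    by move=> H n _ k _ /=; rewrite in_itv/=; apply: H; exact: grid_itv.
  move=> H; apply: path_grid_le => // n k.
  by have := H n I k I; rewrite /= in_itv.
apply: sigma_algebra_bigcap => [|n]; first exact: F1.
apply: sigma_algebra_bigcap => [|k]; first exact: F1.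
have /andP[r0 r1] := grid_itv n k uv.
apply: (F3 _ _ (le_trans u0 r0) r1); apply: adX => //.
exact: le_trans r0.
Qed.

End confinement.

Section confined_paths.
Context {R : realType} {d : measure_display} {T : measurableType d}.
Context (F : R -> set (set T)) (X : R -> T -> R).
Hypothesis filF : filtration F.
Hypothesis adX : adapted F X.
Hypothesis cX : continuous_paths X.
Implicit Types (u v s t e : R).

Lemma measurable_path_ge u v c : 0 <= u -> u <= v ->
  F v [set w | forall s, u <= s <= v -> c <= X s w].
Proof.
move=> u0 uv.
have adN : adapted F (fun t w => - X t w).
  move=> t t0 U mU; apply: (adX t0 (U := -%R @^-1` U)).
  by rewrite -[_ @^-1` _]setTI; exact: oppr_measurable.
have cN : continuous_paths (fun t w => - X t w).
  by move=> w x; apply: continuousN; exact: cX.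
have := measurable_path_le filF adN cN (- c) u0 uv.
rewrite (_ : mkset _ = [set w | forall s, u <= s <= v -> c <= X s w])//.
by apply/seteqP; split => w /= H s /H; rewrite lerN2.
Qed.

(** The upper bound starts at time 0, so that [a] has not been hit; the lower bound starts at [e],
    because the diffusion leaves from 0. *)
Definition confined e lo hi t : set T :=
  [set w | (forall s, 0 <= s <= t -> X s w <= hi) /\ (forall s, e <= s <= t -> lo <= X s w)].

Lemma measurable_confined e lo hi t : 0 <= e -> e <= t -> F t (confined e lo hi t).
Proof.
move=> e0 et; apply: (@sigma_algebra_setI _ _ (F t)
  [set w | forall s, 0 <= s <= t -> X s w <= hi]
  [set w | forall s, e <= s <= t -> lo <= X s w]).
- by have [F1 _ _] := filF; apply: F1; exact: le_trans et.
- by apply: measurable_path_le => //; exact: le_trans et.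
- exact: measurable_path_ge.
Qed.

Lemma le_confined e lo hi s t : s <= t -> confined e lo hi t `<=` confined e lo hi s.
Proof.
move=> st w [h1 h2]; split=> r /andP[r1 r2]; [apply: h1|apply: h2];
  by rewrite r1 (le_trans r2).
Qed.

Lemma confined_hitting_time e lo hi a t w : hi < a ->
  confined e lo hi t w -> (t%:E <= hitting_time X a w)%E.
Proof.
move=> hia [h _]; apply: le_ereal_inf_tmp => _ [s [s0 Xs] <-].
rewrite lee_fin leNgt; apply/negP => st; have := h s; rewrite s0 ltW// Xs => /(_ isT); lra.
Qed.

End confined_paths.

(** * The drift integral over a short time interval *)

Section drift.
Context {R : realType}.
Implicit Types (r s t e : R) (f g x : R -> R).
Local Notation mu := (@lebesgue_measure R).

Lemma measurable_invr : measurable_fun setT (fun x : R => x^-1).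
Proof.
(* Real powers fit nonnegative bases; the factor [x] restores the sign and the value 0 at 0. *)
rewrite (_ : (fun x : R => x^-1) = (fun x : R => x * (x ^+ 2) `^ (-1))).
  apply: measurable_funM; first exact: measurable_id.
  apply: (measurableT_comp (measurable_powR (-1))).
  exact: measurable_funX.
apply/funext => x; rewrite powR_inv1 ?sqr_ge0//.
by have [->|x0] := eqVneq x 0; [rewrite invr0 mul0r|field].
Qed.

(** The coefficient [g] governs the equation on all of [[0, t]], while [f] agrees with it along the
    path on [[s, t]], where the oscillation of [1 / f] bounds the error of freezing the drift at
    time [s]. *)
Lemma drift_increment f g x (c bs bt s t e : R) :
  0 <= s <= t -> continuous (fun r => x (Num.max 0 r)) -> continuous g ->
  (forall r, 0 <= r <= t -> 0 <= g (x r)) ->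
  (forall r, s <= r <= t -> g (x r) = f (x r)) ->
  (forall r, s <= r <= t -> `|(f (x s))^-1 - (f (x r))^-1| <= e) ->
  (x s)%:E = ((c + bs)%:E + \int[mu]_(r in `[0%R, s]) ((g (x r))^-1)%:E)%E ->
  (x t)%:E = ((c + bt)%:E + \int[mu]_(r in `[0%R, t]) ((g (x r))^-1)%:E)%E ->
  `|x t - x s - (bt - bs) - (t - s) / f (x s)| <= (t - s) * e.
Proof.
move=> /andP[s0 st] cx cg g0 gf osc.
pose G r := (g (x (Num.max 0 r)))^-1.
have mG : measurable_fun setT G.
  apply: (measurableT_comp measurable_invr).
  by apply: continuous_measurable_fun => r; apply: continuous_comp; [exact: cx|exact: cg].
have GE r : 0 <= r -> (g (x r))^-1 = G r by move=> r0; rewrite /G (max_idPr r0).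
have G0 r : 0 <= r <= t -> 0 <= G r.
  by move=> rt; have r0 : 0 <= r by [lra]; rewrite -GE// invr_ge0 g0.
have intE u : (\int[mu]_(r in `[0%R, u]) ((g (x r))^-1)%:E = \int[mu]_(r in `[0%R, u]) (G r)%:E)%E.
  apply: eq_integral => r; rewrite inE/= in_itv/= => /andP[r0 _].
  by rewrite GE.
rewrite !intE.
have splitI : (\int[mu]_(r in `[0%R, t]) (G r)%:E =
    \int[mu]_(r in `[0%R, s]) (G r)%:E + \int[mu]_(r in `]s, t]) (G r)%:E)%E.
  have sU : `[0%R, t]%classic = `[0%R, s]%classic `|` `]s, t]%classic.
    by rewrite -itv_bndbnd_setU// bnd_simp.
  rewrite sU ge0_integral_setU//.
  - by apply/measurable_EFinP; exact: measurable_funTS.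
  - by move=> r; rewrite -sU /= in_itv/= => rt; rewrite lee_fin G0.
  - apply/disj_set2P; apply/seteqP; split => // r [] /=.
    by rewrite !in_itv/= => /andP[_ h1] /andP[h2 _]; lra.
have Lst : mu `]s, t] = (t - s)%:E.
  by rewrite lebesgue_measure_itv/= lte_fin; case: ltP => // ts; rewrite (_ : t = s) ?subrr//; lra.
have cstI (k : R) : (\int[mu]_(r in `]s, t]) k%:E = ((t - s) * k)%:E)%E.
  by rewrite integral_cst//= Lst muleC.
have lo_hi r : s <= r <= t -> (f (x s))^-1 - e <= G r <= (f (x s))^-1 + e.
  move=> srt; have r0 : 0 <= r by lra.
  have := osc r srt; rewrite -GE// gf// ler_norml => /andP[h1 h2]; apply/andP; split; lra.
have J1 : (\int[mu]_(r in `]s, t]) (G r)%:E <= ((t - s) * ((f (x s))^-1 + e))%:E)%E.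
  rewrite -cstI; apply: ge0_le_integral => //.
  - by move=> r; rewrite /= in_itv/= => /andP[h1 h2]; rewrite lee_fin G0//; lra.
  - by apply/measurable_EFinP; exact: measurable_funTS.
  - move=> r; rewrite /= in_itv/= => /andP[h1 h2]; rewrite lee_fin.
    have h : s <= r <= t by lra.
    by have /andP[] := lo_hi r h.
have J0 : (0 <= \int[mu]_(r in `]s, t]) (G r)%:E)%E.
  apply: integral_ge0 => r; rewrite /= in_itv/= => /andP[h1 h2].
  by rewrite lee_fin G0//; lra.
have J2 : (((t - s) * ((f (x s))^-1 - e))%:E <= \int[mu]_(r in `]s, t]) (G r)%:E)%E.
  have [h|h] := leP ((f (x s))^-1 - e) 0.
    by apply: le_trans J0; rewrite lee_fin mulr_ge0_le0// subr_ge0.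
  rewrite -cstI; apply: ge0_le_integral => //.
  - by move=> r _; rewrite lee_fin ltW.
  - by apply/measurable_EFinP; exact: measurable_funTS.
  - move=> r; rewrite /= in_itv/= => /andP[h1 h2]; rewrite lee_fin.
    have h' : s <= r <= t by lra.
    by have /andP[] := lo_hi r h'.
rewrite splitI; move: J1 J2 J0.
case: (\int[mu]_(r in `]s, t]) (G r)%:E)%E => // J; rewrite !lee_fin => J1 J2 _.
(* An infinite integral would contradict the equation at [s], whose left side is real; the two
   equations can thus be subtracted. *)
case: (\int[mu]_(r in `[0%R, s]) (G r)%:E)%E => // I [xs] [xt].
by rewrite ler_norml; apply/andP; split; lra.
Qed.

End drift.

Section euler_step.
Context {R : realType} {d : measure_display} {T : measurableType d}.
Context (P : probability T R) (F : R -> set (set T)) (B X : R -> T -> R).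
Hypothesis filF : filtration F.
Hypothesis brB : brownian_motion P F B.
Hypothesis adX : adapted F X.
Implicit Types (s t e : R).

Lemma adapted_measurable (Y : R -> T -> R) t : adapted F Y -> 0 <= t ->
  measurable_fun setT (Y t).
Proof.
move=> adY t0 _ U mU; rewrite setTI.
by have [_ F2 _] := filF; apply: (F2 t t0); exact: adY.
Qed.

Definition euler_gap (f : R -> R) s t (w : T) : R :=
  `|X t w - X s w - (Num.sqrt 2 * B t w - Num.sqrt 2 * B s w) - (t - s) / f (X s w)|.

Lemma measurable_euler_gap f s t : continuous f -> 0 <= s <= t ->
  measurable_fun setT (euler_gap f s t).
Proof.
move=> cf /andP[s0 st]; have t0 := le_trans s0 st.
have [adB _ _ _ _] := brB.
have mX u : 0 <= u -> measurable_fun setT (X u) by exact: adapted_measurable.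
have mB u : 0 <= u -> measurable_fun setT (B u) by exact: adapted_measurable.
apply: (measurableT_comp (@normr_measurable R setT)).
apply: measurable_funB.
  apply: measurable_funB; first by apply: measurable_funB; exact: mX.
  by apply: measurable_funB; apply: measurable_funM => //; exact: mB.
apply: measurable_funM => //; apply: (measurableT_comp measurable_invr).
by apply: measurableT_comp; [exact: continuous_measurable_fun|exact: mX].
Qed.

Context (f V W : R -> R) (lo hi s t L e : R) (Qs Qt : set T).
Hypothesis cf : continuous f.
Hypothesis f_gt0 : forall x, 0 < f x.
Hypothesis s0 : 0 <= s.
Hypothesis st : s < t.
Hypothesis FQs : F s Qs.
Hypothesis FQt : F t Qt.
Hypothesis Qst : Qt `<=` Qs.
Hypothesis Qs_itv : forall w, Qs w -> lo <= X s w <= hi.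
Hypothesis mV : measurable_fun setT V.
Hypothesis mW : measurable_fun setT W.
Hypothesis V0 : forall x, 0 <= V x.
Hypothesis W0 : forall x, 0 <= W x.
Hypothesis L0 : 0 <= L.
Hypothesis e0 : 0 <= e.
Hypothesis W_lip : forall x y, `|W x - W y| <= L * `|x - y|.
Hypothesis VW : forall x, lo <= x <= hi ->
  (\int[normal_prob (0 : R) (Num.sqrt (t - s))]_z
     (W (x + (Num.sqrt 2 * z + (t - s) / f x)))%:E <= (V x + e)%:E)%E.
Local Open Scope ereal_scope.

(** On [Qt] the Lipschitz bound replaces [X t] by its Euler step from [X s]. Then [Qt] is enlarged
    to [Qs], an event of [F s], so that the increment of [B] is integrated with [X s] frozen. *)
Lemma euler_step : \int[P]_(w in Qt) (W (X t w))%:E <=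
  \int[P]_(w in Qs) (V (X s w))%:E + e%:E
    + L%:E * \int[P]_(w in Qt) (euler_gap f s t w)%:E.
Proof.
have t0 : (0 <= t)%R by rewrite (le_trans s0) ?ltW.
have [F1 F2 F3] := filF; have [adB _ _ lawB indB] := brB.
have mQs := F2 _ s0 _ FQs; have mQt := F2 _ t0 _ FQt.
have mX u : (0 <= u)%R -> measurable_fun setT (X u) by exact: adapted_measurable.
have mB u : (0 <= u)%R -> measurable_fun setT (B u) by exact: adapted_measurable.
pose D w := (B t w - B s w)%R.
have mD : measurable_fun setT D by apply: measurable_funB; exact: mB.
have mgap := measurable_euler_gap cf (introT andP (conj s0 (ltW st))).
pose N : probability (measurableTypeR R) R := normal_prob (0 : R)%R (Num.sqrt (t - s)%R).
pose y (p : R * measurableTypeR R) := (p.1 + (Num.sqrt 2 * p.2 + (t - s) / f p.1))%R.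
have my : measurable_fun setT y.
  apply: measurable_funD; first exact: measurable_fst.
  apply: measurable_funD.
    exact: measurable_funM.
  apply: measurable_funM => //; apply: (measurableT_comp measurable_invr).
  by apply: measurableT_comp; [exact: continuous_measurable_fun|exact: measurable_fst].
pose psi p := (W (y p))%:E.
have mpsi : measurable_fun setT psi by apply/measurable_EFinP; exact: measurableT_comp.
have psi0 p : 0 <= psi p by rewrite lee_fin.
have mXD : measurable_fun setT (fun w => (X s w, D w)).
  by apply: measurable_fun_pair => //; exact: mX.
have mpsiXD : measurable_fun setT (fun w => psi (X s w, D w)) by exact: measurableT_comp mpsi mXD.
have gap0 w : 0 <= (euler_gap f s t w)%:E by rewrite lee_fin normr_ge0.
have step1 : \int[P]_(w in Qt) (W (X t w))%:E <=
    \int[P]_(w in Qs) psi (X s w, D w) + L%:E * \int[P]_(w in Qt) (euler_gap f s t w)%:E.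
  apply: (@le_trans _ _ (\int[P]_(w in Qt) (psi (X s w, D w) + L%:E * (euler_gap f s t w)%:E))).
    apply: (ge0_le_integral P mQt).
    - by move=> w _; rewrite lee_fin.
    - by apply/measurable_EFinP; apply: measurable_funTS; apply: measurableT_comp => //; exact: mX.
    - apply: measurable_funTS; apply: emeasurable_funD => //.
      by apply: measurable_funeM; exact/measurable_EFinP.
    - move=> w _; rewrite -EFinM -EFinD lee_fin -lerBlDl.
      apply: le_trans (ler_norm _) _; apply: le_trans (W_lip _ _) _.
      rewrite ler_wpM2l// /euler_gap /y /D/= le_eqVlt; apply/orP; left; apply/eqP.
      congr `|_|%R; ring.
  rewrite (ge0_integralD P)//; first last.
  - by apply: measurable_funTS; apply: measurable_funeM; exact/measurable_EFinP.
  - by move=> w _; rewrite mule_ge0// lee_fin.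
  - exact: measurable_funTS.
  rewrite (ge0_integralZl P)//; first last.
  - by apply: measurable_funTS; exact/measurable_EFinP.
  rewrite leeD2r//; apply: (ge0_subset_integral P) => //.
  exact: measurable_funTS.
apply: (le_trans step1); rewrite leeD2r//.
have st0 : (Num.sqrt (t - s) != 0)%R by rewrite gt_eqF// sqrtr_gt0 subr_gt0.
rewrite (@integral_freezing _ _ _ P Qs mQs _ _ _ _ (X s) (D : T -> measurableTypeR R) N)//; first last.
- move=> U U' mU mU'; rewrite (_ : N U' = P [set w | U' (B t w - B s w)%R]); last first.
    exact/esym/(lawB s t s0 st U' mU').
  apply: (indB s t s0 st) => //.
  apply: sigma_algebra_setI => //; first exact: F1.
  exact: adX.
- exact: mX.
have mI : measurable_fun setT (fun w => \int[N]_z psi (X s w, z)).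
  have := @measurable_fun_fubini_tonelli_F _ _ _ _ _ N psi mpsi psi0.
  by move=> /measurableT_comp; apply; exact: mX.
apply: (@le_trans _ _ (\int[P]_(w in Qs) (V (X s w) + e)%:E)).
  apply: (ge0_le_integral P mQs) => //.
  - by move=> w _; exact: integral_ge0.
  - exact: measurable_funTS.
  - apply/measurable_EFinP; apply: measurable_funTS; apply: measurable_funD => //.
    by apply: measurableT_comp => //; exact: mX.
  - by move=> w Qw; apply: VW; exact: Qs_itv.
rewrite [X in X <= _](_ : _ = \int[P]_(w in Qs) ((V (X s w))%:E + e%:E))//.
rewrite (ge0_integralD P)//; first last.
- by apply/measurable_EFinP; apply: measurable_funTS; apply: measurableT_comp => //; exact: mX.
- by move=> w _; rewrite lee_fin.
rewrite leeD2l// (integral_cst P)// -[leRHS]mule1 lee_wpmul2l ?lee_fin//.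
exact: probability_le1.
Qed.

End euler_step.

(** * The Euler scheme along a time grid *)

Section euler_scheme.
Context {R : realType} {d : measure_display} {T : measurableType d}.
Context (P : probability T R) (F : R -> set (set T)) (B X : R -> T -> R).
Context (g gc f : R -> R) (a lo hi e S c : R).
Implicit Types (r s t : R).
Hypothesis Xd : diffusion_from (fun x => (g x)^-1) a 0 P F B X.
Hypothesis cgc : continuous gc.
Hypothesis gcE : forall x, 0 <= x <= a -> gc x = g x.
Hypothesis g_ge0 : forall x, 0 <= x <= a -> 0 <= g x.
Hypothesis cf : continuous f.
Hypothesis c0 : 0 < c.
Hypothesis f_ge : forall x, c <= f x.
Hypothesis fE : forall x, lo <= x <= hi -> f x = g x.
Hypothesis hia : hi < a.
Hypothesis e0 : 0 <= e.
Hypothesis eS : e < S.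

Let filF : filtration F. Proof. by case: Xd. Qed.
Let brB : brownian_motion P F B. Proof. by case: Xd. Qed.
Let adX : adapted F X. Proof. by case: Xd => _ _ []. Qed.
Let cX : continuous_paths X. Proof. by case: Xd => _ _ []. Qed.
Let f_gt0 x : 0 < f x. Proof. exact: lt_le_trans (f_ge x). Qed.

Local Notation conf := (confined X e lo hi).
Local Notation gap := (euler_gap B X f).

Definition regular_path (w : T) := forall t, 0 <= t -> (t%:E <= hitting_time X a w)%E ->
  0 <= X t w <= a /\ (X t w)%:E = ((X 0 w + Num.sqrt 2 * B t w)%:E
    + \int[lebesgue_measure]_(s in `[0%R, t]) ((g (X s w))^-1)%:E)%E.

Lemma euler_gap_le w s t eta : regular_path w -> conf t w -> e <= s <= t ->
  (forall r, s <= r <= t -> `|(f (X s w))^-1 - (f (X r w))^-1| <= eta) ->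
  gap s t w <= (t - s) * eta.
Proof.
move=> wreg wt /andP[es st] osc; have s0 := le_trans e0 es.
have t0 := le_trans s0 st.
have wr r : 0 <= r <= t -> (r%:E <= hitting_time X a w)%E.
  move=> /andP[r0 rt]; apply: le_trans (confined_hitting_time hia wt).
  by rewrite lee_fin.
have Xr r : 0 <= r <= t -> 0 <= X r w <= a.
  move=> rt; have r0 : 0 <= r by case/andP: rt.
  by have [] := wreg r r0 (wr r rt).
have eqr r : 0 <= r <= t -> (X r w)%:E = ((X 0 w + Num.sqrt 2 * B r w)%:E
    + \int[lebesgue_measure]_(s in `[0%R, r]) ((gc (X s w))^-1)%:E)%E.
  move=> /[dup] rt /andP[r0 rt']; have [_ ->] := wreg r r0 (wr r rt).
  congr (_ + _)%E; apply: eq_integral => u; rewrite inE/= in_itv/= => /andP[u0 ur].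
  by rewrite gcE// Xr// u0 (le_trans ur).
apply: (@drift_increment _ f gc (fun r => X r w) (X 0 w) _ _ s t eta) => //.
- by rewrite s0.
- exact: (@continuous_max0 _ (fun r => X r w) (@cX w)).
- by move=> r rt; rewrite gcE ?g_ge0// Xr.
- move=> r /andP[sr rt]; have r0 := le_trans s0 sr.
  rewrite gcE; last by rewrite Xr// r0.
  rewrite fE//; have [h1 h2] := wt; rewrite h2 ?h1//; first by rewrite r0.
  by rewrite (le_trans es).
- by rewrite eqr// s0.
- by rewrite eqr// t0 lexx.
Qed.

Definition mesh n : R := (S - e) / n.+1%:R.
Definition gridpt n i : R := e + i%:R * mesh n.
(** A step contributes only if the path is confined up to its end; elsewhere [f] need not be the
    coefficient felt by the path. *)
Definition gap_sum n (w : T) : R :=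
  \sum_(i < n.+1) \1_(conf (gridpt n i.+1)) w * gap (gridpt n i) (gridpt n i.+1) w.

Let mesh_gt0 n : 0 < mesh n. Proof. by rewrite divr_gt0// subr_gt0. Qed.

Lemma gridpt0 n : gridpt n 0 = e. Proof. by rewrite /gridpt mul0r addr0. Qed.

Lemma gridpt_end n : gridpt n n.+1 = S.
Proof.
have n0 : n.+1%:R != 0 :> R by rewrite pnatr_eq0.
by rewrite /gridpt /mesh mulrCA divff// mulr1 addrC subrK.
Qed.

Lemma gridptS n i : gridpt n i.+1 - gridpt n i = mesh n.
Proof. by rewrite /gridpt -natr1; ring. Qed.

Lemma gridpt_lt n i : gridpt n i < gridpt n i.+1.
Proof. by rewrite -subr_gt0 gridptS. Qed.

Lemma gridpt_ge n i : e <= gridpt n i.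
Proof. by rewrite lerDl mulr_ge0// ltW. Qed.

Lemma gridpt_le n i : (i <= n.+1)%N -> gridpt n i <= S.
Proof. by move=> ni; rewrite -(gridpt_end n) lerD2l ler_wpM2r ?ler_nat// ltW. Qed.

Let measurable_conf n i : measurable (conf (gridpt n i)).
Proof.
have [_ F2 _] := filF; apply: (F2 (gridpt n i)).
  exact: le_trans e0 (gridpt_ge n i).
by apply: measurable_confined => //; exact: gridpt_ge.
Qed.

Let measurable_gap n i : measurable_fun setT (gap (gridpt n i) (gridpt n i.+1)).
Proof.
apply: (measurable_euler_gap filF brB adX cf).
by rewrite (le_trans e0 (gridpt_ge n i)) ltW// gridpt_lt.
Qed.

Lemma measurable_gap_sum n : measurable_fun setT (gap_sum n).
Proof. by apply: measurable_sum => i; apply: measurable_funM. Qed.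

Lemma gap_sum_ge0 n w : 0 <= gap_sum n w.
Proof.
by apply: sumr_ge0 => i _; apply: mulr_ge0; [rewrite indicE ler0n|exact: normr_ge0].
Qed.

Lemma gap_sum_le n w eta : regular_path w -> 0 <= eta ->
  (forall r s, e <= r <= S -> e <= s <= S -> `|r - s| <= mesh n ->
    `|(f (X r w))^-1 - (f (X s w))^-1| <= eta) ->
  gap_sum n w <= (S - e) * eta.
Proof.
move=> wreg eta0 osc.
apply: (@le_trans _ _ (\sum_(i < n.+1) mesh n * eta)).
  apply: ler_sum => i _; rewrite indicE.
  case: (boolP (w \in _)) => [|_]; last by rewrite mul0r mulr_ge0// ltW.
  rewrite inE mul1r => wt; rewrite -(gridptS n i).
  have tS : gridpt n i.+1 <= S by rewrite gridpt_le.
  have st := ltW (gridpt_lt n i); have es := gridpt_ge n i.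
  apply: euler_gap_le => //; first by rewrite es.
  move=> r /andP[sr rt]; apply: osc.
  - by rewrite es (le_trans st).
  - by rewrite (le_trans es sr) (le_trans rt).
  - by rewrite distrC ger0_norm ?subr_ge0// -(gridptS n i) lerD2r.
rewrite sumr_const card_ord -mulr_natr /mesh.
have N0 : 0 < n.+1%:R :> R by rewrite ltr0n.
rewrite le_eqVlt; apply/orP; left; apply/eqP; move: (n.+1%:R) N0 => N N0.
by field; rewrite gt_eqF.
Qed.

(** Along a path, [1 / f] is uniformly continuous on [[e, S]], so each gap is [o (mesh n)],
    uniformly, and the number of steps times [mesh n] is [S - e]. *)
Lemma gap_sum_cvg w : regular_path w -> gap_sum ^~ w @ \oo --> (0 : R).
Proof.
move=> wreg; apply/cvgrPdist_le => eps eps0.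
have eta0 : 0 < eps / (S - e) by rewrite divr_gt0// subr_gt0.
have cVf : continuous (fun t => (f (X (Num.max 0 t) w))^-1).
  move=> t; apply: continuousVT => [x|x]; first by rewrite gt_eqF.
  apply: (@continuous_comp _ _ _ (fun t => X (Num.max 0 t) w) f); last exact: cf.
  exact: (@continuous_max0 _ (fun t => X t w) (@cX w)).
have [dl dl0 Hdl] := heine_cantor e S cVf eta0.
have eS0 : 0 < S - e by rewrite subr_gt0.
have [n0 _ Hn] := near_infty_natSinv_lt (PosNum (divr_gt0 dl0 eS0)).
near=> n; rewrite sub0r normrN ger0_norm ?gap_sum_ge0//.
have -> : eps = (S - e) * (eps / (S - e)) by field; rewrite gt_eqF// subr_gt0.
apply: gap_sum_le => //; first exact: ltW.
move=> r s /[dup] er /andP[er1 _] /[dup] es /andP[es1 _] rs.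
have := Hdl r s er es; rewrite !(max_idPr _) ?(le_trans e0)// => H.
apply/ltW/H; apply: le_lt_trans rs _; rewrite /mesh mulrC -ltr_pdivlMr ?subr_gt0//.
apply: (Hn n); near: n; exact: nbhs_infty_ge.
Unshelve. all: by end_near. Qed.

Lemma gap_sum_bounded n w : regular_path w -> gap_sum n w <= (S - e) * c^-1.
Proof.
move=> wreg; apply: gap_sum_le => //; first by rewrite invr_ge0 ltW.
move=> r s _ _ _; rewrite ler_norml.
have h x : 0 <= (f x)^-1 <= c^-1 by rewrite invr_ge0 (ltW (f_gt0 x))/= lef_pV2 ?posrE.
have /andP[h1 h2] := h (X r w); have /andP[h3 h4] := h (X s w).
by apply/andP; split; lra.
Qed.

Lemma integral_gap_sum_fin_num n : (\int[P]_w (gap_sum n w)%:E)%E \is a fin_num.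
Proof.
have [_ _ _ _ aereg] := Xd.
have I0 : (0 <= \int[P]_w (gap_sum n w)%:E)%E.
  by apply: integral_ge0 => w _; rewrite lee_fin gap_sum_ge0.
rewrite ge0_fin_numE//.
apply: (@le_lt_trans _ _ (\int[P]_w ((S - e) * c^-1)%:E)%E).
  apply: ae_ge0_le_integral => //.
  - by move=> w _; rewrite lee_fin gap_sum_ge0.
  - by apply/measurable_EFinP; exact: measurable_gap_sum.
  - move=> w _; rewrite lee_fin mulr_ge0 ?invr_ge0 ?subr_ge0// ltW//.
  - by apply: filterS aereg => w wreg _; rewrite lee_fin gap_sum_bounded.
rewrite integral_cst// [X in (_ * X)%E]probability_setT mule1; exact: ltry.
Qed.

Lemma integral_gap_sum_cvg : (\int[P]_w (gap_sum n w)%:E)%E @[n --> \oo] --> 0%E.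
Proof.
have [_ _ _ _ aereg] := Xd.
have cstI : P.-integrable setT (EFin \o cst ((S - e) * c^-1)).
  exact: (finite_measure_integrable_cst P).
have := @dominated_convergence _ _ _ P setT measurableT (fun n w => (gap_sum n w)%:E)
  (fun=> 0%E) (fun=> ((S - e) * c^-1)%:E).
case => //.
- by move=> n; apply/measurable_EFinP; exact: measurable_gap_sum.
- apply: filterS aereg => w wreg _; apply: cvg_EFin; first by near=> n.
  exact: gap_sum_cvg.
- apply: filterS aereg => w wreg n _.
  by rewrite gee0_abs ?lee_fin ?gap_sum_ge0// gap_sum_bounded.
- by move=> _ _; rewrite integral0.
Unshelve. all: by end_near. Qed.

Lemma integral_gap_sum n : (\int[P]_w (gap_sum n w)%:E =
  \sum_(i < n.+1) \int[P]_(w in conf (gridpt n i.+1))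
    (gap (gridpt n i) (gridpt n i.+1) w)%:E)%E.
Proof.
transitivity (\int[P]_w (\sum_(i < n.+1)
    (\1_(conf (gridpt n i.+1)) w * gap (gridpt n i) (gridpt n i.+1) w)%:E))%E.
  by apply: eq_integral => w _; rewrite sumEFin.
rewrite (ge0_integral_sum P)//; first last.
- by move=> i w _; rewrite lee_fin; apply: mulr_ge0; [rewrite indicE ler0n|exact: normr_ge0].
- by move=> i; apply/measurable_EFinP; apply: measurable_funM.
apply: eq_bigr => i _; rewrite [RHS]integral_mkcond; apply: eq_integral => w _.
by rewrite patchE indicE; case: ifP; rewrite ?mul1r ?mul0r.
Qed.

Context (n : nat) (V : nat -> R -> R) (L eta : R).
Hypothesis mV : forall i, measurable_fun setT (V i).
Hypothesis V0 : forall i x, 0 <= V i x.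
Hypothesis L0 : 0 <= L.
Hypothesis eta0 : 0 <= eta.
Hypothesis V_lip : forall i x y, `|V i x - V i y| <= L * `|x - y|.
Hypothesis VS : forall i x, lo <= x <= hi ->
  (\int[normal_prob (0 : R) (Num.sqrt (mesh n))]_z
     (V i.+1 (x + (Num.sqrt 2 * z + mesh n / f x)))%:E <= (V i x + eta)%:E)%E.

Lemma euler_scheme :
  (\int[P]_(w in conf S) (V n.+1 (X S w))%:E <=
   \int[P]_(w in conf e) (V 0%N (X e w))%:E + (n.+1%:R * eta)%:E +
   L%:E * \int[P]_w (gap_sum n w)%:E)%E.
Proof.
rewrite integral_gap_sum.
suff H i : (\int[P]_(w in conf (gridpt n i)) (V i (X (gridpt n i) w))%:E <=
    \int[P]_(w in conf (gridpt n 0)) (V 0%N (X (gridpt n 0) w))%:E + (i%:R * eta)%:E +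
    L%:E * \sum_(j < i) \int[P]_(w in conf (gridpt n j.+1))
      (gap (gridpt n j) (gridpt n j.+1) w)%:E)%E.
  by have := H n.+1; rewrite gridpt_end gridpt0.
elim: i => [|i IH].
  by rewrite big_ord0 mul0r mule0 !adde0.
have [F1 F2 F3] := filF.
have es := gridpt_ge n i; have s0 := le_trans e0 es.
have sub : conf (gridpt n i.+1) `<=` conf (gridpt n i).
  exact/le_confined/ltW/gridpt_lt.
have itv w : conf (gridpt n i) w -> lo <= X (gridpt n i) w <= hi.
  by move=> [h1 h2]; rewrite h2 ?h1// ?s0 ?es lexx.
have Fc j : F (gridpt n j) (conf (gridpt n j)).
  by apply: measurable_confined => //; exact: gridpt_ge.
have VS' x : lo <= x <= hi -> (\int[normal_prob (0 : R) (Num.sqrt (gridpt n i.+1 - gridpt n i))]_z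
     (V i.+1 (x + (Num.sqrt 2 * z + (gridpt n i.+1 - gridpt n i) / f x)))%:E <= (V i x + eta)%:E)%E.
  by move=> xI; rewrite gridptS; exact: VS.
have step := @euler_step _ _ _ P F B X filF brB adX f (V i) (V i.+1) lo hi
  (gridpt n i) (gridpt n i.+1) L eta (conf (gridpt n i)) (conf (gridpt n i.+1))
  cf s0 (gridpt_lt n i) (Fc i) (Fc i.+1) sub itv (mV i) (mV i.+1) (V0 i) (V0 i.+1)
  L0 eta0 (@V_lip i.+1) VS'.
have gap_ge0 j : (0 <= \int[P]_(w in conf (gridpt n j.+1))
    (gap (gridpt n j) (gridpt n j.+1) w)%:E)%E.
  by apply: integral_ge0 => w _; rewrite lee_fin normr_ge0.
rewrite big_ord_recr/=; apply: (le_trans step).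
apply: (le_trans (leeD2r _ (leeD2r _ IH))) => {step IH}.
set G := (\int[P]_(w in conf (gridpt n i.+1)) (gap (gridpt n i) (gridpt n i.+1) w)%:E)%E.
have G0 : (0 <= G)%E by exact: gap_ge0.
set SG := (\sum_(j < i) _)%R; have SG0 : (0 <= SG)%E by exact: sume_ge0.
clearbody G SG; rewrite ge0_muleDr//.
rewrite -natr1 mulrDl mul1r EFinD !addeA leeD2r//.
by rewrite [leLHS]addeAC.
Qed.

End euler_scheme.

(** * Passage to the limit *)

Section confinement_probability.
Context {R : realType} {d : measure_display} {T : measurableType d}.
Context (P : probability T R) (F : R -> set (set T)) (B X : R -> T -> R).
Context (g gc f f1 : R -> R) (a b lo hi a0 e S c : R).
Implicit Types (x y z : R).
Hypothesis Xd : diffusion_from (fun x => (g x)^-1) a 0 P F B X.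
Hypothesis cgc : continuous gc.
Hypothesis gcE : forall x, 0 <= x <= a -> gc x = g x.
Hypothesis g_ge0 : forall x, 0 <= x <= a -> 0 <= g x.
Hypothesis cf : continuous f.
Hypothesis cf1 : continuous f1.
Hypothesis c0 : 0 < c.
Hypothesis f_ge : forall x, c <= f x.
Hypothesis fE : forall x, lo <= x <= hi -> f x = g x.
Hypothesis df : forall x, b <= x <= a0 -> is_derive x 1 f (f1 x).
Hypothesis hia : hi < a.
Hypothesis blo : b < lo.
Hypothesis lohi : lo <= hi.
Hypothesis hia0 : hi < a0.
Hypothesis e0 : 0 <= e.
Hypothesis eS : e < S.

Let f_gt0 x : 0 < f x. Proof. exact: lt_le_trans (f_ge x). Qed.
Let ba0 : b <= a0. Proof. by apply/ltW/(lt_trans blo)/(le_lt_trans lohi). Qed.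
Let Se_gt0 : 0 < S - e. Proof. by rewrite subr_gt0. Qed.

Local Notation conf := (confined X e lo hi).

Lemma measurable_conf t : e <= t -> measurable (conf t).
Proof.
move=> et; have [[F1 F2 F3] _ [adX cX] _ _] := Xd.
apply: (F2 t); first exact: le_trans et.
by apply: measurable_confined => //; split.
Qed.

Section fixed_rate.
Context (A A1 q q1 : R -> R) (th : R).
Hypothesis AL : hasL f A A1 (fun x => q x * A x).
Hypothesis A1b : A1 b = 0.
Hypothesis A_gt0 : forall x, 0 < A x.
Hypothesis A1_ge0 : forall x, b <= x -> 0 <= A1 x.
Hypothesis q_gt0 : forall x, 0 < q x.
Hypothesis dq : forall x, is_derive x 1 q (q1 x).
Hypothesis cq1 : continuous q1.
Hypothesis th_ge1 : 1 <= th.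
Hypothesis q_ge : forall x, b <= x <= a0 -> th - 1 <= q x.

Let cq : continuous q. Proof. exact: is_derive_continuousT dq. Qed.

Local Notation sv := (surv f b a0 A q).
Let G k x := sv k (clamp b a0 x).

Let G_itv k x : 0 <= G k x <= 1.
Proof. exact: (surv_le1 cf f_gt0 AL A1b A_gt0 A1_ge0 q_gt0 cq k (clamp_itv x ba0)). Qed.

Let G0 x : G 0 x = 1. Proof. by []. Qed.

Let cG k : continuous (G k).
Proof.
move=> x; apply: continuous_comp; first exact: continuous_clamp.
exact: (continuous_surv cf f_gt0 AL A_gt0 cq).
Qed.

Let mG k : measurable_fun setT (G k).
Proof. by apply: continuous_measurable_fun; exact: cG. Qed.

Let G_lip n : exists2 L : R, 0 <= L &
  forall k x y, (k <= n)%N -> `|G k x - G k y| <= L * `|x - y|.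
Proof.
elim: n => [|n [L L0 HL]].
  exists 0 => // k x y; rewrite leqn0 => /eqP ->.
  by rewrite !G0 subrr normr0 mul0r.
have [L' L'0 HL'] := surv_lip cf f_gt0 blo lohi hia0 AL A_gt0 dq n.+1.
exists (L + L'); first exact: addr_ge0.
move=> k x y; rewrite leq_eqVlt ltnS => /predU1P[->|kn].
  by apply: (le_trans (HL' x y)); rewrite ler_wpM2r// lerDr.
by apply: (le_trans (HL k x y kn)); rewrite ler_wpM2r// lerDl.
Qed.

Let G_step n : exists2 C : R, 0 <= C & forall k h x, (k < n)%N -> 0 < h <= 1 ->
  lo <= x <= hi -> (\int[normal_prob (0 : R) (Num.sqrt h)]_z
      (G k.+1 (x + (Num.sqrt 2 * z + h / f x)))%:E
   <= (sv k.+1 x + h * (q x * (sv k.+1 x - sv k x)) + C * (h * Num.sqrt h))%:E)%E.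
Proof.
elim: n => [|n [C C0 HC]]; first by exists 0.
have [C' C'0 HC'] := one_step cf cf1 f_gt0 df blo lohi hia0 AL A1b A_gt0 A1_ge0 q_gt0 dq cq1 n.
exists (C + C'); first exact: addr_ge0.
move=> k h x; rewrite ltnS leq_eqVlt => /predU1P[->|kn] /[dup] h01 /andP[h0 _] xI.
  apply: (le_trans (HC' h x h01 xI)); rewrite lee_fin lerD2l ler_wpM2r ?lerDr//.
  by rewrite mulr_ge0 ?sqrtr_ge0 ?ltW.
apply: (le_trans (HC k h x kn h01 xI)); rewrite lee_fin lerD2l ler_wpM2r ?lerDl//.
by rewrite mulr_ge0 ?sqrtr_ge0 ?ltW.
Qed.

Local Notation p := (fine (P (conf S))).

(** The barrier runs along the grid with [s = mesh * (th - 1)]. At the end it is at least the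
    probability that a negative binomial count reaches [n]; at time [e] it is at most [sv n b],
    because [sv n] is nonincreasing. The local errors [C * h ^ (3/2)] add up to order [sqrt h]. *)
Lemma confined_prob_le_euler n z : 0 < z <= 1 -> exists C L : R,
  forall N, mesh e S N <= 1 ->
  p * (1 - z^-1 ^+ n * (1 + mesh e S N * (th - 1) * (1 - z))^-1 ^+ N.+1) <=
  sv n b + C * Num.sqrt (mesh e S N) +
  L * fine (\int[P]_w (gap_sum B X f lo hi e S N w)%:E)%E.
Proof.
move=> z01; have [L L0 HL] := G_lip n; have [C C0 HC] := G_step n.
exists ((S - e) * C), L => N h1; set h := mesh e S N.
have h0 : 0 < h by rewrite divr_gt0.
pose s := h * (th - 1); have s0 : 0 <= s by rewrite mulr_ge0 ?subr_ge0// ltW.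
pose V i := barrier s G n i.
have eta0 : 0 <= C * (h * Num.sqrt h) by rewrite !mulr_ge0 ?sqrtr_ge0// ltW.
have VS i x : lo <= x <= hi ->
  (\int[normal_prob (0 : R) (Num.sqrt h)]_z
     (V i.+1 (x + (Num.sqrt 2 * z + h / f x)))%:E <= (V i x + C * (h * Num.sqrt h))%:E)%E.
  move=> /[dup] xI /andP[lox xhi].
  have xab : b <= x <= a0 by rewrite (le_trans (ltW blo))//= (le_trans xhi)// ltW.
  have GE k : G k x = sv k x by rewrite /G clamp_id.
  apply: (@barrier_step _ s s0 G n G_itv G0 i _ _ (normal_prob (0 : R) (Num.sqrt h))
    (fun z => x + (Num.sqrt 2 * z + h / f x))) => //.
    apply: continuous_measurable_fun; apply: continuousDT; first exact: continuousCT.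
    apply: continuousDT; last exact: continuousCT.
    by apply: continuousMT; [exact: continuousCT|move=> ?; exact: cvg_id].
  move=> k kn; apply: le_trans (HC k h x kn _ xI) _; first by rewrite h0.
  rewrite lee_fin lerD2r !GE /s.
  have /andP[_ svk] := surv_itv cf f_gt0 AL A1b A_gt0 A1_ge0 q_gt0 cq k xab.
  (* The difference [sv k.+1 x - sv k x] is nonpositive, so replacing [q x] by its lower bound
     [th - 1] increases the right side. *)
  have : h * (q x - (th - 1)) * (sv k.+1 x - sv k x) <= 0.
    by rewrite mulr_ge0_le0 ?subr_le0// mulr_ge0 ?subr_ge0 ?q_ge// ltW.
  lra.
have := @euler_scheme _ _ _ P F B X g f a lo hi e S Xd cf
  e0 eS N V L _ (fun i => measurable_barrier s n i mG) (barrier_ge0 s0 n G_itv)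
  L0 eta0 (fun i => barrier_lip s0 i L0 HL) VS.
have cstle Q k : measurable Q -> (\int[P]_(w in Q) k%:E = k%:E * P Q)%E.
  by move=> mQ; rewrite integral_cst.
have mXt t : 0 <= t -> measurable_fun setT (X t).
  by case: Xd => filF _ [adX _] _ _; exact: (adapted_measurable filF).
have [S0 mS] : 0 <= S /\ measurable (conf S).
  by split; [exact: le_trans (ltW eS)|exact/measurable_conf/ltW].
have mV i : measurable_fun setT (V i) by exact: measurable_barrier.
have low : ((1 - \sum_(j < n) nbinom s N.+1 j)%:E * P (conf S) <=
    \int[P]_(w in conf S) (V N.+1 (X S w))%:E)%E.
  rewrite -cstle//; apply: ge0_le_integral => //.
  - by move=> w _; rewrite lee_fin subr_ge0 sum_nbinom_le1.
  - apply/measurable_EFinP; apply: measurable_funTS; apply: measurableT_comp => //.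
    exact: mXt.
  - by move=> w _; rewrite lee_fin barrier_ge.
have up : (\int[P]_(w in conf e) (V 0%N (X e w))%:E <= (sv n b)%:E)%E.
  apply: (@le_trans _ _ (\int[P]_(w in conf e) (sv n b)%:E)%E).
    have mce : measurable (conf e) by exact: measurable_conf.
    apply: ge0_le_integral => //.
    - by move=> w _; rewrite lee_fin barrier_ge0.
    - apply/measurable_EFinP; apply: measurable_funTS; apply: measurableT_comp => //.
      exact: mXt.
    - move=> w [h2 h3]; rewrite lee_fin /V barrier0// /G.
      have Xe : lo <= X e w <= hi by rewrite h2 ?h3 ?e0 ?lexx.
      case/andP: Xe => Xe1 Xe2; rewrite clamp_id; last first.
        by rewrite (le_trans (ltW blo) Xe1) (le_trans Xe2 (ltW hia0)).
      apply: (surv_nincr cf f_gt0 AL A1b A_gt0 A1_ge0 q_gt0 cq) => //.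
        by rewrite (le_trans (ltW blo) Xe1).
      by rewrite (le_trans Xe2 (ltW hia0)).
  rewrite cstle; last exact: measurable_conf.
  rewrite -[leRHS]mule1 lee_wpmul2l ?lee_fin//; last exact: probability_le1 (measurable_conf _).
  by have /andP[] := G_itv n b; rewrite /G clamp_id ?lexx.
move=> H; have {H} := le_trans low (le_trans H (leeD2r _ (leeD2r _ up))).
set E := (\int[P]_w _)%E.
have Efin : E \is a fin_num.
  exact: (integral_gap_sum_fin_num Xd cgc gcE g_ge0 cf c0 f_ge fE hia e0 eS).
rewrite -(fineK Efin) -(fineK (fin_num_measure P _ mS)).
rewrite -!EFinM -!EFinD lee_fin => H.
have p0 : 0 <= p by rewrite fine_ge0.
have nb := sum_nbinom_le s0 N.+1 n z01.
have : p * (1 - z^-1 ^+ n * (1 + s * (1 - z))^-1 ^+ N.+1) <= (1 - \sum_(j < n) nbinom s N.+1 j) * p.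
  by rewrite mulrC ler_wpM2r// lerB.
move=> /le_trans; apply; apply: (le_trans H); rewrite lerD2r lerD2l.
have -> : N.+1%:R * (C * (h * Num.sqrt h)) = (N.+1%:R * h) * C * Num.sqrt h by ring.
by rewrite (_ : N.+1%:R * h = S - e)// /h /mesh mulrC divfK.
Qed.

Lemma confined_prob_le_surv n z : 0 < z <= 1 ->
  p * (1 - z^-1 ^+ n * expR (- ((S - e) * (th - 1) * (1 - z)))) <= sv n b.
Proof.
move=> z01; have [C [L H]] := confined_prob_le_euler n z01.
have /andP[z0 z1] := z01.
pose k := (th - 1) * (1 - z).
have k0 : 0 <= k by rewrite mulr_ge0 ?subr_ge0.
(* Gathers the terms depending continuously on the mesh [(S - e) * harmonic N]; their limit is the
   value at 0. *)
pose U (x : R) := p * (1 - z^-1 ^+ n * expR ((S - e) * k * ((S - e) * x * k - 1))) -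
  C * Num.sqrt ((S - e) * x) - sv n b.
have cid : continuous (fun x : R => x) by move=> x; exact: cvg_id.
have cU : continuous U.
  have cst (u : R) : continuous (fun _ : R => u) by exact: continuousCT.
  apply: continuousDT; last exact: cst.
  apply: continuousDT.
    apply: continuousMT; first exact: cst.
    apply: continuousDT; first exact: cst.
    apply: continuousNT; apply: continuousMT; first exact: cst.
    move=> x; apply: (@continuous_comp _ _ _
      (fun x : R => (S - e) * k * ((S - e) * x * k - 1)) expR); last exact: continuous_expR.
    apply: continuousMT; first exact: cst.
    apply: continuousDT; last exact: cst.
    by apply: continuousMT => //; exact: continuousMT.
  apply: continuousNT; apply: continuousMT; first exact: cst.
  move=> x; apply: (@continuous_comp _ _ _ (fun x : R => (S - e) * x) Num.sqrt); last exact: sqrt_continuous.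
  by apply: continuousMT.
have cvgU : U (harmonic N) @[N --> \oo] --> U 0.
  apply: (continuous_cvg _ (cU 0)); exact: cvg_harmonic.
have cvgE : L * fine (\int[P]_w (gap_sum B X f lo hi e S N w)%:E)%E @[N --> \oo] --> L * 0.
  apply: cvgMl_tmp; apply: fine_cvg.
  exact: (integral_gap_sum_cvg Xd cgc gcE g_ge0 cf c0 f_ge fE hia e0 eS).
suff nearU : \forall N \near \oo, U (harmonic N) <=
    L * fine (\int[P]_w (gap_sum B X f lo hi e S N w)%:E)%E.
  have := ler_cvg_to cvgU cvgE nearU.
  rewrite /U mulr0 sqrtr0 mulr0 mul0r sub0r mulrN1 subr0 mulr0.
  by rewrite subr_le0 /k mulrA; apply; exact: eventually_filter.
have [N0 _ HN0] := near_infty_natSinv_lt (PosNum (divr_gt0 ltr01 Se_gt0)).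
exists N0 => // N NN0.
have h1 : mesh e S N <= 1.
  by have := ltW (HN0 N NN0); rewrite /= ler_pdivlMr// mulrC.
have {H} := H N h1.
have -> : mesh e S N * (th - 1) * (1 - z) = mesh e S N * k by rewrite mulrA.
have hE : mesh e S N = (S - e) * harmonic N by [].
set h := mesh e S N in h1 hE *; have h0 : 0 < h by rewrite divr_gt0.
have t0 : 0 <= h * k by rewrite mulr_ge0// ltW.
rewrite /U -hE.
have p0 : 0 <= p by rewrite fine_ge0.
have zn : 0 <= z^-1 ^+ n by rewrite exprn_ge0// invr_ge0 ltW.
(* For [t = h * k], [(1 + t) * (1 - t + t ^ 2) = 1 + t ^ 3] gives [1 / (1 + t) <= 1 - t + t ^ 2 <=
   expR (t * (t - 1))]. *)
have key : (1 + h * k)^-1 ^+ N.+1 <= expR ((S - e) * k * (h * k - 1)).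
  have hN : N.+1%:R * h = S - e by rewrite /h /mesh mulrC divfK.
  have -> : (S - e) * k * (h * k - 1) = N.+1%:R * (h * k * (h * k - 1)).
    by rewrite -hN; ring.
  rewrite expRM_natl lerXn2r ?nnegrE ?invr_ge0 ?expR_ge0 ?addr_ge0//.
  apply: le_trans (expR_ge1Dx _).
  rewrite -div1r ler_pdivrMr ?ltr_pwDl//.
  have : 0 <= (h * k) ^+ 3 by rewrite exprn_ge0.
  lra.
have : p * (1 - z^-1 ^+ n * expR ((S - e) * k * (h * k - 1))) <=
    p * (1 - z^-1 ^+ n * (1 + h * k)^-1 ^+ N.+1).
  by rewrite ler_wpM2l// lerB// ler_wpM2l.
lra.
Qed.

End fixed_rate.

Lemma continuous_harmonic_le (U : R -> R) (u : R) : continuous U ->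
  (\forall n \near \oo, U (harmonic n) <= u) -> U 0 <= u.
Proof.
move=> cU; apply: cvgr_to_le; apply: (continuous_cvg _ (cU 0)); exact: cvg_harmonic.
Qed.

(* [G] is a survival probability after [n] exponential clocks of rate [th]; as
   [th] grows, the clocks concentrate around the deterministic time [n / th]. *)
Lemma tail_rate_limit (u v mu t : R) : 0 <= u -> 0 <= v -> 0 <= mu -> mu < t ->
  (forall th, 2 <= th -> exists G : nat -> R,
    (forall n z, 0 < z <= 1 ->
      u * (1 - z^-1 ^+ n * expR (- (t * (th - 1) * (1 - z)))) <= G n) /\
    (forall n, th * mu + 1 < n%:R ->
      2 * G n * (n%:R - (th * mu + 1)) ^+ 2 <=
      2 * th ^+ 2 * v + 4 * th * mu + 2 * th * mu ^+ 2 + 4 * n%:R)) ->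
  u * (t - mu) ^+ 2 <= v.
Proof.
move=> u0 v0 mu0 mut H; have t0 : 0 < t by lra.
have cid : continuous (fun x : R => x) by move=> x; exact: cvg_id.
have cst (k : R) : continuous (fun _ : R => k) by exact: continuousCT.
(* [k] is a relative slack: [n] will be about [(1 - 2 * k) * t * th], below the typical number
   [t * th] of rings, and Chernoff's bound is used at [z = 1 - k]. The limit in [th] comes before
   the limit in [k]. *)
suff Hk k : 0 < k < 1 / 2 -> mu < (1 - 2 * k) * t -> u * ((1 - 2 * k) * t - mu) ^+ 2 <= v.
  have := @continuous_harmonic_le (fun k => u * ((1 - 2 * k) * t - mu) ^+ 2) v.
  rewrite mulr0 subr0 mul1r; apply.
    apply: continuousMT; first exact: cst.
    apply: continuousXT; apply: continuousDT; last exact: cst.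
    apply: continuousMT; last exact: cst.
    by apply: continuousDT; [|apply: continuousNT; apply: continuousMT].
  pose del := Num.min (1 / 2) ((t - mu) / (2 * t)).
  have del0 : 0 < del by rewrite lt_min !divr_gt0// ?mulr_gt0// subr_gt0.
  have [n0 _ Hn] := near_infty_natSinv_lt (PosNum del0).
  exists n0 => // n /Hn /=; rewrite /harmonic/=.
  have : 0 < n.+1%:R^-1 :> R by rewrite invr_gt0 ltr0n.
  move: (n.+1%:R^-1) => x x0; rewrite lt_min => /andP[h1].
  rewrite ltr_pdivlMr ?mulr_gt0// => h2.
  by apply: Hk; lra.
move=> /andP[k0 k1] gt; set ga : R := 1 - 2 * k in gt *.
pose D : R := ga * t - mu; have D0 : 0 < D by rewrite subr_gt0.
(* Half of the lower order terms [4 * th * mu + 2 * th * mu ^ 2 + 4 * n], divided by [th], with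
   [n <= t * th]. *)
pose K := 2 * mu + mu ^+ 2 + 2 * t.
(* The Chernoff exponent is at most [t * k - t * k ^ 2 * th], and [expR (- x) <= 1 / x] turns this
   into [K2 / th]. *)
pose K2 := expR (t * k) / (t * k ^+ 2).
have K20 : 0 < K2 by rewrite divr_gt0 ?expR_gt0 ?mulr_gt0 ?exprn_gt0.
suff near_le : \forall n \near \oo,
    u * (1 - K2 * harmonic n) * (D - 2 * harmonic n) ^+ 2 - K * harmonic n <= v.
  have := continuous_harmonic_le (U := fun x => u * (1 - K2 * x) * (D - 2 * x) ^+ 2 - K * x) _ near_le.
  rewrite !mulr0 !subr0 mulr1; apply.
  apply: continuousDT; last by apply: continuousNT; apply: continuousMT.
  apply: continuousMT.
    apply: continuousMT; first exact: cst.
    by apply: continuousDT; [|apply: continuousNT; apply: continuousMT].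
  by apply: continuousXT; apply: continuousDT; [|apply: continuousNT; apply: continuousMT].
pose del := Num.min (1 / 2) (Num.min (D / 2) (1 / K2)).
have del0 : 0 < del by rewrite !lt_min; apply/and3P; split; rewrite divr_gt0.
have [n0 _ Hn] := near_infty_natSinv_lt (PosNum del0).
exists n0 => // m /Hn /=; rewrite !lt_min => /and3P[h1 h2 h3].
set th : R := m.+1%:R in h1 h2 h3; have th0 : 0 < th by rewrite ltr0n.
rewrite -/th.
have {h1} th2 : 2 <= th.
  by move: h1; rewrite -div1r ltr_pdivrMr//; lra.
have {h2} thD : 2 < th * D.
  by move: h2; rewrite -div1r ltr_pdivrMr//; lra.
have {h3} thK : K2 / th <= 1.
  by move: h3; rewrite ltr_pdivlMr// mulrC => /ltW.
have [G [G1 G2]] := H th th2.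
have r0 : 0 <= ga * t * th.
  by rewrite !mulr_ge0// ?ltW// /ga; lra.
have /andP[n1 n2] := truncn_itv r0; set n := Num.trunc _ in n1 n2.
have n3 : ga * t * th - 1 < n%:R by move: n2; rewrite -natr1; lra.
have thDE : th * D = ga * t * th - th * mu by rewrite /D; ring.
have ngt : th * mu + 1 < n%:R by lra.
have := G2 n ngt; have z01 : 0 < 1 - k <= 1 by lra.
have := G1 n (1 - k) z01; rewrite (_ : 1 - (1 - k) = k); last by ring.
move=> GK G2n.
have dle : (1 - k)^-1 ^+ n * expR (- (t * (th - 1) * k)) <= K2 / th.
  have zk : (1 - k)^-1 <= expR (k / (1 - k)).
    apply: le_trans (expR_ge1Dx _); rewrite le_eqVlt; apply/orP; left; apply/eqP.
    by field; lra.
  apply: (@le_trans _ _ (expR (n%:R * (k / (1 - k))) * expR (- (t * (th - 1) * k)))).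
    rewrite ler_wpM2r ?expR_ge0// expRM_natl lerXn2r ?nnegrE ?expR_ge0// invr_ge0; lra.
  rewrite -expRD.
  have E1 : n%:R * (k / (1 - k)) - t * (th - 1) * k <= t * k - t * k ^+ 2 * th.
    have k2 : 0 < 1 - k by lra.
    have : n%:R * (k / (1 - k)) <= ga * t * th * (k / (1 - k)).
      by rewrite ler_wpM2r// divr_ge0// ltW.
    move=> /le_trans -/(_ (t * th * (k - k ^+ 2))) => E2.
    (* After multiplication by [1 - k] this is [1 - 2 * k <= (1 - k) ^ 2]. *)
    have : ga * t * th * (k / (1 - k)) <= t * th * (k - k ^+ 2).
      have -> : ga * t * th * (k / (1 - k)) = (t * th) * (ga * k / (1 - k)) by ring.
      rewrite ler_wpM2l ?mulr_ge0 ?(ltW t0) ?(ltW th0)// ler_pdivrMr// /ga.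
      have : 0 <= k ^+ 3 by rewrite exprn_ge0// ltW.
      lra.
    move=> /E2; lra.
  apply: (@le_trans _ _ (expR (t * k - t * k ^+ 2 * th))); first by rewrite ler_expR.
  rewrite expRD expRN /K2 -!mulrA ler_wpM2l ?expR_ge0// -invfM.
  have tk : 0 < t * (k ^+ 2 * th) by rewrite !mulr_gt0// exprn_gt0.
  rewrite !mulrA in tk *.
  rewrite lef_pV2 ?posrE ?expR_gt0//.
  by apply: le_trans (expR_ge1Dx _); lra.
have uK : u * (1 - K2 / th) <= G n.
  by apply: le_trans GK; rewrite ler_wpM2l// lerB.
have uK0 : 0 <= u * (1 - K2 / th) by rewrite mulr_ge0// subr_ge0.
have sq : (th * D - 2) ^+ 2 <= (n%:R - (th * mu + 1)) ^+ 2.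
  by rewrite lerXn2r ?nnegrE; lra.
have big : u * (1 - K2 / th) * (th * D - 2) ^+ 2 <= G n * (n%:R - (th * mu + 1)) ^+ 2.
  by apply: ler_pM => //; exact: sqr_ge0.
have nle : n%:R <= t * th.
  apply: (le_trans n1); rewrite ler_wpM2r ?(ltW th0)// ler_piMl ?(ltW t0)// /ga; lra.
have thK' : 0 <= th * mu ^+ 2 by rewrite mulr_ge0 ?sqr_ge0// ltW.
have -> : u * (1 - K2 / th) * (D - 2 / th) ^+ 2 - K / th =
    (u * (1 - K2 / th) * (th * D - 2) ^+ 2 - K * th) / th ^+ 2.
  by field; rewrite gt_eqF.
rewrite ler_pdivrMr ?exprn_gt0// /K.
set Z := u * _ * _ in big *; rewrite -mulrA in G2n; set Y := G n * _ in big G2n.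
move: Z Y big G2n => Z Y big G2n; lra.
Qed.

Lemma confined_prob_le : mean_exit f b a0 b < S - e ->
  fine (P (conf S)) * (S - e - mean_exit f b a0 b) ^+ 2 <= var_exit f b a0 b.
Proof.
move=> mu_lt.
have bb : b <= b <= a0 by rewrite lexx.
apply: tail_rate_limit => //.
- by rewrite fine_ge0.
- exact: (var_exit_ge0 cf f_gt0 bb).
- by have /andP[] := mean_exit_ge0 cf f_gt0 bb.
move=> th th2.
have [A [A1 [q [q1 [[AL A1b A0 A10] [q0 dq cq1 q_itv]]]]]] :=
  near_eigenfunction_exists cf f_gt0 ba0 th2.
have q_ge x : b <= x <= a0 -> th - 1 <= q x by move=> /q_itv/andP[].
exists (fun n => surv f b a0 A q n b); split=> [n z z01|n nth].
  apply: (confined_prob_le_surv AL A1b A0 A10 q0 dq cq1 _ q_ge) => //; lra.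
by apply: (surv_tail cf f_gt0 ba0 th2 AL A1b A0 A10 q0 _ q_itv) => //; exact: is_derive_continuousT dq.
Qed.

End confinement_probability.

(** * Relative derivatives and continuous extensions *)

Section derivative_on.
Context {R : realType}.
Implicit Types (D : set R) (F G g : R -> R) (u v x y e : R).

Lemma derivative_on_dist D F G x e : is_derivative_on D F G -> D x -> 0 < e ->
  exists2 dl : R, 0 < dl & forall y, D y -> `|x - y| < dl ->
    `|F y - F x - G x * (y - x)| <= e * `|y - x|.
Proof.
move=> dF Dx e0; have /cvgrPdist_lt/(_ e e0)/nbhs_ballP[dl dl0 H] := dF x Dx.
exists dl => // y Dy xy; have [->|yx] := eqVneq y x.
  by rewrite !subrr mulr0 subr0 normr0 mulr0.
have yx0 : y - x != 0 by rewrite subr_eq0.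
have := H y xy yx Dy; rewrite distrC => /ltW h.
have -> : F y - F x - G x * (y - x) = ((F y - F x) / (y - x) - G x) * (y - x).
  by rewrite mulrBl divfK.
by rewrite normrM ler_wpM2r.
Qed.

Lemma derivative_on_continuous D F G : is_derivative_on D F G ->
  {within D, continuous F}.
Proof.
move=> dF; apply/subspace_continuousP => x Dx; apply/cvgrPdist_lt => e e0.
have [dl dl0 H] := derivative_on_dist dF Dx ltr01.
pose k := 1 + `|G x|; have k0 : 0 < k by rewrite ltr_pwDl.
have m0 : 0 < Num.min dl (e / k) by rewrite lt_min dl0 divr_gt0.
apply/nbhs_ballP; exists (Num.min dl (e / k)) => // y; rewrite /ball/= lt_min => /andP[h1 h2] Dy.
have := H y Dy h1; rewrite mul1r => h3.
rewrite distrC (_ : F y - F x = (F y - F x - G x * (y - x)) + G x * (y - x)); last by ring.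
apply: (le_lt_trans (ler_normD _ _)); rewrite normrM.
apply: (@le_lt_trans _ _ (k * `|y - x|)); first by rewrite /k mulrDl mul1r lerD2r.
by rewrite mulrC -ltr_pdivlMr// distrC.
Qed.

Lemma derivative_on_is_derive u v F G x : is_derivative_on `[u, v] F G ->
  u < x < v -> is_derive x 1 F (G x).
Proof.
move=> dF /andP[ux xv].
have Dx : `[u, v]%classic x by rewrite /= in_itv/= !ltW.
suff H : h^-1 *: ((F \o shift x) (h *: 1) - F x) @[h --> 0^'] --> G x.
  by apply: DeriveDef; [apply: cvgP H|apply: cvg_lim H].
apply/cvgrPdist_le => e e0; have [dl dl0 H] := derivative_on_dist dF Dx e0.
pose m := Num.min dl (Num.min (x - u) (v - x)).
have m0 : 0 < m by rewrite !lt_min dl0 !subr_gt0 ux xv.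
apply/nbhs_ballP; exists m => // h; rewrite /ball/= sub0r normrN !lt_min => /and3P[h1 h2 h3] h0.
have hx : `[u, v]%classic (h + x).
  move: h2 h3; rewrite !ltr_norml /= in_itv/= => /andP[? ?] /andP[? ?]; lra.
have := H (h + x) hx; rewrite (_ : x - (h + x) = - h); last by ring.
rewrite normrN addrK => /(_ h1).
have hn0 : 0 < `|h| by rewrite normr_gt0.
rewrite -ler_pdivrMr// => h4; apply: le_trans h4.
rewrite /GRing.scale/= mulr1 distrC -normfV -normrM.
by rewrite le_eqVlt; apply/orP; left; apply/eqP; congr `|_|; field.
Qed.

Lemma continuous_clamp_comp u v g : u <= v -> {within `[u, v], continuous g} ->
  continuous (fun x => g (clamp u v x)).
Proof.
move=> uv /subspace_continuousP cg x; apply/cvgrPdist_lt => e e0.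
have cx y : `[u, v]%classic (clamp u v y) by rewrite /= in_itv/= clamp_itv.
have /cvgrPdist_lt/(_ e e0)/nbhs_ballP[dl dl0 H] := cg _ (cx x).
apply/nbhs_ballP; exists dl => // y xy; apply: H => //.
exact: le_lt_trans (clamp_lip _ _ _ _) xy.
Qed.

Lemma continuous_ge0_closure u v g : u < v -> continuous g ->
  (forall x, u < x < v -> 0 <= g x) -> forall x, u <= x <= v -> 0 <= g x.
Proof.
move=> uv cg g0 x /andP[ux xv]; rewrite leNgt; apply/negP => gx.
have gx0 : 0 < - g x by rewrite oppr_gt0.
have [dl dl0 H] := continuous_dist (cg x) gx0.
pose m := Num.min (dl / 2) ((v - u) / 4).
have m0 : 0 < m by rewrite lt_min !divr_gt0// subr_gt0.
have mdl : m <= dl / 2 by rewrite ge_min lexx.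
have mvu : m <= (v - u) / 4 by rewrite ge_min lexx orbT.
have [xm|xm] := leP x ((u + v) / 2).
  have := H (x + m); rewrite opprD addNKr normrN gtr0_norm// => /(_ _).
  have := g0 (x + m); rewrite ltr_norml; lra.
have := H (x - m); rewrite opprB addrC subrK gtr0_norm// => /(_ _).
have := g0 (x - m); rewrite ltr_norml; lra.
Qed.

Lemma integral_continuous_prim g u v : u < v -> continuous g ->
  (\int[lebesgue_measure]_(x in `[u, v]) (g x)%:E = (prim u g v)%:E)%E.
Proof.
move=> uv cg; have dp x := is_derive_prim u x cg.
have cp : continuous (prim u g) by exact: is_derive_continuousT dp.
rewrite (@continuous_FTC2 _ _ (prim u g) _ _ uv).
- by rewrite prim_base// sube0.
- exact: continuous_subspaceT.
- split.
  + by move=> x _; have [] := dp x.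
  + exact: (cvg_at_right_filter (cp u)).
  + exact: (cvg_at_left_filter (cp v)).
- by move=> x _; rewrite derive1E; have [] := dp x.
Qed.

End derivative_on.

(** * From confinement to survival *)

Section survival_event.
Context {R : realType} {d : measure_display} {T : measurableType d}.
Context (P : probability T R) (F : R -> set (set T)) (X : R -> T -> R) (a : R).
Hypothesis filF : filtration F.
Hypothesis adX : adapted F X.
Hypothesis cX : continuous_paths X.
Implicit Types (s t : R).

Let Y t w := `|X t w - a|.

Let adY : adapted F Y.
Proof.
move=> t t0 U mU; apply: (adX t0 (U := (fun x => `|x - a|) @^-1` U)).
rewrite -[_ @^-1` _]setTI; apply: (measurableT_comp (@normr_measurable R setT)) => //.
exact: measurable_funB.
Qed.

Let cY : continuous_paths Y.
Proof.
move=> w x; apply: cvg_norm; apply: cvgB; [exact: cX|exact: cvg_cst].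
Qed.

(** A continuous path avoiding [a] on the compact [[0, t]] keeps a positive distance from it.
    Conversely, the distance at time [t] persists a little longer, which makes the infimum strictly
    larger than [t]. *)
Lemma hitting_time_gtE t : 0 <= t -> [set w | (t%:E < hitting_time X a w)%E] =
  \bigcup_k [set w | forall s, 0 <= s <= t -> k.+1%:R^-1 <= `|X s w - a|].
Proof.
move=> t0; apply/seteqP; split => w /=.
  move=> tau; have cYw : {within `[0, t], continuous (fun s => Y (Num.max 0 s) w)}.
    apply: continuous_subspaceT.
    exact: (@continuous_max0 _ (fun s => Y s w) (@cY w)).
  have [s + smin] := EVT_min t0 cYw; rewrite in_itv/= => /andP[s0 st].
  have Ys : 0 < Y s w.
    rewrite normr_gt0 subr_eq0; apply/eqP => Xs.
    have : (hitting_time X a w <= s%:E)%E by apply: ereal_inf_lbound; exists s.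
    by move=> /(lt_le_trans tau); rewrite lte_fin ltNge st.
  have [k _ /(_ k (leqnn k)) kY] := near_infty_natSinv_lt (PosNum Ys).
  exists k => // r /andP[r0 rt]; apply/ltW/(lt_le_trans kY).
  by have := smin r; rewrite in_itv/= r0 rt !(max_idPr _)//; apply.
move=> [k _ Hk].
have k0 : 0 < k.+1%:R^-1 :> R by rewrite invr_gt0 ltr0n.
have [dl dl0 Hdl] := continuous_dist (@continuous_max0 _ (fun s => Y s w) (@cY w) t) k0.
apply: (@lt_le_trans _ _ (t + dl)%:E); first by rewrite lte_fin ltrDl.
apply: le_ereal_inf_tmp => _ [s [s0 Xs] <-]; rewrite lee_fin leNgt; apply/negP => sdl.
have [st|ts] := leP s t.
  by have := Hk s; rewrite s0 st Xs subrr normr0 => /(_ isT); rewrite leNgt k0.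
have := Hdl s; rewrite !(max_idPr _)// distrC ger0_norm ?subr_ge0 ?(ltW ts)//.
rewrite ltrBlDl => /(_ sdl); rewrite /Y Xs subrr normr0 subr0 ger0_norm//.
by rewrite ltNge Hk// t0 lexx.
Qed.

Lemma measurable_hitting_time_gt t : 0 <= t ->
  measurable [set w | (t%:E < hitting_time X a w)%E].
Proof.
move=> t0; rewrite hitting_time_gtE//; apply: bigcup_measurable => k _.
have [_ F2 _] := filF; apply: (F2 t t0).
by apply: (measurable_path_ge filF adY cY).
Qed.

Context (g : R -> R) (B : R -> T -> R).

(** By compactness, the maximum over [[0, t]] is below [a], which is not hit, and the minimum over
    [[e, t]] is positive, as 0 is not revisited. *)
Lemma survival_confined w e t (lo hi : nat -> R) : 0 < e -> e <= t -> 0 < a ->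
  regular_path B X g a w ->
  (forall t, 0 < t -> (t%:E <= hitting_time X a w)%E -> X t w != 0) ->
  (forall r, 0 < r -> exists k, lo k <= r /\ a - r <= hi k) ->
  (t%:E < hitting_time X a w)%E -> exists k, confined X e (lo k) (hi k) t w.
Proof.
move=> e0 et a0 wreg wne dense tau; have t0 : 0 <= t by lra.
have tau_le s : s <= t -> (s%:E <= hitting_time X a w)%E.
  by move=> st; apply/ltW/(le_lt_trans _ tau); rewrite lee_fin.
have cXw : continuous (fun s => X (Num.max 0 s) w).
  exact: (@continuous_max0 _ (fun s => X s w) (@cX w)).
have [s + smax] := EVT_max t0 (continuous_subspaceT cXw).
rewrite in_itv/= => /andP[s0 st].
have [r + rmin] := EVT_min et (continuous_subspaceT cXw).
rewrite in_itv/= => /andP[er rt]; have r0 : 0 <= r by lra.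
have Xs : 0 < a - X s w.
  have [/andP[_ Xsa] _] := wreg s s0 (tau_le s st).
  rewrite subr_gt0 lt_neqAle Xsa andbT; apply/eqP => Xs.
  have : (hitting_time X a w <= s%:E)%E by apply: ereal_inf_lbound; exists s.
  by move=> /(lt_le_trans tau); rewrite lte_fin ltNge st.
have Xr : 0 < X r w.
  have [/andP[Xr0 _] _] := wreg r r0 (tau_le r rt).
  by rewrite lt_neqAle Xr0 eq_sym wne ?tau_le// (lt_le_trans e0).
have m0 : 0 < Num.min (a - X s w) (X r w) by rewrite lt_min Xs Xr.
have [k [h1 h2]] := dense _ m0; exists k; split=> u /andP[u1 u2].
  have := smax u; rewrite in_itv/= u1 u2 !(max_idPr _)// => /(_ isT) h3.
  apply: (le_trans h3); apply: le_trans h2; rewrite lerBrDl -lerBrDr.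
  by rewrite ge_min lexx.
have u0 : 0 <= u by lra.
have := rmin u; rewrite in_itv/= u1 u2 !(max_idPr _)// => /(_ isT); apply: le_trans.
by apply: (le_trans h1); rewrite ge_min lexx orbT.
Qed.

Lemma survival_prob_le e t v (lo hi : nat -> R) : 0 < e -> e <= t -> 0 < a -> 0 <= v ->
  {ae P, forall w, regular_path B X g a w} -> never_returns_to_0 P X a ->
  (forall k, lo k.+1 <= lo k /\ hi k <= hi k.+1) ->
  (forall r, 0 < r -> exists k, lo k <= r /\ a - r <= hi k) ->
  (forall k, fine (P (confined X e (lo k) (hi k) t)) <= v) ->
  (P [set w | (t%:E < hitting_time X a w)%E] <= v%:E)%E.
Proof.
move=> e0 et a0 v0 aereg aene mono dense conf_le; have t0 : 0 <= t by lra.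
pose Q k := confined X e (lo k) (hi k) t.
have mQ k : measurable (Q k).
  have [_ F2 _] := filF; apply: (F2 t t0).
  by apply: measurable_confined => //; exact: ltW.
have ndQ : nondecreasing_seq Q.
  apply/nondecreasing_seqP => k; apply/subsetPset => w [h1 h2].
  have [m1 m2] := mono k; split=> s st.
    by apply: le_trans m2; exact: h1.
  by apply: (le_trans m1); exact: h2.
have PQ : (P (\bigcup_k Q k) <= v%:E)%E.
  have mU : measurable (\bigcup_k Q k) by exact: bigcup_measurable.
  have cvgQ : P \o Q @ \oo --> P (\bigcup_k Q k) by exact: nondecreasing_cvg_mu.
  have <- := cvg_lim (@ereal_hausdorff R) cvgQ.
  apply: lime_le; first by apply/cvg_ex; exists (P (\bigcup_k Q k)).
  apply: nearW => k; rewrite /= -(fineK (fin_num_measure P _ (mQ k))) lee_fin.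
  exact: conf_le.
have [N1 [mN1 PN1 sN1]] := aereg; have [N2 [mN2 PN2 sN2]] := aene.
apply: (@le_trans _ _ (P ((\bigcup_k Q k) `|` (N1 `|` N2)))).
  apply: le_measure; rewrite ?inE.
  - exact: measurable_hitting_time_gt.
  - by do !apply: measurableU => //; exact: bigcup_measurable.
  move=> w /= tau.
  have [[h1 h2]|h] := pselect (regular_path B X g a w /\
      forall t, 0 < t -> (t%:E <= hitting_time X a w)%E -> X t w != 0).
    by left; have [k Qk] := survival_confined e0 et a0 h1 h2 dense tau; exists k.
  right; have [h1|h1] := pselect (regular_path B X g a w).
    by right; apply: sN2 => /= h2; apply: h.
  by left; apply: sN1.
apply: (le_trans (measureU2 _ _ _)); rewrite ?inE//.
- exact: bigcup_measurable.
- exact: measurableU.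
rewrite -[leRHS]adde0 leeD//.
have : (P (N1 `|` N2) <= P N1 + P N2)%E by exact: measureU2.
by rewrite [P N1]PN1 [P N2]PN2 adde0.
Qed.

End survival_event.

(** * The tail of the hitting time *)

Section tail_bound.
Context {R : realType} {d : measure_display} {T : measurableType d}.
Context (P : probability T R) (F : R -> set (set T)) (B X : R -> T -> R).
Context (phi g g1 : R -> R) (a m : R).
Implicit Types (x y : R).
Hypothesis a_gt0 : 0 < a.
Hypothesis Xd : diffusion_from (fun x => (g x)^-1) a 0 P F B X.
Hypothesis dphi : is_derivative_on `[0, a] phi g.
Hypothesis dg : is_derivative_on `[0, a] g g1.
Hypothesis cg1 : {within `[0, a], continuous g1}.
Hypothesis phi_incr : {in `[0, a] &, {homo phi : x y / x < y}}.
Hypothesis g_gt0 : forall x, 0 < x < a -> 0 < g x.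
Hypothesis m_le : forall x, 0 <= x <= a -> m <= g1 x.
Hypothesis m_gt : - (1 / 3) < m.

Let gc x := g (clamp 0 a x).
Let g1c x := g1 (clamp 0 a x).

Let cgc : continuous gc.
Proof.
by apply: (continuous_clamp_comp (ltW a_gt0)); exact: derivative_on_continuous dg.
Qed.
Let cg1c : continuous g1c. Proof. exact: continuous_clamp_comp (ltW a_gt0) cg1. Qed.
Let gcE x : 0 <= x <= a -> gc x = g x. Proof. by move=> x0a; rewrite /gc clamp_id. Qed.
Let gc_ge0 x : 0 <= x <= a -> 0 <= gc x.
Proof.
apply: continuous_ge0_closure => // y /andP[y0 ya].
by rewrite gcE ?(ltW y0) ?(ltW ya)// ltW// g_gt0// y0.
Qed.

Local Notation M := ((phi a - phi 0) / (1 + m)).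
Local Notation V := (prim 0 (fun x => gc x ^+ 3) a / ((1 + m) ^+ 2 * (1 + 3 * m))).

Let cgc3 : continuous (fun x => gc x ^+ 3). Proof. exact: continuousXT. Qed.
Let m1 : 0 < 1 + m. Proof. by move: m_gt; lra. Qed.
Let m3 : 0 < 1 + 3 * m. Proof. by move: m_gt; lra. Qed.

Let prim_le x y : 0 <= x -> x <= y -> y <= a ->
  prim 0 (fun x => gc x ^+ 3) x <= prim 0 (fun x => gc x ^+ 3) y.
Proof.
move=> x0 xy ya; apply: (@ge0_derive_le _ _ (fun x => gc x ^+ 3)) => //.
  by move=> z _; exact: is_derive_prim.
by move=> z /andP[xz zy]; rewrite exprn_ge0// gc_ge0//; lra.
Qed.

Lemma confined_prob_bound (del e S : R) : 0 < del <= a / 2 -> 0 <= e -> M < S - e ->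
  fine (P (confined X e del (a - del) S)) * (S - e - M) ^+ 2 <= V.
Proof.
move=> /andP[del0 dela] e0 MS.
have M_ge0 : 0 <= M.
  rewrite divr_ge0 ?(ltW m1)// subr_ge0 ltW// phi_incr ?in_itv/= ?lexx ?ltW//.
have eS : e < S by lra.
(* Three nested margins: paths are confined with margin [del], survival functions live on [[b, a0]]
   with margin [del / 2], and [f] is constant outside [[l, u]], with margin [del / 4]. So [f] is
   bounded below by a positive constant on the line, yet equals [g] near every point of [[b, a0]]
   and inherits its derivative there. *)
pose l := del / 4; pose u := a - del / 4.
have lu : l <= u by rewrite /l /u; lra.
pose f x := gc (clamp l u x).
have cf : continuous f.
  by move=> x; apply: continuous_comp; [exact: continuous_clamp|exact: cgc].
have fE x : l <= x <= u -> f x = g x.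
  by move=> xlu; rewrite /f clamp_id// gcE//; move: xlu; rewrite /l /u; lra.
have [y0 + Hy0] := EVT_min lu (continuous_subspaceT cgc).
rewrite in_itv/= => y0lu.
have y00 : 0 < gc y0 by move: y0lu; rewrite /l /u => y0lu; rewrite gcE ?g_gt0//; lra.
have f_ge x : gc y0 <= f x.
  by apply: Hy0; rewrite in_itv/=; exact: clamp_itv.
pose b := del / 2; pose a0 := a - del / 2.
have ba0 : b <= a0 by rewrite /b /a0; lra.
have inn x : b <= x <= a0 -> 0 < x < a by rewrite /b /a0; lra.
have df x : b <= x <= a0 -> is_derive x 1 f (g1c x).
  move=> xb; have /andP[x0 xa] := inn x xb.
  rewrite /g1c clamp_id; last by rewrite !ltW.
  apply: (@near_eq_is_derive _ _ _ g); last first.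
    by apply: (derivative_on_is_derive dg); rewrite x0.
  apply/nbhs_ballP; exists (del / 8); first by rewrite /= divr_gt0.
  move=> y; rewrite /ball/= ltr_norml => /andP[h1 h2]; rewrite fE//.
  by move: xb; rewrite /b /a0 /l /u => /andP[h3 h4]; apply/andP; split; lra.
have f_gt0 x : 0 < f x by exact: lt_le_trans (f_ge x).
have m_le' x : b <= x <= a0 -> m <= g1c x.
  move=> /inn/andP[x0 xa]; rewrite /g1c clamp_id ?m_le ?(ltW x0) ?(ltW xa)//.
have fE' x : b <= x <= a0 -> f x = g x.
  by move=> xb; rewrite fE//; move: xb; rewrite /b /a0 /l /u; lra.
have dphi' x : b <= x <= a0 -> is_derive x 1 phi (f x).
  by move=> xb; rewrite fE'//; apply: (derivative_on_is_derive dphi); exact: inn.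
have mean_le := mean_exit_le cf f_gt0 ba0 m_gt df m_le' dphi'.
have dpsi x : b <= x <= a0 -> is_derive x 1 (prim 0 (fun x => gc x ^+ 3)) (f x ^+ 3).
  move=> xb; rewrite fE'// -gcE; first exact: is_derive_prim.
  by have /andP[? ?] := inn x xb; rewrite !ltW.
have var_le := var_exit_le cf f_gt0 ba0 m_gt df m_le' dpsi.
have muM : mean_exit f b a0 b <= M.
  apply: (le_trans mean_le); rewrite ler_wpM2r ?invr_ge0 ?(ltW m1)//.
  have pb : phi 0 <= phi b by rewrite ltW// phi_incr// ?in_itv/= /b; lra.
  have pa : phi a0 <= phi a by rewrite ltW// phi_incr// ?in_itv/= /a0; lra.
  by rewrite lerB.
have varV : var_exit f b a0 b <= V.
  apply: (le_trans var_le); rewrite ler_wpM2r//.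
    by rewrite invr_ge0 mulr_ge0 ?(ltW m3)// sqr_ge0.
  have b0 : prim 0 (fun x => gc x ^+ 3) 0 <= prim 0 (fun x => gc x ^+ 3) b.
    by apply: prim_le => //; rewrite /b; lra.
  have a00 : prim 0 (fun x => gc x ^+ 3) a0 <= prim 0 (fun x => gc x ^+ 3) a.
    by apply: prim_le => //; rewrite /a0; lra.
  by rewrite prim_base// in b0; lra.
have g_ge0 x : 0 <= x <= a -> 0 <= g x by move=> x0a; rewrite -gcE ?gc_ge0.
have delE x : del <= x <= a - del -> f x = g x.
  by move=> xd; rewrite fE//; move: xd; rewrite /l /u; lra.
have H := confined_prob_le Xd cgc gcE g_ge0 cf cg1c y00 f_ge delE df.
have {}H : fine (P (confined X e del (a - del) S)) * (S - e - mean_exit f b a0 b) ^+ 2 <=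
    var_exit f b a0 b.
  by apply: H => //; rewrite /b /a0; lra.
apply: le_trans varV; apply: le_trans H.
by rewrite ler_wpM2l ?fine_ge0// lerXn2r ?nnegrE; lra.
Qed.

Lemma hitting_time_tail (t : R) : never_returns_to_0 P X a -> M < t ->
  (P [set w | (t%:E < hitting_time X a w)%E] <= (V / (t - M) ^+ 2)%:E)%E.
Proof.
move=> ne Mt; have [filF _ [adX cX] _ aereg] := Xd.
have M_ge0 : 0 <= M.
  by rewrite divr_ge0 ?(ltW m1)// subr_ge0 ltW// phi_incr ?in_itv/= ?lexx ?ltW.
have t0 : 0 <= t by lra.
have V_ge0 : 0 <= V.
  apply: divr_ge0; last by rewrite mulr_ge0 ?sqr_ge0// ltW.
  by rewrite -[leLHS](prim_base 0 cgc3); apply: prim_le => //; exact: ltW.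
have mA := measurable_hitting_time_gt a filF adX cX t0.
rewrite -(fineK (fin_num_measure P _ mA)) lee_fin.
set u := fine _.
have tM : 0 < t - M by rewrite subr_gt0.
rewrite ler_pdivlMr ?exprn_gt0//.
(* The confinement bound loses the initial time [e]; the loss vanishes by continuity along
   [e = harmonic n]. *)
have := @continuous_harmonic_le _ (fun e => u * (t - e - M) ^+ 2) V.
rewrite subr0; apply.
  apply: continuousMT; first exact: continuousCT.
  apply: continuousXT; apply: continuousDT; last exact: continuousCT.
  by apply: continuousDT; [exact: continuousCT|apply: continuousNT => x; exact: cvg_id].
have [n0 _ Hn] := near_infty_natSinv_lt (PosNum tM).
exists n0 => // n /Hn; rewrite /harmonic /=.
have : 0 < n.+1%:R^-1 :> R by rewrite invr_gt0.
move: (n.+1%:R^-1) => e e0 etM.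
have eM : 0 < t - e - M by lra.
rewrite -ler_pdivlMr ?exprn_gt0// /u -lee_fin fineK ?fin_num_measure//.
pose del (k : nat) := a / 2 / k.+1%:R.
have del_gt0 k : 0 < del k by rewrite !divr_gt0.
have a2 : 0 < a / 2 by rewrite divr_gt0.
apply: (@survival_prob_le _ _ _ P F X a filF adX cX g B e t _ del (fun k => a - del k)) => //.
- lra.
- by rewrite divr_ge0// sqr_ge0.
- move=> k; have h : del k.+1 <= del k.
    by rewrite /del ler_wpM2l ?(ltW a2)// lef_pV2 ?posrE// ler_nat.
  by split=> //; lra.
- move=> r r0; have [k _ /(_ k (leqnn k)) /=] := near_infty_natSinv_lt (PosNum (divr_gt0 r0 a2)).
  rewrite ltr_pdivlMr// mulrC -/(del k) => h; exists k; split; lra.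
move=> k; rewrite ler_pdivlMr ?exprn_gt0//; apply: confined_prob_bound => //.
- rewrite del_gt0/= /del ler_pdivrMr// ler_peMr ?(ltW a2)// ler1n//.
- exact: ltW.
- lra.
Qed.

End tail_bound.

Theorem lemma17 (R : realType) (phi phi' phi'' : R -> R) (m : R)
    (phi_ge0 : forall x, x \in `[0, pi] -> 0 <= phi x)
    (phi_C2 : is_C2_on `[0, pi] phi phi' phi'')
    (phi_incr : {in `[0, pi] &, {homo phi : x y / x < y}})
    (phi'_gt0 : forall x, x \in `]0, pi[ -> 0 < phi' x)
    (entrance : entrance_boundary_0 (fun x => (phi' x)^-1) pi)
    (d : measure_display) (T : measurableType d) (P : probability T R)
    (F : R -> set (set T)) (B X : R -> T -> R)
    (X_diffusion : diffusion_from (fun x => (phi' x)^-1) pi 0 P F B X)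
    (phi_0 : phi 0 = 0)
    (m_min : is_min_on `[0, pi] phi'' m)
    (m_gt : - (1 / 3) < m)
    (r : R) (r_gt0 : 0 < r) :
  (P [set w | ((phi pi / (1 + m) * (1 + r))%:E < hitting_time X pi w)%E]
   <= (1 / (r ^+ 2 * phi pi ^+ 2 * (1 + 3 * m)))%:E
      * \int[lebesgue_measure]_(u in `[0%R, pi]) (phi' u ^+ 3)%:E)%E.
Proof.
have [dphi dphi' cphi''] := phi_C2.
have pi0 := @pi_gt0 R.
have g_gt0 x : 0 < x < pi -> 0 < phi' x by move=> x0; apply: phi'_gt0; rewrite in_itv.
have m_le x : 0 <= x <= pi -> m <= phi'' x.
  by move=> x0; apply: (m_min.2); rewrite /= in_itv.
have m1 : 0 < 1 + m by lra.
have m3 : 0 < 1 + 3 * m by lra.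
have phipi : 0 < phi pi.
  by rewrite -phi_0; apply: phi_incr => //; rewrite in_itv/= lexx ltW.
have ne := entrance.2 _ _ _ _ _ _ X_diffusion.
set t := phi pi / (1 + m) * (1 + r).
have Mt : (phi pi - phi 0) / (1 + m) < t.
  by rewrite phi_0 subr0 /t ltr_pMr ?divr_gt0// ltrDl.
have := hitting_time_tail pi0 X_diffusion dphi dphi' cphi'' phi_incr g_gt0 m_le m_gt ne Mt.
move=> /le_trans; apply.
(* [phi'] is controlled on [[0, pi]] only; its clamped version has the same integral there and is
   continuous on the line. *)
rewrite [X in (_ <= _ * X)%E](_ : _ =
    (\int[lebesgue_measure]_(u in `[0%R, pi]) (phi' (clamp 0 pi u) ^+ 3)%:E)%E); last first.
  by apply: eq_integral => u; rewrite inE/= in_itv/= => u0; rewrite clamp_id.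
rewrite integral_continuous_prim//; last first.
  apply: continuousXT; apply: continuous_clamp_comp; first exact: ltW.
  exact: derivative_on_continuous dphi'.
rewrite -EFinM lee_fin phi_0 subr0.
(* The distance to the mean bound carries a factor [1 / (1 + m)], whose square cancels the
   [(1 + m) ^ 2] of the variance bound. *)
rewrite (_ : t - phi pi / (1 + m) = phi pi * r / (1 + m)); last by rewrite /t; ring.
rewrite le_eqVlt; apply/orP; left; apply/eqP.
by field; rewrite !gt_eqF.
Qed.
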